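(* Let $T>0$ and $u_0,u_1\in L_0^2(\mathbb{T}^2)$. Then there exists $h\in L^2((0,T);L^2(\mathbb{T}^2))$ such that the solution $u$ of $$\partial_t u+\partial_x^3u+\partial_x^{-1}\partial_y^2u=\mathcal{G}h,\qquad u|_{t=0}=u_0,$$ on $(0,T)\times\mathbb{T}^2$ satisfies $u(T)=u_1$.
   Context: $\mathbb{T}=\mathbb{R}/(2\pi\mathbb{Z})$, with points of $\mathbb{T}^2$ written $(x,y)$. $L_0^2(\mathbb{T}^2)$ is the closed subspace of $v\in L^2(\mathbb{T}^2)$ whose Fourier coefficients satisfy $\widehat v(0,l)=0$ for all $l\in\mathbb{Z}$. On distributions $v$ with $\widehat v(0,l)=0$ for all $l$, $\partial_x^{-1}$ is the Fourier multiplier $\widehat{\partial_x^{-1}v}(k,l)=\frac{1}{ik}\widehat v(k,l)$, $k\neq0$. The control region is a vertical strip $\omega=(a,b)\times\mathbb{T}$, with $(a,b)$ a nonempty open interval of $\mathbb{T}$. A non-negative real-valued function $g\in C^2(\mathbb{T})$ is fixed with $\{x\in\mathbb{T}:g(x)>0\}=(a,b)$ and $\int_{\mathbb{T}}g=1$, and $$\mathcal{G}h(x,y):=g(x)\Big(h(x,y)-\int_{\mathbb{T}}g(x')h(x',y)\,dx'\Big),$$ applied at each time $t$ when $h$ depends on $t$. (Then $\mathcal{G}h$ has zero mean in $x$.) The solution is the mild solution $u\in C([0,T];L_0^2(\mathbb{T}^2))$, given by Duhamel's formula with the unitary group on $L_0^2(\mathbb{T}^2)$ generated by $-(\partial_x^3+\partial_x^{-1}\partial_y^2)$.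 *)

(* Defs.v *)
From mathcomp Require Import all_boot all_order all_algebra.
From mathcomp Require Import complex.
From mathcomp Require Import all_classical all_reals all_analysis.

Set Implicit Arguments.
Unset Strict Implicit.
Unset Printing Implicit Defensive.
Import Order.TTheory GRing.Theory Num.Theory.
Import numFieldNormedType.Exports.

Local Open Scope classical_set_scope.
Local Open Scope ring_scope.

(* The torus T = R/(2 pi Z) is represented by the fundamental domain [0, 2 pi[
   with Lebesgue measure (total mass 2 pi).  Only the values on that domain
   matter, up to a.e. equality, for a function standing for an element of
   L^2(T^2); such functions are complex-valued. *)

Definition torus (R : realType) : set (measurableTypeR R) := `[0, 2 * pi[.

Definition torus2 (R : realType) :
    set (measurableTypeR R * measurableTypeR R) :=
  @torus R `*` @torus R.

Local Notation leb1 R := (@lebesgue_measure R).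
Local Notation leb2 R := (@lebesgue_measure R \x @lebesgue_measure R)%E.

Definition field2 (R : realType) : Type :=
  measurableTypeR R * measurableTypeR R -> R[i].

Definition cintegral (R : realType) d (T : measurableType d)
    (mu : {measure set T -> \bar R}) (D : set T) (f : T -> R[i]) : R[i] :=
  Complex (\int[mu]_(x in D) complex.Re (f x))
          (\int[mu]_(x in D) complex.Im (f x)).

Definition cexp (R : realType) (z : R[i]) : R[i] :=
  (expR (complex.Re z))%:C%C *
  Complex (cos (complex.Im z)) (sin (complex.Im z)).

Definition L2norm (R : realType) (v : field2 R) : \bar R :=
  'N[leb2 R]_2%:E[(fun z => (Normc.normc (v z))%:E) \_ (@torus2 R)].

Definition L2 (R : realType) (v : field2 R) : Prop :=
  [/\ measurable_fun (@torus2 R) (fun z => complex.Re (v z)),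
      measurable_fun (@torus2 R) (fun z => complex.Im (v z)) &
      (L2norm v < +oo)%E].

Definition L2eq (R : realType) (v w : field2 R) : Prop :=
  {ae leb2 R, forall z, @torus2 R z -> v z = w z}.

Definition fourier (R : realType) (v : field2 R) (k l : int) : R[i] :=
  (((2 * pi) ^- 2 : R)%:C)%C *
  cintegral (leb2 R) (@torus2 R)
    (fun z => v z * cexp (- ('i%C * (k%:~R * z.1 + l%:~R * z.2)%:C%C))).

Definition L20 (R : realType) (v : field2 R) : Prop :=
  L2 v /\ forall l : int, fourier v 0 l = 0.

(* For a bounded symbol m, the representative chosen below exists, by
   Riesz-Fischer, and is unique up to a.e. equality. *)
Definition fourier_multiplier (R : realType) (m : int -> int -> R[i])
    (v : field2 R) : field2 R :=
  xget (fun=> 0)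
    [set w : measurableTypeR R * measurableTypeR R -> R[i] |
      L20 w /\ forall k l, fourier w k l = m k l * fourier v k l].

(* Symbol of -(dx^3 + dx^-1 dy^2).  Its value at k = 0 is irrelevant on
   L20. *)
Definition kp_symbol (R : realType) (k l : int) : R[i] :=
  let dx : R[i] := 'i%C * k%:~R in
  let dy : R[i] := 'i%C * l%:~R in
  - (dx ^+ 3 + dx^-1 * dy ^+ 2).

(* The unitary group generated on L20 by the multiplier operator kp_symbol:
   it multiplies the (k, l) mode by exp (t * kp_symbol k l). *)
Definition kp_group (R : realType) (t : R) : field2 R -> field2 R :=
  fourier_multiplier (fun k l => cexp (t%:C%C * kp_symbol R k l)).

(* The simple function \sum_i 1_(cell i) value_i from time to L^2(T^2). *)
Record L2simple (R : realType) := {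
  ncell : nat;
  cell : 'I_ncell -> set (measurableTypeR R);
  value : 'I_ncell -> field2 R;
  measurable_cell : forall i, measurable (cell i);
  L2_value : forall i, L2 (value i) }.

Definition simple_fun (R : realType) (s : L2simple R) (t : R) : field2 R :=
  fun z => \sum_(i < ncell s) (\1_(cell i) t)%:C%C * value i z.

Definition simple_integral (R : realType) (D : set (measurableTypeR R))
    (s : L2simple R) : field2 R :=
  fun z => \sum_(i < ncell s)
    ((fine (leb1 R (cell i `&` D)))%:C)%C * value i z.

Definition L2dist (R : realType) (v w : field2 R) : \bar R :=
  L2norm (fun z => v z - w z).

Definition simple_approx (R : realType) (D : set (measurableTypeR R))
    (s : nat -> L2simple R) (F : R -> field2 R) : Prop :=
  {ae leb1 R, forall t, D t ->
     L2dist (F t) (simple_fun (s n) t) @[n --> \oo] --> 0%E}.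

Definition strongly_measurable (R : realType) (D : set (measurableTypeR R))
    (F : R -> field2 R) : Prop :=
  (forall t, D t -> L2 (F t)) /\ exists s, simple_approx D s F.

(* w is the Bochner integral of F over D (D of finite measure), as an element
   of L^2(T^2). *)
Definition is_bochner_integral (R : realType) (D : set (measurableTypeR R))
    (F : R -> field2 R) (w : field2 R) : Prop :=
  [/\ forall t, D t -> L2 (F t), L2 w &
   exists s : nat -> L2simple R,
   [/\ simple_approx D s F,
       (\int[leb1 R]_(t in D) L2dist (F t) (simple_fun (s n) t))%E
         @[n --> \oo] --> 0%E &
       L2dist (simple_integral D (s n)) w @[n --> \oo] --> 0%E]].

Definition L2_time (R : realType) (T : R) (h : R -> field2 R) : Prop :=
  strongly_measurable `]0, T[ h /\
  (\int[leb1 R]_(t in `]0%R, T[) (L2norm (h t) ^+ 2) < +oo)%E.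

Definition mild_solution (R : realType) (T : R) (u0 : field2 R)
    (f u : R -> field2 R) : Prop :=
  [/\ forall t, t \in `[0, T] -> L20 (u t),
      forall t, t \in `[0, T] ->
        L2dist (u s) (u t) @[s --> within `[0, T] (nbhs t)] --> 0%E &
      forall t, t \in `[0, T] -> exists w : field2 R,
        is_bochner_integral `]0, t[ (fun s => kp_group (t - s) (f s)) w /\
        L2eq (u t) (fun z => kp_group t u0 z + w z)].

Definition C2 (R : realType) (g : R -> R) : Prop :=
  [/\ forall x, derivable g x 1,
      forall x, derivable (derive1 g) x 1 &
      continuous (derive1 (derive1 g))].

(* g is a 2 pi-periodic function on R, and the arc (a, b) of T lifts to the
   union of the intervals (a + 2 pi n, b + 2 pi n). *)
Definition control_profile (R : realType) (a b : R) (g : R -> R) : Prop :=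
  [/\ C2 g,
      forall x, g (x + 2 * pi) = g x,
      forall x, 0 <= g x,
      [set x | 0 < g x] =
        [set x | exists n : int, a < x - 2 * pi * n%:~R < b] &
      \int[leb1 R]_(x in @torus R) g x = 1].

Definition control_op (R : realType) (g : R -> R) (h : field2 R) : field2 R :=
  fun z => ((g z.1)%:C)%C *
    (h z - cintegral (leb1 R) (@torus R)
             (fun x' => ((g x')%:C)%C * h (x', z.2))).

(* Main.v *)
(* Duality. Let U be the unitary group, G the control operator, which is self-adjoint on
   L^2(T^2), and S x the integral over [0, T] of U(-s) G U(s) x. The control
   h(s) = U(s) x steers u0 to u1 as soon as S x = U(-T) u1 - u0, so it suffices that S be
   coercive on zero-mean functions: it is then inverted by a contraction.

   Coercivity is an observability inequality, uniform in the mode l in y, for sums of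
   exponentials in time with frequencies w k = k^3 - l^2 / k, weighted by the Gram matrix
   M k j = c (j - k) - c j * c (- k) of the exponentials exp (i k x) modulo constants in
   L^2(g dx), where c is the Fourier transform of g. If k and j have the same sign, then
   w k and w j are at least max(|k|, |j|)^2 apart; if they have opposite signs, then M k j
   is O(1 / max(|k|, |j|)^2) because g is C^2. High modes are therefore observed by
   diagonal dominance. The finitely many remaining modes k0 are added one at a time, at the
   price of an arbitrarily small increase of T: subtracting from the solution shifted in
   time its rotation by the frequency w k0 kills the modes with w k = w k0 and costs a
   uniform factor on the others, as w k and w k0 are equal or at least 1 / |k0| apart. At
   most two modes share the frequency w k0, and the 2 x 2 blocks of M are uniformly
   positive definite, by finite differences in x on an interval where g is positive. *)
Require Import Defs.
From HB Require Import structures.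
From mathcomp Require Import all_boot all_order all_algebra.
From mathcomp Require Import complex.
From mathcomp Require Import all_classical all_reals all_analysis.
From mathcomp Require Import measurable_realfun.
From mathcomp Require Import zify ring lra.
Set Implicit Arguments.
Unset Strict Implicit.
Unset Printing Implicit Defensive.
Import Order.TTheory GRing.Theory Num.Theory.
Import numFieldNormedType.Exports.
Local Open Scope classical_set_scope.
Local Open Scope ring_scope.
Local Notation Re := (@complex.Re _).
Local Notation Im := (@complex.Im _).

(** * Square-integrable functions *)

Section RealL2.
Context d (T : measurableType d) (R : realType) (mu : {measure set T -> \bar R}).
Variables (D : set T) (mD : measurable D).
Implicit Types f g : T -> R.

(** No gap between the frequencies is uniform in [l]: two modes [k], [j] of opposite signs have the
    same frequency as soon as [l ^ 2 = - k j (k ^ 2 + k j + j ^ 2)], and can come close otherwise,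
    so an inequality of Ingham type does not apply. Treating one [l] at a time by compactness gives
    no common constant either. Hence the smoothness of [g] stands in for the missing gap, and the
    low modes are recovered by an explicit procedure whose number of steps does not depend on [l].
    The separation [1 / |k0|] used there is arithmetic: for opposite signs the difference of
    frequencies is proportional to a nonzero integer. Elements of L^2 are functions, not classes, so
    inner products are semidefinite and equality of vectors reads [nrm (x - y) = 0], proved by
    comparing Fourier coefficients. Time integrals of vectors are defined by their coefficients too;
    Bochner integrals enter only at the end, for uniformly continuous integrands. Inequalities
    between time integrals of finite exponential sums are obtained from explicit primitives, by
    comparing derivatives. *)

Definition sqint f :=
  measurable_fun D f /\ mu.-integrable D (fun x => (f x ^+ 2)%:E).

Lemma sqintM f g : sqint f -> sqint g ->
  mu.-integrable D (fun x => (f x * g x)%:E).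
Proof.
move=> [mf f2] [mg g2].
apply: (le_integrable mD _ _ (integrableD mD f2 g2)).
  by apply/measurable_EFinP; exact: measurable_funM.
move=> x Dx /=; rewrite lee_fin (ger0_norm (addr_ge0 (sqr_ge0 _) (sqr_ge0 _))).
by rewrite ler_norml; nra.
Qed.

Lemma sqint_lin a b f g : sqint f -> sqint g -> sqint (fun x => a * f x + b * g x).
Proof.
move=> hf hg; have [mf f2] := hf; have [mg g2] := hg; split.
  by apply: measurable_funD; apply: measurable_funM.
rewrite (_ : (fun _ => _) =
    (fun x => (a ^+ 2)%:E * (f x ^+ 2)%:E + ((2 * a * b)%:E * (f x * g x)%:E
      + (b ^+ 2)%:E * (g x ^+ 2)%:E))%E); last first.
  by apply/funext => x; rewrite -!EFinM -!EFinD; congr EFin; ring.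
apply: (integrableD mD); first exact: integrableZl.
by apply: (integrableD mD); apply: (integrableZl mD) => //; exact: sqintM.
Qed.

Lemma sqintB f g : sqint f -> sqint g -> sqint (fun x => f x - g x).
Proof.
move=> hf hg; have := sqint_lin 1 (-1) hf hg.
by congr sqint; apply/funext => x; rewrite mul1r mulN1r.
Qed.

(* Fatou along an a.e. convergent subsequence; weighting the squared increments
   of the subsequence by 4^k makes their sum integrable, so that no finiteness of
   mu is needed. *)
Lemma sqint_complete (u : nat -> T -> R) : (forall n, sqint (u n)) ->
  (forall e, 0 < e -> exists N, forall n m, (N <= n)%N -> (N <= m)%N ->
     \int[mu]_(x in D) ((u n x - u m x) ^+ 2) <= e) ->
  exists v, sqint v /\ (forall e, 0 < e -> exists N, forall n, (N <= n)%N ->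
     \int[mu]_(x in D) ((u n x - v x) ^+ 2) <= e).
Proof.
move=> hu cau.
have hB n m : sqint (fun x => u n x - u m x) by exact: sqintB.
have mu_ n : measurable_fun D (u n) by have [] := hu n.
have e0 k : 0 < (1 / 2 : R) ^+ k by rewrite exprn_gt0// divr_gt0.
(* Beyond rank [N0 k] the squared distances are at most [16 ^ (- k)]; after the weight [4 ^ k] there
   remains [4 ^ (- k)], which is still summable. *)
pose N0 k := sval (cid (cau _ (e0 (4 * k)%N))).
have N0P k n m : (N0 k <= n)%N -> (N0 k <= m)%N ->
    \int[mu]_(x in D) ((u n x - u m x) ^+ 2) <= (1 / 2) ^+ (4 * k).
  exact: (svalP (cid (cau _ (e0 (4 * k)%N)))).
pose s := fix s k := if k is k'.+1 then maxn (N0 k) (maxn k (s k')) else N0 0.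
have sN k : (N0 k <= s k)%N by case: k => //= k; rewrite leq_maxl.
have sS k : (s k <= s k.+1)%N by rewrite /= !leq_max leqnn !orbT.
have sk k : (k <= s k)%N by case: k => //= k; rewrite !leq_max leqnn !orbT.
pose w k x := u (s k.+1) x - u (s k) x.
pose G x := (\sum_(0 <= k <oo) ((4 ^+ k) * (w k x) ^+ 2)%:E)%E.
have mw k : measurable_fun D (w k) by have [] := hB (s k.+1) (s k).
have mG_ k : measurable_fun D (fun x => (4 ^+ k * (w k x) ^+ 2)%:E).
  apply/measurable_EFinP; apply: measurable_funM => //.
  exact: measurable_funX.
have G0_ k x : D x -> (0 <= (4 ^+ k * (w k x) ^+ 2)%:E)%E.
  by move=> _; rewrite lee_fin mulr_ge0 ?sqr_ge0 ?exprn_ge0 ?ler0n.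
have mG : measurable_fun D G.
  apply: ge0_emeasurable_sum => [k x Dx _|k _]; [exact: G0_|exact: mG_].
have Gfin : {ae mu, forall x, D x -> G x \is a fin_num}.
  apply: (integrable_ae mD); apply/integrableP; split => //.
  rewrite (eq_integral G); last first.
    move=> x /set_mem Dx; rewrite gee0_abs//.
    by apply: nneseries_ge0 => k _ _; exact: G0_.
  rewrite integral_nneseries//.
  apply: (@le_lt_trans _ _ (\sum_(0 <= k <oo) ((1 / (2 ^ (k + 0.+1))%:R) * 2)%:E)%E).
    apply: lee_nneseries => [k _ _|k _].
      by apply: integral_ge0 => x; exact: G0_.
    have [_ iw] := hB (s k.+1) (s k).
    under eq_integral do rewrite EFinM.
    rewrite integralZl//.
    rewrite -[X in (_ * X <= _)%E]fineK; last first.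
      exact: (integrable_fin_num mD iw).
    rewrite -EFinM lee_fin.
    have := N0P k (s k.+1) (s k) (leq_trans (sN k) (sS k)) (sN k).
    rewrite /Rintegral => h.
    have h4 : 4 ^+ k * (1 / 2) ^+ (4 * k) <= 1 / (2 ^ (k + 1))%:R * 2 :> R.
      rewrite exprM -exprMn natrX exprD expr1 (_ : 1 / (2 ^+ k * 2) * 2 = (1 / 2) ^+ k).
        by apply: lerXn2r; rewrite ?nnegrE; lra.
      by rewrite expr_div_n expr1n; field; rewrite expf_neq0.
    by apply: le_trans h4; apply: ler_wpM2l => //; apply: exprn_ge0.
  have := @cvg_geometric_eseries_half R 1 0.
  move=> /(@cvg_lim _ _) => /(_ (@ereal_hausdorff R)) h.
  rewrite (_ : (\sum_(0 <= k <oo) _ = 2%:E * \sum_(0 <= k <oo) (1 / (2 ^ (k + 0.+1))%:R)%:E)%E); last first.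
    rewrite -nneseriesZl//.
      by apply: eq_eseriesr => k _; rewrite -EFinM mulrC.
  by rewrite h -EFinM ltry.
pose us k x := (u (s k) x)%:E.
(* An upper limit is measurable whether or not the sequence converges; off a null set it is the
   limit, and [fine] sends infinite values to 0. *)
pose v x := fine (limn_esup (us ^~ x)).
have mv : measurable_fun D v.
  apply/(measurableT_comp (@fine_measurable R setT measurableT)).
  apply: measurable_realfun.measurable_fun_limn_esup => k.
  by apply/measurable_EFinP.
have vP : {ae mu, forall x, D x -> us k x @[k --> \oo] --> (v x)%:E}.
  apply: filterS Gfin => x h Dx; have {h} := h Dx => Gx.
  (* Each term of the series [G x] is at most its sum, so the increments at [x] decay
     geometrically. *)
  have wle k : `|w k x| <= (1 / 2) ^+ k * Num.sqrt (fine (G x)).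
    have h1 : 4 ^+ k * w k x ^+ 2 <= fine (G x).
      rewrite -lee_fin fineK//.
      apply: (@le_trans _ _ (\sum_(0 <= j < k.+1) ((4 ^+ j) * (w j x) ^+ 2)%:E)); last first.
        by apply: (@nneseries_lim_ge _ (fun j => (4 ^+ j * w j x ^+ 2)%:E) xpredT 0) => j _ _; exact: G0_.
      rewrite big_mkord big_ord_recr/=.
      by rewrite leeDr// sume_ge0// => i _; exact: G0_.
    rewrite -(ler_sqr) ?nnegrE ?mulr_ge0 ?exprn_ge0 ?sqrtr_ge0//.
    rewrite real_normK ?num_real// exprMn sqr_sqrtr; last first.
      by apply: le_trans h1; rewrite mulr_ge0 ?sqr_ge0 ?exprn_ge0.
    rewrite -exprM mulnC exprM (_ : (1 / 2) ^+ 2 = 4^-1); last by field.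
    by rewrite exprVn -ler_pdivrMl ?invr_gt0 ?exprn_gt0// invrK.
  have cw : cvgn (series (fun k => w k x)).
    apply: normed_cvg.
    apply: (@series_le_cvg _ _ (geometric (Num.sqrt (fine (G x))) (1 / 2))).
    - by move=> n; rewrite normr_ge0.
    - by move=> n; rewrite /geometric/= mulr_ge0 ?sqrtr_ge0 ?exprn_ge0.
    - by move=> n /=; rewrite mulrC.
    - by apply: is_cvg_geometric_series; rewrite ger0_norm; lra.
  have cu : cvgn (fun k => u (s k) x).
    have E : (fun k => u (s k) x) = (fun k => u (s 0) x + series (fun k => w k x) k).
      apply/funext => k; rewrite /series/= telescope_sumr//.
      by rewrite addrC subrK.
    by rewrite E; apply: is_cvgD => //; exact: is_cvg_cst.
  have cE : us k x @[k --> \oo] --> (limn (fun k => u (s k) x))%:E.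
    by apply: cvg_EFin; [exact: nearW|exact: cu].
  have := cvg_limn_einf_sup cE => -[_ hs].
  by rewrite /v hs.
have hint n k : mu.-integrable D (fun x => ((u n x - u (s k) x) ^+ 2)%:E).
  by have [] := hB n (s k).
(* Fatou's lemma along [s (n + k)]: the shift keeps all indices at least [n], where the assumed
   bound holds. *)
have key e n : (forall k, (n <= k)%N -> \int[mu]_(x in D) ((u n x - u k x) ^+ 2) <= e) ->
    (\int[mu]_(x in D) ((u n x - v x) ^+ 2)%:E <= e%:E)%E.
  move=> he; pose h k x := ((u n x - u (s (n + k)%N) x) ^+ 2)%:E.
  have mf k : measurable_fun D (h k).
    by have [_ /integrableP[]] := hB n (s (n + k)%N).
  have f0 k x : D x -> (0 <= h k x)%E by rewrite lee_fin sqr_ge0.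
  have mlim : measurable_fun D (fun x => ((u n x - v x) ^+ 2)%:E).
    by apply/measurable_EFinP; apply: measurable_funX; exact: measurable_funB.
  have := fatou mu mD mf f0.
  rewrite (@ae_eq_integral _ _ _ _ _ (fun x => ((u n x - v x) ^+ 2)%:E))//; last 2 first.
  - rewrite (_ : (fun _ => _) =
        (fun x => - limn_esup (fun k => - h k x)))%E; last first.
      by apply/funext => x; rewrite (limn_esupN (h ^~ x)) oppeK.
    apply: measurableT_comp => //.
    apply: measurable_realfun.measurable_fun_limn_esup => k.
    exact: measurableT_comp.
  - apply: filterS vP => x hx Dx; have {hx}hx := hx Dx.
    have c1 : h k x @[k --> \oo] --> ((u n x - v x) ^+ 2)%:E.
      have /fine_cvg/= c : us k x @[k --> \oo] --> (v x)%:E by [].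
      have c' : u (s (n + k)%N) x @[k --> \oo] --> v x.
        have E : (fun k => u (s (n + k)%N) x) = (fun k => u (s (k + n)%N) x).
          by apply/funext => k; rewrite addnC.
        by rewrite E (cvg_shiftn n (fun k => u (s k) x : R)).
      apply: cvg_EFin; first exact: nearW.
      by rewrite expr2; under eq_cvg do rewrite /= expr2; apply: cvgM; apply: cvgB => //; exact: cvg_cst.
    by have [] := cvg_limn_einf_sup c1.
  move=> /le_trans; apply.
  rewrite limn_einf_lim; apply: lime_le; first exact: is_cvg_einfs.
  apply: nearW => k; apply: le_trans (ereal_inf_lbound _) _.
    by exists k => /=.
  rewrite -[leLHS]fineK ?lee_fin.
    by apply: he; apply: leq_trans (sk _); rewrite leq_addr.
  by apply: (integrable_fin_num mD); have [] := hB n (s (n + k)%N).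
have vd n e : (forall k, (n <= k)%N -> \int[mu]_(x in D) ((u n x - u k x) ^+ 2) <= e) ->
    sqint (fun x => u n x - v x) /\ \int[mu]_(x in D) ((u n x - v x) ^+ 2) <= e.
  move=> /key h; have m1 : measurable_fun D (fun x => u n x - v x) by exact: measurable_funB.
  have i1 : mu.-integrable D (fun x => ((u n x - v x) ^+ 2)%:E).
    apply/integrableP; split; first by apply/measurable_EFinP; exact: measurable_funX.
    under eq_integral do rewrite gee0_abs ?lee_fin ?sqr_ge0//.
    exact: le_lt_trans h (ltry _).
  split => //; rewrite -lee_fin /Rintegral fineK//.
  exact: integrable_fin_num.
exists v; split.
  have [N hN] := cau 1 ltr01.
  have [hs _] := vd N 1 (fun k => hN N k (leqnn N)).
  have := sqintB (hu N) hs; congr sqint; apply/funext => x; ring.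
move=> e e0'; have [N hN] := cau e e0'; exists N => n Nn.
by have [] := vd n e (fun k nk => hN n k Nn (leq_trans Nn nk)).
Qed.
End RealL2.

Section ComplexNumbers.
Variable R : realType.
Implicit Types z w : R[i].

(** Real-valued, so that it can be integrated and compared in [R], whereas the norm of [R[i]] takes
    its values in [R[i]]. *)
Definition normsq z : R := Re z ^+ 2 + Im z ^+ 2.

Lemma complexP z w : Re z = Re w -> Im z = Im w -> z = w.
Proof. by case: z w => [a b] [c e] /= -> ->. Qed.

Lemma ReD z w : Re (z + w) = Re z + Re w. Proof. by case: z w => [? ?] []. Qed.
Lemma ImD z w : Im (z + w) = Im z + Im w. Proof. by case: z w => [? ?] []. Qed.
Lemma ReN z : Re (- z) = - Re z. Proof. by case: z. Qed.
Lemma ImN z : Im (- z) = - Im z. Proof. by case: z. Qed.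
Lemma ReM z w : Re (z * w) = Re z * Re w - Im z * Im w.
Proof. by case: z w => [? ?] []. Qed.
Lemma ImM z w : Im (z * w) = Re z * Im w + Im z * Re w.
Proof. by case: z w => [? ?] []. Qed.
Lemma ReJ z : Re z^*%C = Re z. Proof. by case: z. Qed.
Lemma ImJ z : Im z^*%C = - Im z. Proof. by case: z. Qed.
Lemma Re_sum (I : Type) (s : seq I) (P : pred I) (F : I -> R[i]) :
  Re (\sum_(i <- s | P i) F i) = \sum_(i <- s | P i) Re (F i).
Proof. by elim/big_rec2: _ => //= i y x _ <-; rewrite ReD. Qed.
Definition cE := (ReD, ImD, ReN, ImN, ReM, ImM, ReJ, ImJ).

Lemma normsq_ge0 z : 0 <= normsq z. Proof. by rewrite addr_ge0 ?sqr_ge0. Qed.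
Lemma normsqM z w : normsq (z * w) = normsq z * normsq w.
Proof. by rewrite /normsq !cE; ring. Qed.
Lemma normsq_eq0 z : normsq z = 0 -> z = 0.
Proof.
move=> h; have h1 := sqr_ge0 (Re z); have h2 := sqr_ge0 (Im z).
rewrite /normsq in h.
by apply: complexP => /=; apply/eqP; rewrite -sqrf_eq0; apply/eqP; lra.
Qed.
Lemma normsqN z : normsq (- z) = normsq z.
Proof. by rewrite /normsq !cE !sqrrN. Qed.
Lemma normsqJ z : normsq z^*%C = normsq z.
Proof. by rewrite /normsq !cE sqrrN. Qed.
Lemma mulcJ z : z * z^*%C = (normsq z)%:C%C.
Proof. by apply: complexP; rewrite !cE /normsq /=; ring. Qed.

Definition cis (t : R) : R[i] := Complex (cos t) (sin t).

Lemma cisD s t : cis (s + t) = cis s * cis t.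
Proof. by apply: complexP; rewrite !cE /= ?cosD ?sinD; ring. Qed.
Lemma cis0 : cis 0 = 1.
Proof. by apply: complexP; rewrite /= ?cos0 ?sin0. Qed.
Lemma cisN t : cis (- t) = (cis t)^*%C.
Proof. by apply: complexP; rewrite /= ?cosN ?sinN. Qed.
Lemma normsq_cis t : normsq (cis t) = 1.
Proof. by rewrite /normsq /= cos2Dsin2. Qed.
Lemma mulcisN t : cis t * cis (- t) = 1.
Proof. by rewrite -cisD subrr cis0. Qed.
Lemma cexp_iR (t : R) : cexp ('i%C * t%:C%C) = cis t.
Proof.
have E : 'i%C * t%:C%C = Complex 0 t.
  by apply: complexP; rewrite !cE /=; ring.
by rewrite /cexp E /= expR0 mul1r.
Qed.

End ComplexNumbers.

Section RealIntegrable.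
Context d (T : measurableType d) (R : realType) (mu : {measure set T -> \bar R}).
Variables (D : set T) (mD : measurable D).
Implicit Types f g : T -> R.

Lemma rintegrableD f g : mu.-integrable D (EFin \o f) -> mu.-integrable D (EFin \o g) ->
  mu.-integrable D (EFin \o (fun x => f x + g x)).
Proof. by move=> hf hg; have := integrableD mD hf hg. Qed.

Lemma rintegrableB f g : mu.-integrable D (EFin \o f) -> mu.-integrable D (EFin \o g) ->
  mu.-integrable D (EFin \o (fun x => f x - g x)).
Proof. by move=> hf hg; have := integrableB mD hf hg. Qed.

Lemma rintegrableZ a f : mu.-integrable D (EFin \o f) ->
  mu.-integrable D (EFin \o (fun x => a * f x)).
Proof. by move=> hf; have := integrableZl mD a hf. Qed.

End RealIntegrable.

Section Cintegral.
Context d (T : measurableType d) (R : realType) (mu : {measure set T -> \bar R}).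
Variables (D : set T) (mD : measurable D).
Implicit Types f g : T -> R[i].

Definition cintble f :=
  mu.-integrable D (fun x => (Re (f x))%:E) /\ mu.-integrable D (fun x => (Im (f x))%:E).

Lemma cintble_lin a f g : cintble f -> cintble g -> cintble (fun x => a * f x + g x).
Proof.
move=> [f1 f2] [g1 g2]; split.
  rewrite (_ : (fun _ => _) = (fun x => ((Re a)%:E * (Re (f x))%:E - (Im a)%:E * (Im (f x))%:E)
    + (Re (g x))%:E)%E); last by apply/funext => x; rewrite !cE.
  by apply: integrableD => //; apply: integrableB => //; exact: integrableZl.
rewrite (_ : (fun _ => _) = (fun x => ((Re a)%:E * (Im (f x))%:E + (Im a)%:E * (Re (f x))%:E)
  + (Im (g x))%:E)%E); last by apply/funext => x; rewrite !cE.
by apply: integrableD => //; apply: integrableD => //; exact: integrableZl.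
Qed.

Lemma cintegral_lin a f g : cintble f -> cintble g ->
  cintegral mu D (fun x => a * f x + g x) = a * cintegral mu D f + cintegral mu D g.
Proof.
move=> [f1 f2] [g1 g2]; apply: complexP; rewrite !cE /=.
  under eq_Rintegral do rewrite !cE.
  rewrite RintegralD//; last by apply: (rintegrableB mD); exact: rintegrableZ.
  by rewrite RintegralB ?RintegralZl//; exact: rintegrableZ.
under eq_Rintegral do rewrite !cE.
rewrite RintegralD//; last by apply: (rintegrableD mD); exact: rintegrableZ.
by rewrite RintegralD ?RintegralZl//; exact: rintegrableZ.
Qed.

Lemma cintegral_conj f : cintble f ->
  cintegral mu D (fun x => (f x)^*%C) = (cintegral mu D f)^*%C.
Proof.
move=> [f1 f2]; apply: complexP; rewrite !cE /=.
  by under eq_Rintegral do rewrite !cE.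
under eq_Rintegral do rewrite !cE -mulN1r.
by rewrite RintegralZl// mulN1r.
Qed.

Lemma cintble0 : cintble (fun=> 0).
Proof. by split; apply: integrable0. Qed.

Lemma cintbleZ a f : cintble f -> cintble (fun x => a * f x).
Proof.
move=> hf; have := cintble_lin a hf cintble0.
by congr cintble; apply/funext => x; rewrite addr0.
Qed.

Lemma cintegral0 : cintegral mu D (fun=> 0 : R[i]) = 0.
Proof. by apply: complexP => /=; rewrite Rintegral_cst// mul0r. Qed.

Lemma cintegralZ a f : cintble f ->
  cintegral mu D (fun x => a * f x) = a * cintegral mu D f.
Proof.
move=> hf; have := cintegral_lin a hf cintble0; rewrite cintegral0 addr0 => <-.
by congr cintegral; apply/funext => x; rewrite addr0.
Qed.

Lemma cintegralB f g : cintble f -> cintble g ->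
  cintegral mu D (fun x => f x - g x) = cintegral mu D f - cintegral mu D g.
Proof.
move=> hf hg; have := cintegral_lin (-1) hg hf; rewrite mulN1r addrC => <-.
by congr cintegral; apply/funext => x; rewrite mulN1r addrC.
Qed.

Lemma cintbleB f g : cintble f -> cintble g -> cintble (fun x => f x - g x).
Proof.
move=> hf hg; have := cintble_lin (-1) hg hf.
by congr cintble; apply/funext => x; rewrite mulN1r addrC.
Qed.

Lemma cintble_sum (I : Type) (s : seq I) (F : I -> T -> R[i]) :
  (forall i, cintble (F i)) -> cintble (fun x => \sum_(i <- s) F i x).
Proof.
move=> h; elim: s => [|i s IH].
  by under eq_fun do rewrite big_nil; exact: cintble0.
under eq_fun do rewrite big_cons -[F i _]mul1r.
exact: cintble_lin.
Qed.

Lemma cintegral_sum (I : Type) (s : seq I) (F : I -> T -> R[i]) :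
  (forall i, cintble (F i)) ->
  cintegral mu D (fun x => \sum_(i <- s) F i x) = \sum_(i <- s) cintegral mu D (F i).
Proof.
move=> h; elim: s => [|i s IH].
  by rewrite big_nil; under eq_fun do rewrite big_nil; exact: cintegral0.
rewrite big_cons -IH; under eq_fun do rewrite big_cons -[F i _]mul1r.
by rewrite cintegral_lin ?mul1r//; exact: cintble_sum.
Qed.

Lemma eq_cintegral f g : {in D, f =1 g} -> cintegral mu D f = cintegral mu D g.
Proof.
by move=> fg; apply: complexP => /=; apply: eq_Rintegral => x xD; rewrite fg.
Qed.

End Cintegral.

Section L2space.
Context d (T : measurableType d) (R : realType) (mu : {measure set T -> \bar R}).
Variables (D : set T) (mD : measurable D).

Definition csqint (f : T -> R[i]) :=
  sqint mu D (fun x => Re (f x)) /\ sqint mu D (fun x => Im (f x)).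

Lemma csqint_lin a f g : csqint f -> csqint g -> csqint (fun x => a * f x + g x).
Proof.
move=> [f1 f2] [g1 g2]; split.
  have h := sqint_lin mD 1 1 (sqint_lin mD (Re a) (- Im a) f1 f2) g1.
  by move: h; congr sqint; apply/funext => x; rewrite !cE; ring.
have h := sqint_lin mD 1 1 (sqint_lin mD (Re a) (Im a) f2 f1) g2.
by move: h; congr sqint; apply/funext => x; rewrite !cE; ring.
Qed.

Lemma csqint0 : csqint (fun=> 0).
Proof.
split; split; try exact: measurable_cst.
  by under eq_fun do rewrite /= expr0n/=; exact: integrable0.
by under eq_fun do rewrite /= expr0n/=; exact: integrable0.
Qed.

Lemma csqintM f g : csqint f -> csqint g -> cintble mu D (fun x => f x * (g x)^*%C).
Proof.
move=> [f1 f2] [g1 g2]; split.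
  rewrite (_ : (fun _ => _) = (fun x => (Re (f x) * Re (g x))%:E + (Im (f x) * Im (g x))%:E)%E).
    by apply: integrableD => //; exact: sqintM.
  by apply/funext => x; rewrite !cE mulrN opprK.
rewrite (_ : (fun _ => _) = (fun x => (Im (f x) * Re (g x))%:E - (Re (f x) * Im (g x))%:E)%E).
  by apply: integrableB => //; exact: sqintM.
by apply/funext => x; rewrite !cE -EFinB; congr EFin; ring.
Qed.

Definition l2pred : {pred T -> R[i]} := fun f => `[< csqint f >].

Lemma l2_submod_closed : submod_closed l2pred.
Proof.
split; first by apply/asboolP; exact: csqint0.
by move=> a f g /asboolP hf /asboolP hg; apply/asboolP; exact: csqint_lin.
Qed.

End L2space.

(** Genuine functions, with the pointwise module structure inherited through [l2pred]. Functions
    equal almost everywhere stay distinct and values outside [D] are arbitrary, hence an inner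
    product that is only semidefinite. *)
Record l2fun d (T : measurableType d) (R : realType) (mu : {measure set T -> \bar R})
  (D : set T) (mD : measurable D) :=
  L2Fun { l2val :> T -> R[i]; l2valP : l2val \in l2pred mu D }.

Section L2type.
Context d (T : measurableType d) (R : realType) (mu : {measure set T -> \bar R}).
Variables (D : set T) (mD : measurable D).
Local Notation E := (l2fun mu mD).

HB.instance Definition _ := [isSub for @l2val d T R mu D mD].
HB.instance Definition _ := [Choice of E by <:].
HB.instance Definition _ := GRing.isSubmodClosed.Build _ _ (l2pred mu D)
  (l2_submod_closed mu mD).
HB.instance Definition _ := [SubChoice_isSubLmodule of E by <:].

Lemma l2fun_csqint (f : E) : csqint mu D f.
Proof. by have /asboolP := l2valP f. Qed.

Definition mkl2 (f : T -> R[i]) (hf : csqint mu D f) : E := L2Fun mD (asboolT hf).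

Lemma l2_linE a (f g : E) x : (a *: f + g) x = a * f x + g x.
Proof. by []. Qed.
Lemma l2_subE (f g : E) x : (f - g) x = f x - g x.
Proof. by []. Qed.
Lemma l2_addE (f g : E) x : (f + g) x = f x + g x.
Proof. by []. Qed.

Lemma l2_sumE (I : Type) (s : seq I) (F : I -> E) x :
  (\sum_(i <- s) F i) x = \sum_(i <- s) F i x.
Proof. by elim/big_rec2: _ => //= i y z _ <-. Qed.

Definition l2_ip (f g : E) : R[i] := cintegral mu D (fun x => f x * (g x)^*%C).

Lemma l2_ip_lin a f g h : l2_ip (a *: f + g) h = a * l2_ip f h + l2_ip g h.
Proof.
rewrite /l2_ip -cintegral_lin//; try by apply: csqintM => //; exact: l2fun_csqint.
by apply: eq_cintegral => x _; rewrite l2_linE mulrDl mulrA.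
Qed.

Lemma l2_ipC f g : l2_ip g f = (l2_ip f g)^*%C.
Proof.
rewrite /l2_ip -cintegral_conj//; last by apply: csqintM => //; exact: l2fun_csqint.
by apply: eq_cintegral => x _; rewrite rmorphM/= conjcK mulrC.
Qed.

Lemma l2_ipxx f : l2_ip f f = (\int[mu]_(x in D) normsq (f x))%:C%C.
Proof.
apply: complexP => /=.
  by apply: eq_Rintegral => x _; rewrite !cE /normsq mulrN opprK !expr2.
under eq_Rintegral do rewrite !cE mulrN mulrC addNr.
by rewrite Rintegral_cst// mul0r.
Qed.

Lemma l2_ip_ge0 f : 0 <= Re (l2_ip f f).
Proof. by rewrite l2_ipxx /= Rintegral_ge0// => x _; exact: normsq_ge0. Qed.

Lemma Rintegral_normsq (f : T -> R[i]) : csqint mu D f ->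
  \int[mu]_(x in D) normsq (f x) =
  \int[mu]_(x in D) (Re (f x) ^+ 2) + \int[mu]_(x in D) (Im (f x) ^+ 2).
Proof. by move=> [[m1 f1] [m2 f2]]; rewrite -RintegralD. Qed.

Lemma l2_complete (u : nat -> E) :
  (forall e, 0 < e -> exists N, forall n m, (N <= n)%N -> (N <= m)%N ->
     Re (l2_ip (u n - u m) (u n - u m)) <= e) ->
  exists v : E, forall e, 0 < e -> exists N, forall n, (N <= n)%N ->
     Re (l2_ip (u n - v) (u n - v)) <= e.
Proof.
move=> cau; have hu n := l2fun_csqint (u n).
have dE (f g : E) : Re (l2_ip (f - g) (f - g)) =
    \int[mu]_(x in D) ((Re (f x) - Re (g x)) ^+ 2) +
    \int[mu]_(x in D) ((Im (f x) - Im (g x)) ^+ 2).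
  transitivity (\int[mu]_(x in D) normsq ((f - g) x)); first by rewrite l2_ipxx.
  rewrite Rintegral_normsq; last exact: l2fun_csqint.
  by congr (_ + _); apply: eq_Rintegral => x _; rewrite l2_subE !cE.
have g0 (f g : T -> R) : 0 <= \int[mu]_(x in D) ((f x - g x) ^+ 2).
  by apply: Rintegral_ge0 => x _; exact: sqr_ge0.
have [v1 [hv1 c1]] : exists v, sqint mu D v /\ (forall e, 0 < e -> exists N, forall n, (N <= n)%N ->
     \int[mu]_(x in D) ((Re (u n x) - v x) ^+ 2) <= e).
  apply: (@sqint_complete _ _ _ _ _ _ (fun n x => Re (u n x))) => // [n|e e0].
    by have [] := hu n.
  have [N hN] := cau e e0; exists N => n m Nn Nm; have := hN n m Nn Nm.
  by rewrite dE; apply: le_trans; rewrite lerDl.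
have [v2 [hv2 c2]] : exists v, sqint mu D v /\ (forall e, 0 < e -> exists N, forall n, (N <= n)%N ->
     \int[mu]_(x in D) ((Im (u n x) - v x) ^+ 2) <= e).
  apply: (@sqint_complete _ _ _ _ _ _ (fun n x => Im (u n x))) => // [n|e e0].
    by have [] := hu n.
  have [N hN] := cau e e0; exists N => n m Nn Nm; have := hN n m Nn Nm.
  by rewrite dE; apply: le_trans; rewrite lerDr.
have hv : csqint mu D (fun x => Complex (v1 x) (v2 x)) by [].
exists (mkl2 hv) => e e0; have e2 : 0 < e / 2 by rewrite divr_gt0.
have [N1 h1] := c1 _ e2; have [N2 h2] := c2 _ e2; exists (maxn N1 N2) => n.
rewrite geq_max => /andP[n1 n2]; rewrite dE.
by have := h1 n n1; have := h2 n n2 => /=; lra.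
Qed.

End L2type.

(** * Hilbert bases *)

Section Cabs.
Variable R : realType.
Implicit Types z w : R[i].

Definition cabs z : R := Num.sqrt (normsq z).

Lemma cabs_ge0 z : 0 <= cabs z. Proof. exact: sqrtr_ge0. Qed.
Lemma cabs_sq z : cabs z ^+ 2 = normsq z.
Proof. by rewrite sqr_sqrtr ?normsq_ge0. Qed.
Lemma normcE z : Normc.normc z = cabs z. Proof. by case: z. Qed.
Lemma cabsM z w : cabs (z * w) = cabs z * cabs w.
Proof. by rewrite /cabs normsqM sqrtrM ?normsq_ge0. Qed.
Lemma cabsD z w : cabs (z + w) <= cabs z + cabs w.
Proof. by rewrite -!normcE; exact: le_normcD. Qed.
Lemma cabsN z : cabs (- z) = cabs z. Proof. by rewrite /cabs normsqN. Qed.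
Lemma cabsJ z : cabs z^*%C = cabs z. Proof. by rewrite /cabs normsqJ. Qed.
Lemma cabs_cis t : cabs (cis t : R[i]) = 1.
Proof. by rewrite /cabs normsq_cis sqrtr1. Qed.
Lemma cabs_real (x : R) : cabs x%:C%C = `|x|.
Proof. by rewrite /cabs /normsq /= [0 ^+ _]expr0n addr0 sqrtr_sqr. Qed.
Lemma ler_Re_cabs z : `|Re z| <= cabs z.
Proof.
by rewrite -(ler_sqr) ?nnegrE ?cabs_ge0// cabs_sq real_normK ?num_real// lerDl sqr_ge0.
Qed.
Lemma ler_Im_cabs z : `|Im z| <= cabs z.
Proof.
by rewrite -(ler_sqr) ?nnegrE ?cabs_ge0// cabs_sq real_normK ?num_real// lerDr sqr_ge0.
Qed.
Lemma cabs_le z : cabs z <= `|Re z| + `|Im z|.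
Proof.
rewrite -ler_sqr ?nnegrE ?cabs_ge0 ?addr_ge0// cabs_sq /normsq -(real_normK (num_real (Re z))).
rewrite -(real_normK (num_real (Im z))).
by have := normr_ge0 (Re z); have := normr_ge0 (Im z); nra.
Qed.
End Cabs.

(* Only a semi-inner product is required: vectors at distance 0, such as a.e. equal
   functions, are not identified. *)
Record hilbert (R : realType) (E : lmodType R[i]) := Hilbert {
  hip : E -> E -> R[i];
  hip_lin : forall a x y z, hip (a *: x + y) z = a * hip x z + hip y z;
  hipC : forall x y, hip y x = (hip x y)^*%C;
  hip_ge0 : forall x, 0 <= Re (hip x x);
  hcomplete : forall u : nat -> E,
    (forall e, 0 < e -> exists N, forall n m, (N <= n)%N -> (N <= m)%N ->
       Re (hip (u n - u m) (u n - u m)) <= e) ->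
    exists v : E, forall e, 0 < e -> exists N, forall n, (N <= n)%N ->
       Re (hip (u n - v) (u n - v)) <= e }.

Section Hilbert.
Variables (R : realType) (E : lmodType R[i]) (H : hilbert E).
Implicit Types (x y z : E) (a : R[i]).
Local Notation ip := (hip H).

Definition nsq x : R := Re (ip x x).
Definition nrm x : R := Num.sqrt (nsq x).

Lemma ipDl x y z : ip (x + y) z = ip x z + ip y z.
Proof. by rewrite -[x]scale1r hip_lin scale1r mul1r. Qed.
Lemma ip0l z : ip 0 z = 0.
Proof. by apply: (addrI (ip 0 z)); rewrite -ipDl !addr0. Qed.
Lemma ipZl a x z : ip (a *: x) z = a * ip x z.
Proof. by rewrite -[a *: x]addr0 hip_lin ip0l addr0. Qed.
Lemma ipNl x z : ip (- x) z = - ip x z.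
Proof. by rewrite -scaleN1r ipZl mulN1r. Qed.
Lemma ipBl x y z : ip (x - y) z = ip x z - ip y z.
Proof. by rewrite ipDl ipNl. Qed.
Lemma ipDr x y z : ip z (x + y) = ip z x + ip z y.
Proof. by rewrite hipC ipDl rmorphD/= -!hipC. Qed.
Lemma ip0r z : ip z 0 = 0. Proof. by rewrite hipC ip0l rmorph0. Qed.
Lemma ipZr a x z : ip z (a *: x) = a^*%C * ip z x.
Proof. by rewrite hipC ipZl rmorphM/= -hipC. Qed.
Lemma ipNr x z : ip z (- x) = - ip z x.
Proof. by rewrite hipC ipNl rmorphN/= -hipC. Qed.
Lemma ipBr x y z : ip z (x - y) = ip z x - ip z y.
Proof. by rewrite ipDr ipNr. Qed.
Lemma ip_suml (I : Type) (s : seq I) (F : I -> E) z :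
  ip (\sum_(i <- s) F i) z = \sum_(i <- s) ip (F i) z.
Proof. by elim/big_rec2: _ => [|i y x _ <-]; rewrite ?ip0l ?ipDl. Qed.
Lemma ip_sumr (I : Type) (s : seq I) (F : I -> E) z :
  ip z (\sum_(i <- s) F i) = \sum_(i <- s) ip z (F i).
Proof. by elim/big_rec2: _ => [|i y x _ <-]; rewrite ?ip0r ?ipDr. Qed.

Lemma ipxx x : ip x x = (nsq x)%:C%C.
Proof.
apply: complexP => //=; have : Im (ip x x) = Im (ip x x)^*%C by rewrite -hipC.
by rewrite ImJ; lra.
Qed.

Lemma nsq_ge0 x : 0 <= nsq x. Proof. exact: hip_ge0. Qed.
Lemma nrm_ge0 x : 0 <= nrm x. Proof. exact: sqrtr_ge0. Qed.
Lemma nrm_sq x : nrm x ^+ 2 = nsq x. Proof. by rewrite sqr_sqrtr ?nsq_ge0. Qed.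
Lemma nsqD x y : nsq (x + y) = nsq x + nsq y + 2 * Re (ip x y).
Proof.
by rewrite /nsq ipDl !ipDr !cE (hipC H x y) ReJ; ring.
Qed.
Lemma nsqZ a x : nsq (a *: x) = normsq a * nsq x.
Proof. by rewrite /nsq ipZl ipZr ipxx !cE /normsq /=; ring. Qed.
Lemma nsqN x : nsq (- x) = nsq x.
Proof. by rewrite /nsq ipNl ipNr opprK. Qed.
Lemma nsq0 : nsq 0 = 0. Proof. by rewrite /nsq ip0l. Qed.

(** The vector [x - t (ip x y) y] has nonnegative square for every real [t]. Since [nsq y] may
    vanish for a nonzero [y], that case needs a large [t] contradicting nonnegativity, in place of
    the usual [t = 1 / nsq y]. *)
Lemma cauchy_schwarz x y : normsq (ip x y) <= nsq x * nsq y.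
Proof.
have h (t : R) : 0 <= nsq x - 2 * t * normsq (ip x y) + t ^+ 2 * (normsq (ip x y) * nsq y).
  have := nsq_ge0 (x + (- (t%:C%C * ip x y)) *: y).
  rewrite nsqD nsqZ normsqN normsqM ipZr.
  by rewrite !cE /normsq /=; congr (_ <= _); ring.
have := nsq_ge0 x; have := normsq_ge0 (ip x y); have := nsq_ge0 y.
move: (nsq x) (nsq y) (normsq _) h => A C B h C0 B0 A0.
have [C1|C1] := eqVneq C 0.
  have [->|B1] := eqVneq B 0; first by rewrite mulr_ge0.
  have := h ((A + 1) / (2 * B)); rewrite C1 !mulr0 addr0.
  rewrite (_ : 2 * _ * B = A + 1); last by field.
  by lra.
have := h C^-1; rewrite (_ : _ + _ = A - B / C); last by field.
by rewrite subr_ge0 ler_pdivrMr// lt_neqAle eq_sym C1.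
Qed.

Lemma cabs_ip x y : cabs (ip x y) <= nrm x * nrm y.
Proof.
rewrite -ler_sqr ?nnegrE ?cabs_ge0 ?mulr_ge0 ?nrm_ge0//.
by rewrite cabs_sq exprMn !nrm_sq cauchy_schwarz.
Qed.

Lemma nrmD x y : nrm (x + y) <= nrm x + nrm y.
Proof.
rewrite -ler_sqr ?nnegrE ?addr_ge0 ?nrm_ge0// nrm_sq nsqD sqrrD !nrm_sq.
rewrite -[X in _ <= _ + X + _]mulr_natl.
by have := le_trans (ler_norm _) (le_trans (ler_Re_cabs _) (cabs_ip x y)); lra.
Qed.

Lemma nrmZ a x : nrm (a *: x) = cabs a * nrm x.
Proof. by rewrite /nrm nsqZ sqrtrM ?normsq_ge0. Qed.
Lemma nrmN x : nrm (- x) = nrm x. Proof. by rewrite /nrm nsqN. Qed.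
Lemma nrm0 : nrm 0 = 0. Proof. by rewrite /nrm nsq0 sqrtr0. Qed.
Lemma nrmBC x y : nrm (x - y) = nrm (y - x). Proof. by rewrite -nrmN opprB. Qed.
Lemma nrm_sum (I : Type) (s : seq I) (F : I -> E) :
  nrm (\sum_(i <- s) F i) <= \sum_(i <- s) nrm (F i).
Proof.
elim: s => [|i s IH]; first by rewrite !big_nil nrm0.
by rewrite !big_cons (le_trans (nrmD _ _))// lerD2l.
Qed.
Lemma nrm_tri z x y : nrm (x - y) <= nrm (x - z) + nrm (z - y).
Proof. by rewrite (le_trans _ (nrmD _ _))// addrA subrK. Qed.
Lemma nrm_eq0_nsq x : nsq x = 0 -> nrm x = 0.
Proof. by rewrite /nrm => ->; rewrite sqrtr0. Qed.
Lemma nrm_le e x : 0 <= e -> nsq x <= e ^+ 2 -> nrm x <= e.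
Proof. by move=> e0 h; rewrite -ler_sqr ?nnegrE ?nrm_ge0// nrm_sq. Qed.
Lemma nsq_le e x : nrm x <= e -> nsq x <= e ^+ 2.
Proof. by move=> h; rewrite -nrm_sq ler_sqr ?nnegrE ?nrm_ge0// (le_trans (nrm_ge0 x)). Qed.
Lemma nrm_complete (u : nat -> E) :
  (forall e, 0 < e -> exists N, forall n m, (N <= n)%N -> (N <= m)%N -> nrm (u n - u m) <= e) ->
  exists v, forall e, 0 < e -> exists N, forall n, (N <= n)%N -> nrm (u n - v) <= e.
Proof.
move=> cau; have [e e0|v hv] := @hcomplete _ _ H u.
  have [N hN] := cau (Num.sqrt e) ltac:(by rewrite sqrtr_gt0).
  exists N => n m Nn Nm; have := nsq_le (hN n m Nn Nm).
  by rewrite sqr_sqrtr; [|exact: ltW].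
exists v => e e0; have [N hN] := hv (e ^+ 2) ltac:(by rewrite exprn_gt0).
by exists N => n Nn; apply: nrm_le; [exact: ltW|exact: hN].
Qed.

End Hilbert.

Record hbasis (R : realType) (E : lmodType R[i]) (H : hilbert E) (I : countType) := HBasis {
  hb :> I -> E;
  hb_orth : forall i j, hip H (hb i) (hb j) = (i == j)%:R;
  hb_total : forall x, (forall i, hip H x (hb i) = 0) -> nsq H x = 0 }.

Section Basis.
Variables (R : realType) (E : lmodType R[i]) (H : hilbert E) (I : countType).
Variable e : hbasis H I.
Implicit Types (x y : E) (c : I -> R[i]) (s : seq I).
Local Notation ip := (hip H).
Local Notation nsq := (nsq H).
Local Notation nrm := (nrm H).

Definition coef x i := ip x (e i).
Definition comb s c := \sum_(i <- s) c i *: e i.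

Lemma coef_comb s c j : uniq s -> coef (comb s c) j = if j \in s then c j else 0.
Proof.
move=> us; rewrite /coef ip_suml.
under eq_bigr do rewrite ipZl hb_orth.
have [js|js] := boolP (j \in s).
  rewrite (bigD1_seq j)//= eqxx mulr1 big1 ?addr0// => i /negbTE ->.
  by rewrite mulr0.
rewrite big_seq big1// => i si; case: eqP => [ij|]; last by rewrite mulr0.
by rewrite -ij si in js.
Qed.

Lemma ip_comb x s c : ip x (comb s c) = \sum_(i <- s) (c i)^*%C * coef x i.
Proof. by rewrite ip_sumr; apply: eq_bigr => i _; rewrite ipZr. Qed.

Lemma nsq_comb s c : uniq s -> nsq (comb s c) = \sum_(i <- s) normsq (c i).
Proof.
move=> us; rewrite /nsq ip_comb Re_sum big_seq [RHS]big_seq.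
apply: eq_bigr => i si; rewrite coef_comb// si mulrC mulcJ //=.
Qed.

Lemma nsq_sub_comb x s : uniq s ->
  nsq (x - comb s (coef x)) = nsq x - \sum_(i <- s) normsq (coef x i).
Proof.
move=> us; rewrite nsqD nsqN nsq_comb// ipNr ip_comb ReN Re_sum.
rewrite [X in _ + 2 * - X](eq_bigr (fun i => normsq (coef x i))); first by lra.
by move=> i _; rewrite mulrC mulcJ.
Qed.

Lemma bessel x s : uniq s -> \sum_(i <- s) normsq (coef x i) <= nsq x.
Proof. by move=> us; rewrite -subr_ge0 -nsq_sub_comb// nsq_ge0. Qed.

(** The indices of code less than [n]: an exhaustion of the countable index set by finite
    duplicate-free lists, each a prefix of the next. *)
Definition frame n : seq I := pmap (@pickle_inv I) (iota 0 n).

Lemma mem_frame n i : (i \in frame n) = (pickle i < n)%N.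
Proof.
rewrite mem_pmap; apply/mapP/idP => [[k]|h].
  rewrite mem_iota add0n => /andP[_ kn] ki.
  by have := @pickle_invK I k; rewrite -ki /= => ->.
by exists (pickle i); rewrite ?mem_iota ?add0n// pickleK_inv.
Qed.

Lemma frame_uniq n : uniq (frame n).
Proof.
apply: (pmap_uniq (g := @pickle I)); last exact: iota_uniq.
exact: pickle_invK.
Qed.

Lemma frame_cat n m : (n <= m)%N -> exists s, frame m = frame n ++ s.
Proof.
move=> nm; exists (pmap (@pickle_inv I) (iota n (m - n))).
by rewrite -pmap_cat -{2}[n]add0n -iotaD subnKC.
Qed.

(** The sums of [normsq (c i)] over the frames increase and are bounded, and their differences are
    the squared distances between the partial combinations, which are therefore Cauchy. *)
Lemma riesz_fischer c B : (forall s, uniq s -> \sum_(i <- s) normsq (c i) <= B) ->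
  exists y, (forall i, coef y i = c i) /\
    (forall eps, 0 < eps -> exists N, forall n, (N <= n)%N -> nrm (comb (frame n) c - y) <= eps).
Proof.
move=> hB; pose A n := \sum_(i <- frame n) normsq (c i).
have A_mono n m : (n <= m)%N -> A n <= A m.
  move=> /frame_cat[s hs]; rewrite /A hs big_cat/= lerDl sumr_ge0// => i _.
  exact: normsq_ge0.
have dist n m : (n <= m)%N -> nsq (comb (frame m) c - comb (frame n) c) = A m - A n.
  move=> /frame_cat[s hs]; have := frame_uniq m; rewrite hs cat_uniq => /and3P[_ _ us].
  by rewrite /comb /A hs !big_cat/= [_ + _ - _]addrC addKr nsq_comb// [_ + _ - _]addrC addKr.
pose S := [set A n | n in setT].
have hS : has_sup S.
  by split; [exists (A 0); exists 0%N|exists B => _ [n _ <-]; apply: hB; exact: frame_uniq].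
have [eps e0|y hy] := @nrm_complete _ _ H (fun n => comb (frame n) c).
  have e2 : 0 < eps ^+ 2 by rewrite exprn_gt0.
  have [_ [N _ <-] hN] := sup_adherent e2 hS.
  have hle n : A n <= sup S by apply: sup_upper_bound => //; exists n.
  exists N => n m; wlog nm : n m / (n <= m)%N => [W|Nn Nm].
    by case/orP: (leq_total n m) => h ? ?; [|rewrite nrmBC]; apply: W.
  rewrite nrmBC; apply: nrm_le; first exact: ltW.
  by rewrite dist//; have := A_mono N n Nn; have := hle m; lra.
exists y; split => // i; apply/eqP; rewrite -subr_eq0; apply/eqP/normsq_eq0.
apply/eqP; rewrite eq_le normsq_ge0 andbT; apply/ler_addgt0Pr => eps e0; rewrite add0r.
have se : 0 < Num.sqrt eps by rewrite sqrtr_gt0.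
have [N hN] := hy _ se.
(* The rank must exceed the code of [i], so that [i] belongs to the frame and the combination has
   [i]-th coefficient [c i]. *)
have h := nsq_le (hN (maxn N (pickle i).+1) (leq_maxl _ _)).
rewrite sqr_sqrtr in h; last exact: ltW.
apply: le_trans h.
apply: le_trans (@bessel _ [:: i] isT); rewrite big_seq1 /coef ipBl.
have := coef_comb c i (frame_uniq (maxn N (pickle i).+1)).
by rewrite mem_frame leq_max ltnSn orbT /coef => ->; rewrite -normsqN opprB.
Qed.

(** The substitute for extensionality: identities between vectors are checked on coefficients and
    hold up to a vector of norm 0. *)
Lemma eq_coef x y : (forall i, coef x i = coef y i) -> nrm (x - y) = 0.
Proof.
move=> h; apply: nrm_eq0_nsq; apply: (@hb_total _ _ _ _ e) => i.
by rewrite ipBl; apply/eqP; rewrite subr_eq0; apply/eqP/h.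
Qed.

Lemma approx_comb x eps : 0 < eps -> exists n, nrm (x - comb (frame n) (coef x)) <= eps.
Proof.
move=> e0; have [y [hy /(_ _ e0)[N hN]]] := @riesz_fischer (coef x) (nsq x) (@bessel x).
exists N; rewrite (le_trans (@nrm_tri _ _ _ y _ _))// eq_coef// add0r nrmBC.
exact: hN.
Qed.

(** Converse of Bessel's inequality: the remainder of a truncation has square [nsq x] minus the
    partial sum, and is arbitrarily small. *)
Lemma nsq_le_coef x B : (forall s, uniq s -> \sum_(i <- s) normsq (coef x i) <= B) -> nsq x <= B.
Proof.
move=> h; apply/ler_addgt0Pr => eps e0.
have [n hn] := @approx_comb x (Num.sqrt eps) ltac:(by rewrite sqrtr_gt0).
have := nsq_le hn; rewrite sqr_sqrtr; last exact: ltW.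
rewrite nsq_sub_comb ?frame_uniq//.
by have := h _ (frame_uniq n); lra.
Qed.

Lemma nrm_le_coef x y : (forall i, normsq (coef x i) <= normsq (coef y i)) -> nrm x <= nrm y.
Proof.
move=> h; apply: nrm_le; rewrite ?nrm_ge0 ?nrm_sq//; apply: nsq_le_coef => s us.
by apply: le_trans (bessel y us); apply: ler_sum.
Qed.

Lemma multiplier_exists (m : I -> R[i]) x : (forall i, normsq (m i) <= 1) ->
  exists y, forall i, coef y i = m i * coef x i.
Proof.
move=> m1; have [s us|y [hy _]] := @riesz_fischer (fun i => m i * coef x i) (nsq x).
  apply: le_trans (bessel x us); apply: ler_sum => i _.
  by rewrite normsqM ler_piMl ?normsq_ge0.
by exists y.
Qed.

End Basis.

Local Notation leb := lebesgue_measure.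

(** * Mean value estimates and integrals over time intervals *)

Section RealCalculus.
Variable R : realType.

Lemma derive_continuous (f df : R -> R) :
  (forall x : R, is_derive x 1 f (df x)) -> continuous f.
Proof.
by move=> h x; apply: differentiable_continuous; apply/derivable1_diffP; have [] := h x.
Qed.

Lemma derive_mean_value (f df : R -> R) a b :
  (forall x : R, is_derive x 1 f (df x)) -> a <= b ->
  exists2 c, c \in `[a, b] & f b - f a = df c * (b - a).
Proof.
move=> h ab; apply: (@MVT_segment R f df a b ab (fun x _ => h x)).
exact/continuous_subspaceT/(derive_continuous h).
Qed.

Lemma derive_lipschitz (f df : R -> R) K a b :
  (forall x : R, is_derive x 1 f (df x)) -> (forall x, `|df x| <= K) ->
  `|f a - f b| <= K * `|a - b|.
Proof.
move=> h hK; wlog ab : a b / a <= b => [W|].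
  by case/orP: (le_total a b) => ?; [|rewrite distrC [`|a - b|]distrC]; exact: W.
have [c _ hc] := derive_mean_value h ab.
by rewrite distrC hc normrM [`|a - b|]distrC ler_wpM2r.
Qed.

Lemma derive_ge0_le (f df : R -> R) a b :
  (forall x : R, is_derive x 1 f (df x)) -> (forall x, x \in `[a, b] -> 0 <= df x) -> a <= b ->
  f a <= f b.
Proof.
move=> h h0 ab; have [c cab hc] := derive_mean_value h ab.
by rewrite -subr_ge0 hc mulr_ge0 ?subr_ge0// h0.
Qed.

Lemma cabs_cisB (a b : R) : cabs (cis a - cis b) <= 2 * `|a - b|.
Proof.
apply: le_trans (cabs_le _) _; rewrite !cE /= mulrDl mul1r; apply: lerD.
  rewrite -[leRHS]mul1r; apply: derive_lipschitz (fun x => is_derive_cos x) _ => x.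
  by rewrite normrN ler_norml sin_geN1 sin_le1.
rewrite -[leRHS]mul1r; apply: derive_lipschitz (fun x => is_derive_sin x) _ => x.
by rewrite ler_norml cos_geN1 cos_le1.
Qed.

Lemma continuous_integrable_cc (f : R -> R) a b : continuous f ->
  (@lebesgue_measure R).-integrable (`[a, b]%classic : set (measurableTypeR R)) (EFin \o f).
Proof.
move=> cf; apply: continuous_compact_integrable; first exact: segment_compact.
exact: continuous_subspaceT.
Qed.

Lemma continuous_integrable_oo (f : R -> R) a b : continuous f ->
  (@lebesgue_measure R).-integrable (`]a, b[%classic : set (measurableTypeR R)) (EFin \o f).
Proof.
move=> /(continuous_integrable_cc a b); apply: integrableS => //.
exact: subset_itv_oo_cc.
Qed.

End RealCalculus.

Section TimeIntegral.
Variables (R : realType) (a b : R).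
Hypothesis ab : a <= b.
Local Notation D := (`]a, b[%classic : set (measurableTypeR R)).
Local Notation tint := (cintegral (@lebesgue_measure R) D).

Lemma itvD_measure : fine (leb D) = b - a.
Proof.
rewrite lebesgue_measure_itv /=; case: ifPn => //; rewrite lte_fin -leNgt => ba.
by apply/esym/eqP; rewrite subr_eq0 eq_le ba ab.
Qed.

(** Multiplying by the conjugate of the integral [w] makes it real and nonnegative: [|w| ^ 2] is the
    integral of [Re (conj w * f)], at most [(b - a) |w| B]. *)
Lemma cabs_tint (f : R -> R[i]) B : 0 <= B -> cintble leb D f ->
  (forall s, D s -> cabs (f s) <= B) -> cabs (tint f) <= (b - a) * B.
Proof.
move=> B0 fi hB; set w := tint f.
have mD : measurable D by [].
have ci : cintble leb D (fun s => w^*%C * f s + 0).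
  by apply: cintble_lin => //; exact: cintble0.
have E : normsq w = \int[leb]_(s in D) Re (w^*%C * f s + 0).
  have := cintegral_lin mD w^*%C fi (cintble0 leb D).
  rewrite cintegral0// addr0 mulrC mulcJ => /(congr1 Re) /= <-.
  by apply: eq_Rintegral.
have [w0|w0] := eqVneq (cabs w) 0.
  by rewrite w0 mulr_ge0 ?subr_ge0.
have : cabs w ^+ 2 <= (b - a) * (cabs w * B).
  rewrite cabs_sq E -itvD_measure mulrC -Rintegral_cst//.
  apply: le_Rintegral => //; first by case: ci.
    by apply: continuous_integrable_oo => x; exact: cvg_cst.
  move=> s Ds; rewrite addr0; apply: le_trans (ler_norm _) _.
  by rewrite (le_trans (ler_Re_cabs _))// cabsM cabsJ ler_wpM2l ?cabs_ge0 ?hB.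
have w1 : 0 < cabs w by rewrite lt_neqAle eq_sym w0 cabs_ge0.
by rewrite mulrCA expr2 ler_pM2l.
Qed.

End TimeIntegral.

(** * Inversion of the controllability Gramian *)

Local Notation tint a b := (cintegral (@lebesgue_measure _) (`]a, b[%classic : set (measurableTypeR _))).
Local Notation tintble a b :=
  (cintble (@lebesgue_measure _) (`]a, b[%classic : set (measurableTypeR _))).

(** Serves to choose a tolerance [x / (a + 1)] against a factor [a] that may be 0. *)
Lemma mulr_div1D (R : realFieldType) (a x : R) : 0 <= a -> 0 <= x -> a * (x / (a + 1)) <= x.
Proof.
move=> a0 x0; rewrite mulrA ler_pdivrMr ?ltr_wpDl// mulrC ler_wpM2l//.
by rewrite lerDl.
Qed.

Section VectorIntegral.
Variables (R : realType) (E : lmodType R[i]) (H : hilbert E) (I : countType).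
Variable e : hbasis H I.
Local Notation ip := (hip H).
Local Notation nsq := (nsq H).
Local Notation nrm := (nrm H).
Local Notation coef := (coef e).
Implicit Types (x y z : E) (F : R -> E).

Lemma coefB x y i : coef (x - y) i = coef x i - coef y i.
Proof. exact: ipBl. Qed.
Lemma coefD x y i : coef (x + y) i = coef x i + coef y i.
Proof. exact: ipDl. Qed.
Lemma coefZ a x i : coef (a *: x) i = a * coef x i.
Proof. exact: ipZl. Qed.
Lemma coef_sum (J : Type) (s : seq J) (F : J -> E) i :
  coef (\sum_(j <- s) F j) i = \sum_(j <- s) coef (F j) i.
Proof. exact: ip_suml. Qed.
Lemma nrm_hb i : nrm (e i) = 1.
Proof. by rewrite /nrm /nsq hb_orth eqxx sqrtr1. Qed.
Lemma cabs_coef x i : cabs (coef x i) <= nrm x.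
Proof. by rewrite (le_trans (cabs_ip _ _ _))// nrm_hb mulr1. Qed.
Lemma ip_eqvl x y z : nrm (x - y) = 0 -> ip x z = ip y z.
Proof.
move=> h; apply/eqP; rewrite -subr_eq0 -ipBl; apply/eqP/normsq_eq0.
rewrite -cabs_sq; apply/eqP; rewrite sqrf_eq0 eq_le cabs_ge0 andbT.
by rewrite (le_trans (cabs_ip _ _ _))// h mul0r.
Qed.
Lemma ip_eqvr x y z : nrm (x - y) = 0 -> ip z x = ip z y.
Proof. by move=> h; rewrite hipC (ip_eqvl _ h) -hipC. Qed.
Lemma nrm_eqv x y : nrm (x - y) = 0 -> nrm x = nrm y.
Proof.
move=> h; rewrite /nrm /nsq (ip_eqvl _ h) (ip_eqvr _ h) //.
Qed.

Definition ucont F := forall eps, 0 < eps -> exists delta, 0 < delta /\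
  forall s s', `|s - s'| <= delta -> nrm (F s - F s') <= eps.

Lemma ucont_continuous (phi : R -> R) F : ucont F ->
  (forall s s', `|phi s - phi s'| <= nrm (F s - F s')) -> continuous phi.
Proof.
move=> uF h t; apply/cvgrPdist_le => eps e0; have [d [d0 hd]] := uF _ e0.
near=> s; apply: le_trans (h _ _) _; apply: hd.
by near: s; exists d => //= s /= /ltW.
Unshelve. all: by end_near. Qed.

Lemma ucont_tintble F i a b : ucont F -> tintble a b (fun t => coef (F t) i).
Proof.
move=> uF; split; apply: continuous_integrable_oo; apply: (ucont_continuous uF) => s s'.
  by apply: le_trans (cabs_coef _ i); rewrite coefB -ReN -ReD ler_Re_cabs.
by apply: le_trans (cabs_coef _ i); rewrite coefB -ImN -ImD ler_Im_cabs.
Qed.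

Section Interval.
Variables (a b : R) (F : R -> E) (B : R).
Hypotheses (ab : a <= b) (B0 : 0 <= B).
Hypothesis mF : forall i, tintble a b (fun t => coef (F t) i).
Hypothesis bF : forall t, t \in `]a, b[ -> nrm (F t) <= B.
Local Notation c := (fun i => tint a b (fun t => coef (F t) i)).

(** Duality: with [p] the combination of the numbers [c i], [nsq p] is the integral of [ip (F t) p],
    hence at most [(b - a) B (nrm p)]; one factor [nrm p] cancels. *)
Lemma tint_coef_bound s : uniq s -> \sum_(i <- s) normsq (c i) <= ((b - a) * B) ^+ 2.
Proof.
move=> us; pose p := comb e s c; have mD : measurable `]a, b[%classic by [].
have mD' : @measurable _ (measurableTypeR R) `]a, b[%classic by [].
have Ep : (fun t => ip (F t) p) = (fun t => \sum_(i <- s) (c i)^*%C * coef (F t) i).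
  by apply/funext => t; exact: ip_comb.
have E1 : tint a b (fun t => ip (F t) p) = (nsq p)%:C%C.
  rewrite Ep.
  rewrite cintegral_sum//; last by move=> i; exact: cintbleZ.
  rewrite /p nsq_comb// rmorph_sum/=; apply: eq_bigr => i _.
  by rewrite cintegralZ// mulrC mulcJ.
have K0 : 0 <= (b - a) * B by rewrite mulr_ge0 ?subr_ge0.
have : cabs (tint a b (fun t => ip (F t) p)) <= (b - a) * (B * nrm p).
  apply: cabs_tint => //; first by rewrite mulr_ge0 ?nrm_ge0.
    by rewrite Ep; apply: cintble_sum => // i; exact: cintbleZ.
  move=> t tD; apply: le_trans (cabs_ip _ _ _) _.
  by rewrite ler_wpM2r ?nrm_ge0 ?bF.
rewrite E1 cabs_real ger0_norm ?nsq_ge0// -nrm_sq mulrA => h.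
rewrite -(nsq_comb e _ us) -/p -nrm_sq lerXn2r ?nnegrE ?nrm_ge0//.
have [->|p0] := eqVneq (nrm p) 0; first by [].
by move: h; rewrite expr2 ler_pM2r// lt_neqAle eq_sym p0 nrm_ge0.
Qed.

(** The integral of [F] in the weak sense: the vector whose coefficients are the integrals of the
    coefficients. *)
Lemma vint_exists : exists z, forall i, coef z i = c i.
Proof.
by have [z [hz _]] := riesz_fischer e tint_coef_bound; exists z.
Qed.

Lemma vint_bound z : (forall i, coef z i = c i) -> nrm z <= (b - a) * B.
Proof.
move=> hz; apply: nrm_le; first by rewrite mulr_ge0 ?subr_ge0.
apply: (nsq_le_coef (e := e)) => s us; apply: le_trans (tint_coef_bound us).
by rewrite le_eqVlt; apply/orP; left; apply/eqP/eq_bigr => i _; rewrite hz.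
Qed.

End Interval.

End VectorIntegral.

(** * The unitary group, the Gramian and its inversion *)

Section Evolution.
Variables (R : realType) (E : lmodType R[i]) (H : hilbert E) (I : countType).
Variable e : hbasis H I.
Local Notation ip := (hip H).
Local Notation nsq := (nsq H).
Local Notation nrm := (nrm H).
Local Notation coef := (coef e).
Local Notation ucont := (ucont H).
Variables (U : R -> E -> E) (om : I -> R) (G : E -> E) (CG : R).
Hypothesis HU : forall t x i, coef (U t x) i = cis (t * om i) * coef x i.
Hypothesis HG : forall x y, ip (G x) y = ip x (G y).
Hypothesis CG0 : 0 <= CG.
Hypothesis nrmG : forall x, nrm (G x) <= CG * nrm x.
Implicit Types x y z : E.

Lemma normsq_coefU t x i : normsq (coef (U t x) i) = normsq (coef x i).
Proof. by rewrite HU normsqM normsq_cis mul1r. Qed.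

Lemma nrmU t x : nrm (U t x) = nrm x.
Proof.
by apply/eqP; rewrite eq_le; apply/andP; split; apply: (nrm_le_coef (e := e)) => i;
  rewrite normsq_coefU.
Qed.

Lemma nrmUB t x y : nrm (U t x - U t y) = nrm (x - y).
Proof.
rewrite -(nrmU t (x - y)); apply: nrm_eqv; apply: (eq_coef (e := e)) => i.
by rewrite !(coefB, HU) mulrBr.
Qed.

(** Linearity of [G] up to null vectors comes from self-adjointness: the [i]-th coefficient of [G x]
    is the product of [x] with [G (e i)]. *)
Lemma nrmGB x y : nrm (G x - G y) <= CG * nrm (x - y).
Proof.
apply: le_trans (nrmG (x - y)); rewrite le_eqVlt; apply/orP; left; apply/eqP.
apply: nrm_eqv; apply: (eq_coef (e := e)) => i.
by rewrite coefB /coef !HG ipBl.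
Qed.

Lemma coefG_comb s (c : I -> R[i]) i :
  coef (G (comb e s c)) i = \sum_(j <- s) c j * coef (G (e j)) i.
Proof.
by rewrite /coef HG ip_suml; apply: eq_bigr => j _; rewrite ipZl -HG.
Qed.

(** Since [U] preserves norms, the remainder of an approximation of [y] costs twice its norm
    whatever the times. The vectors [v j] are left arbitrary because both the modes and their images
    under [G] are used. *)
Lemma nrmU_diff (J : Type) (s : seq J) (a : J -> R[i]) (v : J -> E) y t t' :
  nrm (U t y - U t' y) <= 2 * nrm (y - \sum_(j <- s) a j *: v j) +
    \sum_(j <- s) cabs (a j) * nrm (U t (v j) - U t' (v j)).
Proof.
set r := y - _.
have -> : nrm (U t y - U t' y) = nrm ((U t r - U t' r) +
    \sum_(j <- s) a j *: (U t (v j) - U t' (v j))).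
  apply: nrm_eqv; apply: (eq_coef (e := e)) => i.
  rewrite coefB coefD coefB !HU coef_sum /r coefB coef_sum.
  under [X in _ = _ + X]eq_bigr do rewrite coefZ coefB !HU -mulrBl mulrCA.
  rewrite -mulr_sumr -!mulrBl -mulrDr; congr (_ * _).
  by under [X in _ = _ - X + _]eq_bigr do rewrite coefZ; rewrite subrK.
apply: le_trans (nrmD _ _ _) _; apply: lerD.
  by apply: le_trans (nrmD _ _ _) _; rewrite nrmN !nrmU; lra.
by apply: le_trans (nrm_sum _ _ _) _; apply: ler_sum => j _; rewrite nrmZ.
Qed.

Lemma ucont_sum (J : Type) (s : seq J) (a : J -> R) (F : J -> R -> E) :
  (forall j, 0 <= a j) -> (forall j, ucont (F j)) -> forall eps, 0 < eps ->
  exists delta, 0 < delta /\ forall t t', `|t - t'| <= delta ->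
    \sum_(j <- s) a j * nrm (F j t - F j t') <= eps.
Proof.
move=> a0 uF; elim: s => [|j s IH] eps e0.
  by exists 1; split => // t t' _; rewrite big_nil ltW.
have e2 : 0 < eps / 2 by rewrite divr_gt0.
have [d1 [d10 h1]] := IH _ e2.
have e3 : 0 < eps / 2 / (a j + 1) by rewrite divr_gt0// ltr_wpDl.
have [d2 [d20 h2]] := uF j _ e3.
exists (Num.min d1 d2); split; first by rewrite lt_min d10.
move=> t t'; rewrite le_min => /andP[/h1 l1 /h2 l2]; rewrite big_cons.
have : a j * nrm (F j t - F j t') <= eps / 2.
  apply: le_trans (_ : a j * (eps / 2 / (a j + 1)) <= _); first by rewrite ler_wpM2l.
  by apply: mulr_div1D => //; exact: ltW.
by lra.
Qed.

(** On a mode the orbit is a rotation, Lipschitz with constant [2 |om i|]; these constants are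
    unbounded in [i], so a general [x] is first replaced by a finite combination. *)
Lemma ucontU x : ucont (fun t => U t x).
Proof.
move=> eps e0; have e4 : 0 < eps / 4 by rewrite divr_gt0.
have [n hn] := approx_comb e x e4.
have e2 : 0 < eps / 2 by rewrite divr_gt0.
have ub i : ucont (fun t => U t (e i)).
  move=> ep ep0; exists (ep / (2 * (`|om i| + 1))).
  have q0 : 0 < 2 * (`|om i| + 1) by rewrite mulr_gt0// ltr_wpDl.
  split=> [|s s' hs]; first by rewrite divr_gt0.
  have -> : nrm (U s (e i) - U s' (e i)) = nrm ((cis (s * om i) - cis (s' * om i)) *: e i).
    apply: nrm_eqv; apply: (eq_coef (e := e)) => j.
    rewrite coefB coefZ !HU /coef hb_orth; case: eqP => [->|_]; last by rewrite !mulr0 subrr.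
    by rewrite !mulr1.
  rewrite nrmZ nrm_hb mulr1; apply: le_trans (cabs_cisB _ _) _.
  rewrite -mulrBl normrM; apply: le_trans (_ : `|s - s'| * (2 * (`|om i| + 1)) <= _).
    by rewrite mulrCA ler_wpM2l// ler_pM2l// lerDl.
  by rewrite -ler_pdivlMr.
have [d [d0 hd]] := ucont_sum (frame I n) (fun i => cabs_ge0 (coef x i)) ub e2.
exists d; split => // s s' /hd h.
apply: le_trans (nrmU_diff (frame I n) (coef x) e x s s') _.
by move: hn h; rewrite /comb; lra.
Qed.

Definition pullback x s := U (- s) (G (U s x)).

Lemma coef_pullback x s i : coef (pullback x s) i = cis (- s * om i) * coef (G (U s x)) i.
Proof. exact: HU. Qed.

Lemma nrm_pullback x s : nrm (pullback x s) <= CG * nrm x.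
Proof. by rewrite nrmU -(nrmU s x). Qed.

Lemma nrm_pullbackB x y s : nrm (pullback x s - pullback y s) <= CG * nrm (x - y).
Proof. by rewrite nrmUB -(nrmUB s x y) nrmGB. Qed.

(** Both the outer operator and its argument depend on [s]. Moving the argument is harmless because
    [G] is bounded. Moving the outer time calls for a finite approximation of [G (U s' x)] valid for
    all [s'] at once. *)
Lemma ucont_orbit x t : ucont (fun s => U (t - s) (G (U s x))).
Proof.
move=> eps e0; have e2 : 0 < eps / 4 / (CG + 1).
  by rewrite divr_gt0 ?divr_gt0// ltr_wpDl.
have C1 : 0 < CG + 1 by rewrite ltr_wpDl.
have e4 : 0 < eps / 4 by rewrite divr_gt0.
have [d1 [d10 h1]] := ucontU x e2.
have [n hn] := approx_comb e x e2.
have ue i : ucont (fun s => U (t - s) (G (e i))).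
  move=> ep /(ucontU (G (e i)))[d [d0 hd]]; exists d; split => // s s' hs.
  by apply: hd; rewrite opprB addrC addrA subrK distrC.
have [d2 [d20 h2]] := ucont_sum (frame I n) (fun i => cabs_ge0 (coef x i)) ue e4.
exists (Num.min d1 d2); split; first by rewrite lt_min d10.
move=> s s'; rewrite le_min => /andP[/h1 l1 /h2 l2].
have CGe : CG * (eps / 4 / (CG + 1)) <= eps / 4.
  by apply: mulr_div1D => //; exact: ltW.
apply: le_trans (nrm_tri _ (U (t - s) (G (U s' x))) _ _) _.
have : nrm (U (t - s) (G (U s x)) - U (t - s) (G (U s' x))) <= eps / 4.
  rewrite nrmUB; apply: le_trans (nrmGB _ _) _.
  by apply: le_trans CGe; rewrite ler_wpM2l.
have := nrmU_diff (frame I n) (coef (U s' x)) (fun i => G (e i)) (G (U s' x)) (t - s) (t - s').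
under [X in _ <= _ + X]eq_bigr do rewrite {1}/cabs normsq_coefU -/(cabs _).
(* One truncation rank [n] serves for every [s']: the moduli of the coefficients of [U s' x] do not
   depend on [s'], hence neither does the truncation error. *)
have : nrm (G (U s' x) - \sum_(i <- frame I n) coef (U s' x) i *: G (e i)) <= eps / 4.
  apply: le_trans CGe.
  have -> : nrm (G (U s' x) - \sum_(i <- frame I n) coef (U s' x) i *: G (e i)) =
      nrm (G (U s' x) - G (comb e (frame I n) (coef (U s' x)))).
    apply: nrm_eqv; apply: (eq_coef (e := e)) => i.
    rewrite !coefB coefG_comb coef_sum; congr (_ - _).
    by apply: eq_bigr => j _; rewrite coefZ.
  apply: le_trans (nrmGB _ _) _; rewrite ler_wpM2l//; apply: le_trans hn.
  rewrite le_eqVlt /nrm !nsq_sub_comb ?frame_uniq//; apply/orP; left; apply/eqP.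
  congr (Num.sqrt (_ - _)); first by rewrite -!nrm_sq nrmU.
  by apply: eq_bigr => i _; rewrite normsq_coefU.
by move: l2; lra.
Qed.

Lemma ucont_pullback x : ucont (pullback x).
Proof.
by have := @ucont_orbit x 0; congr ucont; apply/funext => s; rewrite sub0r.
Qed.

(** The weak integral over [[0, t]] of the pulled back control term. At [t = T] it is the
    controllability Gramian applied to [x], and [U t] of it is the Duhamel term produced by the
    control [U s x]. The default 0 is not reached for [t >= 0]. *)
Definition duhamel x t : E :=
  xget 0 [set z | forall i, coef z i = tint 0 t (fun s => coef (pullback x s) i)].

Lemma coef_duhamel x t i : 0 <= t ->
  coef (duhamel x t) i = tint 0 t (fun s => coef (pullback x s) i).
Proof.
move=> t0; move: i.
have [|||z hz] := @vint_exists _ _ _ _ e 0 t (pullback x) (CG * nrm x) t0.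
- by rewrite mulr_ge0 ?nrm_ge0.
- by move=> i; apply: ucont_tintble; exact: ucont_pullback.
- by move=> s _; exact: nrm_pullback.
by apply: (@xgetPex _ 0 [set z | forall i, coef z i = _]); exists z.
Qed.

Lemma duhamelB_bound x y t : 0 <= t ->
  nrm (duhamel x t - duhamel y t) <= t * (CG * nrm (x - y)).
Proof.
move=> t0; rewrite -[X in X * _]subr0.
apply: (@vint_bound _ _ _ _ e 0 t (fun s => pullback x s - pullback y s)) => //.
- by rewrite mulr_ge0 ?nrm_ge0.
- move=> i; rewrite (_ : (fun s => _) =
      (fun s => coef (pullback x s) i - coef (pullback y s) i)); last first.
    by apply/funext => s; exact: coefB.
  by apply: cintbleB => //; apply: ucont_tintble; exact: ucont_pullback.
- by move=> s _; exact: nrm_pullbackB.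
- move=> i; rewrite coefB !coef_duhamel// -cintegralB//; try
    by apply: ucont_tintble; exact: ucont_pullback.
  by apply: eq_cintegral => s _; rewrite coefB.
Qed.

Lemma duhamel_bound x t : 0 <= t -> nrm (duhamel x t) <= t * (CG * nrm x).
Proof.
move=> t0; rewrite -[X in X * _]subr0.
apply: (@vint_bound _ _ _ _ e 0 t (pullback x)) => //.
- by rewrite mulr_ge0 ?nrm_ge0.
- by move=> i; apply: ucont_tintble; exact: ucont_pullback.
- by move=> s _; exact: nrm_pullback.
- by move=> i; rewrite coef_duhamel.
Qed.

(** The adjoint of [U (- t)] is [U t]; against a finite combination the product is a finite sum and
    the identity can be read off mode by mode. *)
Lemma ipU_comb y t s (c : I -> R[i]) : uniq s ->
  ip (U (- t) y) (comb e s c) = ip y (U t (comb e s c)).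
Proof.
move=> us; have -> : ip y (U t (comb e s c)) =
    ip y (comb e s (fun i => cis (t * om i) * c i)).
  apply: (ip_eqvr (H := H)); apply: (eq_coef (e := e)) => i.
  by rewrite HU !coef_comb//; case: ifP => // _; rewrite mulr0.
rewrite !ip_comb; apply: eq_bigr => i _.
by rewrite HU mulNr cisN rmorphM/= mulrCA mulrA.
Qed.

Lemma ip_duhamel_comb t s (c : I -> R[i]) : 0 <= t -> uniq s ->
  ip (duhamel (comb e s c) t) (comb e s c) =
  tint 0 t (fun r => ip (G (U r (comb e s c))) (U r (comb e s c))).
Proof.
move=> t0 us; set p := comb e s c; rewrite {2}/p ip_comb.
have mD : @measurable _ (measurableTypeR R) `]0, t[%classic by [].
have ic i : tintble 0 t (fun r => coef (pullback p r) i).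
  by apply: ucont_tintble; exact: ucont_pullback.
under eq_bigr do rewrite coef_duhamel// -cintegralZ//.
rewrite -cintegral_sum//; last by move=> i; exact: cintbleZ.
by apply: eq_cintegral => r _; rewrite -ip_comb /pullback ipU_comb.
Qed.

Section Controllability.
Variables (T : R) (J : pred I) (kappa : R).
Hypotheses (T0 : 0 < T) (kappa0 : 0 < kappa).
Hypothesis GJ : forall x i, ~~ J i -> coef (G x) i = 0.
Hypothesis coercive_comb : forall s (c : I -> R[i]), uniq s -> {in s, forall i, J i} ->
  kappa * \sum_(i <- s) normsq (c i) <=
  Re (tint 0 T (fun t => ip (G (U t (comb e s c))) (U t (comb e s c)))).

Local Notation S x := (duhamel x T).
(** A Lipschitz constant of the Gramian, increased by [kappa] so that [kappa <= C] and by 1 so that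
    it is positive; this keeps [1 - kappa ^ 2 / C ^ 2] in [[0, 1[]. *)
Local Notation C := (T * CG + kappa + 1).
Definition supported x := forall i, ~~ J i -> coef x i = 0.

Let T0' : 0 <= T. Proof. exact: ltW. Qed.
Let C0 : 0 < C.
Proof. by rewrite ltr_wpDl// addr_ge0 ?mulr_ge0 ?(ltW kappa0). Qed.

Lemma duhamel_supported x : supported (S x).
Proof.
move=> i Ji; rewrite coef_duhamel//.
rewrite (_ : (fun _ => _) = fun=> 0) ?cintegral0//.
by apply/funext => s; rewrite coef_pullback GJ ?mulr0.
Qed.

Lemma nrm_gramianB x y : nrm (S x - S y) <= C * nrm (x - y).
Proof.
apply: le_trans (duhamelB_bound _ _ T0') _; rewrite mulrA ler_wpM2r ?nrm_ge0//.
by rewrite -addrA lerDl addr_ge0 ?(ltW kappa0).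
Qed.

Lemma nrm_gramian x : nrm (S x) <= C * nrm x.
Proof.
apply: le_trans (duhamel_bound _ T0') _; rewrite mulrA ler_wpM2r ?nrm_ge0//.
by rewrite -addrA lerDl addr_ge0 ?(ltW kappa0).
Qed.

(** Extension by density of the inequality known for finite combinations; truncating a vector
    supported in [J] leaves only modes of [J]. *)
Lemma gramian_coercive x : supported x -> kappa * nsq x <= Re (ip (S x) x).
Proof.
move=> xJ; apply/ler_addgt0Pr => eps e0.
(* For an approximation within [d <= 1], replacing [x] by its truncation costs at most [kappa d ^ 2]
   on the left and [2 C (nrm x) d] on the right, together at most [d M]. *)
pose M := kappa + 2 * C * nrm x + 1.
have M0 : 0 < M by rewrite ltr_wpDl// addr_ge0 ?(ltW kappa0) ?mulr_ge0 ?nrm_ge0 ?(ltW C0).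
have d0 : 0 < Num.min 1 (eps / M) by rewrite lt_min ltr01 divr_gt0.
move: d0; set d := Num.min _ _ => d0.
have [d1 d2] : d <= 1 /\ d * M <= eps.
  by rewrite -ler_pdivlMr// /d !ge_min !lexx orbT.
have [n hn] := approx_comb e x d0.
set p := comb e (frame I n) (coef x) in hn.
have np : nsq x - d ^+ 2 <= nsq p.
  have := nsq_sub_comb e x (frame_uniq I n); rewrite -/p -(nsq_comb e _ (frame_uniq I n)) -/p.
  by have := nsq_le hn; lra.
have nsqp : nsq p <= nsq x by rewrite /p nsq_comb ?frame_uniq// bessel ?frame_uniq.
have np' : nrm p <= nrm x by rewrite /nrm ler_sqrt ?nsq_ge0.
have pE : p = comb e [seq i <- frame I n | J i] (coef x).
  rewrite /p /comb big_filter [RHS]big_mkcond; apply: eq_bigr => i _.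
  by case: ifPn => // /xJ ->; rewrite scale0r.
have cp : kappa * nsq p <= Re (ip (S p) p).
  have us : uniq [seq i <- frame I n | J i] by rewrite filter_uniq ?frame_uniq.
  rewrite pE nsq_comb// ip_duhamel_comb//.
  apply: coercive_comb => //.
  by move=> i; rewrite mem_filter => /andP[].
have h1 : Re (ip (S p) p) - Re (ip (S x) x) <= 2 * C * nrm x * d.
  have -> : Re (ip (S p) p) - Re (ip (S x) x) = Re (ip (S p - S x) p) + Re (ip (S x) (p - x)).
    by rewrite ipBl ipBr !cE; ring.
  have l1 : Re (ip (S p - S x) p) <= C * d * nrm x.
    apply: le_trans (ler_norm _) (le_trans (ler_Re_cabs _) _).
    apply: le_trans (cabs_ip _ _ _) _; apply: ler_pM; rewrite ?nrm_ge0//.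
    by apply: le_trans (nrm_gramianB _ _) _; rewrite ler_wpM2l ?(ltW C0)// nrmBC.
  have l2 : Re (ip (S x) (p - x)) <= C * nrm x * d.
    apply: le_trans (ler_norm _) (le_trans (ler_Re_cabs _) _).
    apply: le_trans (cabs_ip _ _ _) _; apply: ler_pM; rewrite ?nrm_ge0//.
      exact: nrm_gramian.
    by rewrite nrmBC.
  by move: l1 l2; lra.
have h2 : kappa * d ^+ 2 <= kappa * d.
  by rewrite ler_wpM2l ?(ltW kappa0)// expr2 ler_piMr// ltW.
have h3 : kappa * (nsq x - d ^+ 2) <= kappa * nsq p by rewrite ler_wpM2l ?(ltW kappa0).
have h4 : kappa * d + 2 * C * nrm x * d <= d * M.
  by rewrite /M -mulrDl mulrC ler_wpM2l ?(ltW d0)// lerDl.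
by move: h1 h2 h3 h4 cp d2; rewrite mulrBr; lra.
Qed.

(** The step that minimizes [1 - 2 tau kappa + tau ^ 2 C ^ 2], an upper bound for the squared
    contraction factor of [x - tau (S x)]; the minimum is [rho ^ 2]. *)
Let tau := kappa / C ^+ 2.
Let rho := Num.sqrt (1 - kappa ^+ 2 / C ^+ 2).

Let rho_lt1 : rho < 1.
Proof.
rewrite -[ltRHS]sqrtr1 ltr_sqrt ?ltr01// ltrBlDr ltrDl.
by rewrite divr_gt0 ?exprn_gt0.
Qed.
Let rho_ge0 : 0 <= rho. Proof. exact: sqrtr_ge0. Qed.

Lemma supportedD a x y : supported x -> supported y -> supported (x + a *: y).
Proof. by move=> hx hy i Ji; rewrite coefD coefZ hx// hy// mulr0 addr0. Qed.

Lemma richardson_contraction x : supported x ->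
  nrm (x + (- tau)%:C%C *: S x) <= rho * nrm x.
Proof.
move=> xJ; apply: nrm_le; first by rewrite mulr_ge0 ?nrm_ge0.
rewrite exprMn sqr_sqrtr; last first.
  rewrite subr_ge0 ler_pdivrMr ?exprn_gt0// mul1r lerXn2r ?nnegrE ?(ltW kappa0) ?(ltW C0)//.
  by rewrite addrAC lerDr addr_ge0 ?mulr_ge0.
rewrite nrm_sq nsqD nsqZ ipZr hipC !cE /normsq /=.
have := gramian_coercive xJ; have := nsq_le (nrm_gramian x).
rewrite exprMn nrm_sq => h1 h2.
have t0 : 0 < tau by rewrite divr_gt0 ?exprn_gt0.
have h3 : tau ^+ 2 * nsq (S x) <= tau ^+ 2 * (C ^+ 2 * nsq x) by rewrite ler_wpM2l ?sqr_ge0.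
have h4 : tau * (kappa * nsq x) <= tau * Re (ip (S x) x) by rewrite ler_wpM2l ?(ltW t0).
have E1 : tau ^+ 2 * (C ^+ 2 * nsq x) = kappa ^+ 2 / C ^+ 2 * nsq x.
  by rewrite /tau; field; rewrite gt_eqF.
have E2 : tau * (kappa * nsq x) = kappa ^+ 2 / C ^+ 2 * nsq x.
  by rewrite /tau; field; rewrite gt_eqF.
rewrite E1 in h3; rewrite E2 in h4.
by rewrite oppr0 mul0r subr0 expr0n/= addr0 sqrrN mulrBl mul1r; lra.
Qed.

Lemma coef_pullbackB x y s i :
  coef (pullback (x - y) s) i = coef (pullback x s) i - coef (pullback y s) i.
Proof.
rewrite !coef_pullback -mulrBr; congr (_ * _); rewrite /coef !HG -ipBl.
apply: (ip_eqvl (H := H)); apply: (eq_coef (e := e)) => j.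
by rewrite !(coefB, HU) mulrBr.
Qed.

(** Richardson iteration [x + tau (d - S x)] started at 0. It preserves the vectors supported in
    [J], and coercivity makes it a contraction there. *)
Lemma gramian_surjective d : supported d ->
  exists x, supported x /\ nrm (S x - d) = 0.
Proof.
move=> dJ; pose Phi x := x + tau%:C%C *: (d - S x).
have PhiJ x : supported x -> supported (Phi x).
  move=> xJ; apply: supportedD => // i Ji; rewrite coefB dJ// duhamel_supported//.
  by rewrite subrr.
have contr x y : supported x -> supported y -> nrm (Phi x - Phi y) <= rho * nrm (x - y).
  move=> xJ yJ; have xyJ : supported (x - y) by move=> i Ji; rewrite coefB xJ// yJ// subrr.
  apply: le_trans (richardson_contraction xyJ); rewrite le_eqVlt; apply/orP; left; apply/eqP.
  apply: nrm_eqv; apply: (eq_coef (e := e)) => i.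
  have SB : coef (S (x - y)) i = coef (S x) i - coef (S y) i.
    have mD : @measurable _ (measurableTypeR R) `]0, T[%classic by [].
    rewrite !coef_duhamel// -cintegralB//; try by apply: ucont_tintble; exact: ucont_pullback.
    by apply: eq_cintegral => s _; rewrite coef_pullbackB.
  by rewrite /Phi !(coefB, coefD, coefZ) SB rmorphN/=; ring.
pose u := fun n => iter n Phi 0.
have uJ n : supported (u n).
  by elim: n => [i _|n IH]; [rewrite /coef /= ip0l|exact: PhiJ].
pose K := nrm (u 1 - u 0) / (1 - rho).
have r1 : 0 < 1 - rho by rewrite subr_gt0.
have KE : nrm (u 1 - u 0) = (1 - rho) * K by rewrite /K mulrC divfK// gt_eqF.
have K0 : 0 <= K by rewrite /K divr_ge0 ?nrm_ge0 ?ltW.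
(* [K] is the sum of the geometric series of ratio [rho] whose first term is the length of the first
   step. *)
have uK m : nrm (u m - u 0) <= K.
  elim: m => [|m IH]; first by rewrite subrr nrm0.
  apply: le_trans (nrm_tri _ (u 1) _ _) _; rewrite KE.
  have := contr _ _ (uJ m) (uJ 0); rewrite -/(u m.+1) -/(u 1) => h.
  have : rho * nrm (u m - u 0) <= rho * K by rewrite ler_wpM2l.
  by move: h; rewrite /=; lra.
have uC n m : nrm (u (n + m)%N - u n) <= rho ^+ n * K.
  elim: n => [|n IH]; first by rewrite add0n expr0 mul1r.
  apply: le_trans (contr _ _ (uJ _) (uJ _)) _.
  by rewrite exprS -mulrA ler_wpM2l.
have geo : forall eps, 0 < eps -> exists N, forall n, (N <= n)%N -> rho ^+ n * K <= eps.
  move=> eps e0; have := @cvg_geometric R K rho; rewrite ger0_norm// => /(_ rho_lt1).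
  move=> /cvgrPdist_le/(_ _ e0)[N _ hN]; exists N => n Nn.
  have := hN n Nn; rewrite sub0r normrN => h; rewrite mulrC.
  exact: le_trans (ler_norm _) h.
have [eps e0|x hx] := @nrm_complete _ _ H u.
  have [N hN] := geo _ e0; exists N => n m.
  wlog nm : n m / (n <= m)%N => [W Nn Nm|Nn _].
    by case/orP: (leq_total n m) => h; [|rewrite nrmBC]; apply: W.
  by rewrite nrmBC -(subnKC nm); apply: le_trans (uC _ _) (hN _ Nn).
exists x; split.
  move=> i Ji; apply: normsq_eq0; apply/eqP; rewrite -cabs_sq sqrf_eq0 eq_le cabs_ge0 andbT.
  apply/ler_addgt0Pr => eps e0; rewrite add0r; have [N hN] := hx _ e0.
  apply: le_trans (hN N (leqnn N)); rewrite nrmBC; apply: le_trans (cabs_coef e _ i).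
  by rewrite coefB uJ// subr0.
apply/eqP; rewrite eq_le nrm_ge0 andbT; apply/ler_addgt0Pr => eps e0; rewrite add0r.
have tau0 : 0 < tau by rewrite divr_gt0 ?exprn_gt0.
have e1 : 0 < eps / (2 * C) by rewrite divr_gt0 ?mulr_gt0.
have e2 : 0 < tau * (eps / 4) by apply: mulr_gt0 => //; rewrite divr_gt0.
have e3 : 0 < Num.min (eps / (2 * C)) (tau * (eps / 4)) by rewrite lt_min e1 e2.
have [N hN] := hx _ e3.
have := hN N (leqnn N); have := hN N.+1 (leqnSn N); rewrite !le_min.
move=> /andP[_ g1] /andP[g2 g3].
(* The residual at [u N] is, up to the factor [tau], the increment from [u N] to its successor,
   which is small by convergence. *)
have g4 : tau * nrm (d - S (u N)) <= tau * (eps / 2).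
  have -> : tau * nrm (d - S (u N)) = nrm (u N.+1 - u N).
    rewrite [u N.+1]/= -/(u N) /Phi [_ + _ - _]addrC addKr nrmZ cabs_real.
    by rewrite ger0_norm// ltW.
  apply: le_trans (nrm_tri _ x _ _) _; rewrite [nrm (x - _)]nrmBC.
  by move: g1 g3; rewrite -!mulrA; lra.
rewrite ler_pM2l// in g4.
apply: le_trans (nrm_tri _ (S (u N)) _ _) _; rewrite nrmBC [nrm (_ - d)]nrmBC.
have := nrm_gramianB (u N) x; have : C * nrm (u N - x) <= eps / 2.
  apply: le_trans (_ : C * (eps / (2 * C)) <= _); first by rewrite ler_wpM2l ?(ltW C0).
  by rewrite le_eqVlt; apply/orP; left; apply/eqP; field; rewrite gt_eqF.
by move: g4; lra.
Qed.

End Controllability.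

End Evolution.

(** * Observability of exponential sums *)

Section Primitives.
Variable R : realType.

Lemma derive_lin a b (f g df dg : R -> R) :
  (forall x : R, is_derive x 1 f (df x)) -> (forall x : R, is_derive x 1 g (dg x)) ->
  forall x : R, is_derive x 1 (fun t => a * f t + b * g t) (a * df x + b * dg x).
Proof.
move=> hf hg x.
exact: (is_deriveD (is_deriveZ a (hf x)) (is_deriveZ b (hg x))).
Qed.

Lemma derive_translate c (f df : R -> R) : (forall x : R, is_derive x 1 f (df x)) ->
  forall x : R, is_derive x 1 (fun t => f (t + c)) (df (x + c)).
Proof.
move=> hf x.
have h1 : is_derive x 1 (fun t : R => t + c) 1.
  have := is_deriveD (is_derive_id x 1) (is_derive_cst c x 1).
  by rewrite addr0.
have := @is_derive1_comp _ f (fun t => t + c) x _ _ (hf _) h1.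
by rewrite mulr1.
Qed.

Lemma derive_bigsum (I : Type) (s : seq I) (F dF : I -> R -> R) :
  (forall i (x : R), is_derive x 1 (F i) (dF i x)) ->
  forall x : R, is_derive x 1 (fun t => \sum_(i <- s) F i t) (\sum_(i <- s) dF i x).
Proof.
move=> h x; elim: s => [|i s IH].
  by under eq_fun do rewrite big_nil; rewrite big_nil; exact: is_derive_cst.
rewrite big_cons; under eq_fun do rewrite big_cons.
exact: (is_deriveD (h i x) IH).
Qed.

Lemma derive_scaled (f df : R -> R) w : (forall x : R, is_derive x 1 f (df x)) ->
  forall x : R, is_derive x 1 (fun t => f (w * t)) (w * df (w * x)).
Proof.
move=> h x; have h1 : is_derive x 1 (fun t : R => w * t) w.
  by have := is_deriveZ w (is_derive_id x (1 : R)); rewrite /GRing.scale/= mulr1.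
by rewrite mulrC; exact: (@is_derive1_comp _ f (fun t => w * t) x _ _ (h _) h1).
Qed.

(* The primitive of t |-> cis (w t) vanishing at 0. *)
Definition cisint (w t : R) : R[i] :=
  if w == 0 then t%:C%C else Complex (w^-1 * sin (w * t)) (w^-1 * (1 - cos (w * t))).

Lemma cisint0 w : cisint w 0 = 0.
Proof.
rewrite /cisint; case: ifP => // _.
by rewrite mulr0 sin0 cos0 subrr !mulr0.
Qed.

Lemma derive_cisint (z : R[i]) w (x : R) :
  is_derive x 1 (fun t => Re (z * cisint w t)) (Re (z * cis (w * x))).
Proof.
rewrite /cisint; case: eqVneq => [->|w0].
  under eq_fun do rewrite !cE /= mulr0 subr0.
  rewrite mul0r cis0 mulr1.
  by have := is_deriveZ (Re z) (is_derive_id x (1 : R)); rewrite /GRing.scale/= mulr1.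
under eq_fun do rewrite !cE /=.
have h1 (y : R) : is_derive y 1 (fun t => 1 - cos (w * t)) (w * sin (w * y)).
  have := is_deriveB (is_derive_cst (1 : R) y 1) (derive_scaled w (@is_derive_cos R) y).
  by rewrite mulrN opprK add0r.
have := derive_lin (Re z * w^-1) (- (Im z * w^-1)) (derive_scaled w (@is_derive_sin R)) h1 x.
rewrite (_ : _ + _ = Re (z * cis (w * x))); last by rewrite !cE /=; field.
by congr (is_derive x 1 _ _); apply/funext => t; ring.
Qed.

Lemma sin_abs_le (x : R) : `|sin x| <= `|x|.
Proof.
have := @derive_lipschitz R sin cos 1 x 0 (@is_derive_sin R) (@cos_max R).
by rewrite sin0 !subr0 mul1r.
Qed.

Lemma subr1cos_le (x : R) : `|1 - cos x| <= `|x|.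
Proof.
have := @derive_lipschitz R cos _ 1 x 0 (@is_derive_cos R).
rewrite cos0 subr0 mul1r distrC; apply => y; rewrite normrN; exact: sin_max.
Qed.

Lemma cabs_cisint_le w t : 0 <= t -> cabs (cisint w t) <= 2 * t.
Proof.
move=> t0; rewrite /cisint; case: eqVneq => [_|w0].
  by rewrite cabs_real ger0_norm//; lra.
apply: le_trans (cabs_le _) _; rewrite /= !normrM normfV.
have w1 : 0 < `|w| by rewrite normr_gt0.
have h (y : R) : `|y| <= `|w * t| -> `|w|^-1 * `|y| <= t.
  by rewrite normrM (ger0_norm t0) ler_pdivrMl.
by have := h _ (sin_abs_le (w * t)); have := h _ (subr1cos_le (w * t)); lra.
Qed.

(** The gain from oscillation, independent of the length of time: a large difference of frequencies
    makes two modes almost orthogonal in time. *)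
Lemma cabs_cisint_inv w t : w != 0 -> cabs (cisint w t) <= 3 / `|w|.
Proof.
move=> w0; rewrite /cisint (negbTE w0); apply: le_trans (cabs_le _) _.
rewrite /= !normrM normfV -mulrDr mulrC ler_wpM2r ?invr_ge0//.
have := sin_max (w * t); have : `|1 - cos (w * t)| <= 2.
  by have := cos_max (w * t); rewrite !ler_norml => /andP[]; lra.
by lra.
Qed.

Lemma sin_le_cos_half (x : R) : 0 <= x <= 2 -> sin x <= x * cos (x / 2).
Proof.
move=> /andP[x0 x2]; have -> : sin x = 2 * (cos (x / 2) * sin (x / 2)).
  by rewrite mulr_natl -sin_mulr2n -mulr_natl; congr sin; lra.
have c0 : 0 <= cos (x / 2).
  by have := @pi_ge2 R; move=> ?; apply: cos_ge0_pihalf; lra.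
have : sin (x / 2) <= x / 2.
  apply: le_trans (ler_norm _) (le_trans (sin_abs_le _) _).
  by rewrite ger0_norm//; lra.
by move=> /(ler_wpM2l c0); lra.
Qed.

(** Used to bound below the mean over [[0, d]] of [2 - 2 cos (s t)], which is
    [2 (1 - sin (s d) / (s d))], uniformly over all [s] away from 0. Up to 2 the duplication formula
    gives [sin x <= x cos (x / 2)]; beyond 2, [1 / x < 1 / 2] suffices. *)
Lemma sinc_bound (x0 : R) : 0 < x0 ->
  exists2 k, 0 < k & forall x, x0 <= `|x| -> sin x / x <= 1 - k.
Proof.
move=> h0; pose y := Num.min x0 2.
have y0 : 0 < y by rewrite lt_min h0 ltr0n.
have y2 : y <= 2 by rewrite ge_min lexx orbT.
have pi2 := @pi_ge2 R.
have c1 : cos (y / 2) < 1.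
  by rewrite -[ltRHS]cos0 ltr_cos ?in_itv/=; lra.
exists (Num.min (1 / 2) (1 - cos (y / 2))); first by rewrite lt_min; apply/andP; lra.
move=> x hx; wlog xp : x hx / 0 < x => [W|].
  have [x1|x1|x1] := ltgtP x 0.
  - by have := W (- x); rewrite normrN sinN invrN mulrNN oppr_gt0 => /(_ hx x1).
  - exact: W.
  - by move: hx; rewrite x1 normr0; lra.
rewrite (ger0_norm (ltW xp)) in hx.
rewrite ler_pdivrMr//.
have k1 : Num.min (1 / 2) (1 - cos (y / 2)) <= 1 / 2 by rewrite ge_min lexx.
have k2 : Num.min (1 / 2) (1 - cos (y / 2)) <= 1 - cos (y / 2) by rewrite ge_min lexx orbT.
have [x2|x2] := leP x 2.
  apply: le_trans (sin_le_cos_half _) _; first by lra.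
  rewrite mulrC ler_pM2r//.
  have : cos (x / 2) <= cos (y / 2).
    have yx : y <= x by rewrite ge_min hx.
    move: yx; rewrite le_eqVlt => /orP[/eqP ->//|yx].
    by apply: ltW; rewrite ltr_cos ?in_itv/=; lra.
  by lra.
have := sin_max x; rewrite ler_norml => /andP[_ s1].
nra.
Qed.

End Primitives.

Section SeqSums.
Variable R : realType.

Lemma ler_sum_subseq (I : eqType) (r s : seq I) (f : I -> R) :
  uniq r -> {subset r <= s} -> (forall i, 0 <= f i) ->
  \sum_(i <- r) f i <= \sum_(i <- s) f i.
Proof.
move=> + + f0; elim: r s => [|x r IH] s /=.
  by move=> _ _; rewrite big_nil sumr_ge0.
move=> /andP[xr ur] rs; have xs : x \in s by apply: rs; rewrite mem_head.
rewrite big_cons (perm_big _ (perm_to_rem xs)) big_cons lerD2l; apply: IH => // y yr.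
have : y \in x :: rem x s by rewrite -(perm_mem (perm_to_rem xs)) rs// inE yr orbT.
by rewrite inE => /orP[/eqP yx|//]; rewrite -yx yr in xr.
Qed.

(** An absolute value is shared by at most two integers; counting 0 twice only enlarges the
    bound. *)
Lemma sum_absz_le (r : seq int) (h : nat -> R) : uniq r -> (forall n, 0 <= h n) ->
  exists N, \sum_(j <- r) h `|j|%N <= 2 * \sum_(n < N) h n.
Proof.
move=> ur h0; pose N := (\max_(j <- r) `|j|%N).+1; exists N.
pose s : seq int := [seq Posz n | n <- iota 0 N] ++ [seq - Posz n | n <- iota 0 N].
have rs : {subset r <= s}.
  move=> j jr; have jN : (`|j|%N < N)%N by rewrite ltnS leq_bigmax_seq.
  have ji : `|j|%N \in iota 0 N by rewrite mem_iota.
  have [j0|j0] := leP 0 j; rewrite mem_cat; apply/orP.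
    by left; rewrite -[j]gez0_abs//; apply: (map_f Posz).
  right; rewrite -[j]opprK -[- j]gez0_abs ?oppr_ge0 ?ltW// abszN.
  exact: (map_f (fun n => - Posz n)).
apply: le_trans (ler_sum_subseq ur rs (fun j => h0 _)) _.
rewrite big_cat !big_map mulr_natl mulr2n -(big_mkord xpredT h) /index_iota subn0.
apply: lerD; apply: ler_sum => i _ //; by rewrite abszN.
Qed.

(** The terms of index at most [K] contribute [(K + 1) / K ^ 2], and the tail telescopes through
    [1 / (n + 1) ^ 2 <= 1 / n - 1 / (n + 1)] to at most [1 / K]. *)
Lemma sum_inv_max_sq (K N : nat) : (0 < K)%N ->
  \sum_(n < N) ((maxn K n)%:R ^+ 2)^-1 <= 3 / K%:R :> R.
Proof.
move=> K0; have K1 : 1 <= K%:R :> R by rewrite ler1n.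
have h1 M : (M <= K.+1)%N -> \sum_(n < M) ((maxn K n)%:R ^+ 2)^-1 = M%:R / K%:R ^+ 2 :> R.
  move=> MK; rewrite (eq_bigr (fun=> (K%:R ^+ 2)^-1)).
    by rewrite sumr_const card_ord mulr_natl.
  by move=> i _; rewrite (maxn_idPl _)// -ltnS (leq_trans (ltn_ord i)).
have h2 m : \sum_(n < (K.+1 + m)%N) ((maxn K n)%:R ^+ 2)^-1 <=
    K.+1%:R / K%:R ^+ 2 + K%:R^-1 - (K + m)%:R^-1 :> R.
  elim: m => [|m IH]; first by rewrite !addn0 h1// addrK.
  rewrite addnS big_ord_recr/=.
  have -> : maxn K (K.+1 + m) = (K + m).+1 by rewrite (maxn_idPr _) // addSn ltnW// ltnS leq_addr.
  have a1 : 1 <= (K + m)%:R :> R by rewrite ler1n addn_gt0 K0.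
  have : ((K + m).+1%:R ^+ 2)^-1 <= (K + m)%:R^-1 - (K + m).+1%:R^-1 :> R.
    rewrite -natr1; set x := (K + m)%:R in a1 *.
    rewrite (_ : x^-1 - (x + 1)^-1 = (x * (x + 1))^-1); last by field; lra.
    have x1 : 0 < x + 1 by lra.
    have x0 : 0 < x by lra.
    by rewrite lef_pV2 ?posrE ?exprn_gt0 ?mulr_gt0// expr2 ler_pM2r// lerDl.
  by rewrite addnS => h; apply: le_trans (lerD IH h) _; rewrite addrA subrK.
have h3 : K.+1%:R / K%:R ^+ 2 + K%:R^-1 <= 3 / K%:R :> R.
  rewrite -natr1; set x := K%:R in K1 *.
  rewrite -subr_ge0 (_ : _ - _ = (x - 1) / x ^+ 2); last by field; lra.
  by rewrite divr_ge0 ?sqr_ge0 ?subr_ge0.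
have [NK|NK] := leqP N K.+1.
  rewrite h1//; apply: le_trans h3; rewrite -[leLHS]addr0 lerD ?invr_ge0//.
  by rewrite ler_wpM2r ?invr_ge0 ?sqr_ge0// ler_nat.
rewrite -(subnKC (ltnW NK)); apply: le_trans (h2 _) _; apply: le_trans h3.
by rewrite gerBl invr_ge0.
Qed.

End SeqSums.

Section Observation.
Local Arguments cis : simpl never.

Section Conjugation.
Variable R : realType.
Implicit Types z w : R[i].
Lemma conjM z w : (z * w)^*%C = z^*%C * w^*%C. Proof. exact: rmorphM. Qed.
Lemma conjD z w : (z + w)^*%C = z^*%C + w^*%C. Proof. exact: rmorphD. Qed.
Lemma conjB z w : (z - w)^*%C = z^*%C - w^*%C. Proof. exact: rmorphB. Qed.
Lemma conj0 : (0 : R[i])^*%C = 0. Proof. exact: rmorph0. Qed.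
End Conjugation.

Section GramForm.
Variables (R : realType) (M : int -> int -> R[i]).
Implicit Types (r : seq int) (b : int -> R[i]) (w : int -> R).

Definition gram_form r b : R :=
  \sum_(k <- r) \sum_(j <- r) Re (M k j * (b j * (b k)^*%C)).

(* The integral over [0, t] of the form evaluated along k |-> b k * cis (w k * s). *)
Definition gram_energy w r b t : R :=
  \sum_(k <- r) \sum_(j <- r) Re (M k j * (b j * (b k)^*%C) * cisint (w j - w k) t).

Definition flow w b t k : R[i] := b k * cis (w k * t).

Lemma gram_energy0 w r b : gram_energy w r b 0 = 0.
Proof.
by rewrite /gram_energy big1// => k _; rewrite big1// => j _; rewrite cisint0 mulr0.
Qed.

(** Makes [gram_energy] an explicit primitive of the form along the flow. Inequalities between
    energies are then derived from pointwise inequalities between forms, through the sign of a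
    derivative. *)
Lemma derive_gram_energy w r b (t : R) :
  is_derive t 1 (gram_energy w r b) (gram_form r (flow w b t)).
Proof.
have -> : gram_form r (flow w b t) = \sum_(k <- r) \sum_(j <- r)
    Re (M k j * (b j * (b k)^*%C) * cis ((w j - w k) * t)).
  apply: eq_bigr => k _; apply: eq_bigr => j _; congr complex.Re.
  rewrite /flow conjM -cisN mulrBl cisD; ring.
apply: (@derive_bigsum R _ r _ (fun k x => \sum_(j <- r)
    Re (M k j * (b j * (b k)^*%C) * cis ((w j - w k) * x)))) => k x.
apply: (@derive_bigsum R _ r _ (fun j x =>
    Re (M k j * (b j * (b k)^*%C) * cis ((w j - w k) * x)))) => j y.
exact: derive_cisint.
Qed.

Lemma eq_gram_form r b b' : {in r, b =1 b'} -> gram_form r b = gram_form r b'.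
Proof.
move=> h; rewrite /gram_form big_seq [RHS]big_seq; apply: eq_bigr => k kr.
rewrite big_seq [RHS]big_seq; apply: eq_bigr => j jr.
by rewrite !h.
Qed.

Lemma gram_form_parallelogram r b b' :
  gram_form r (fun k => b k + b' k) + gram_form r (fun k => b k - b' k) =
  2 * gram_form r b + 2 * gram_form r b'.
Proof.
rewrite /gram_form !mulr_sumr -!big_split; apply: eq_bigr => k _ /=.
rewrite !mulr_sumr -!big_split; apply: eq_bigr => j _ /=.
rewrite conjD conjB !cE; ring.
Qed.

(** The rotation by [t] is common to all modes, so it cancels in each product [b j * conj (b k)]. *)
Lemma gram_form_rotate r b t : gram_form r (fun k => b k * cis t) = gram_form r b.
Proof.
apply: eq_bigr => k _; apply: eq_bigr => j _; congr complex.Re.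
rewrite conjM -cisN; congr (_ * _).
by rewrite mulrACA -cisD subrr cis0 mulr1.
Qed.

Lemma gram_form_filter r (p : pred int) b :
  gram_form r (fun k => if p k then b k else 0) = gram_form [seq k <- r | p k] b.
Proof.
rewrite /gram_form big_filter [RHS]big_mkcond; apply: eq_bigr => k _.
case: (p k); last first.
  by rewrite big1// => j _; rewrite conj0 !mulr0.
rewrite big_filter [RHS]big_mkcond; apply: eq_bigr => j _.
by case: (p j) => //; rewrite mul0r mulr0.
Qed.

Lemma gram_energy_filter w r (p : pred int) b t :
  gram_energy w r (fun k => if p k then b k else 0) t =
  gram_energy w [seq k <- r | p k] b t.
Proof.
rewrite /gram_energy big_filter [RHS]big_mkcond; apply: eq_bigr => k _.
case: (p k); last first.
  by rewrite big1// => j _; rewrite conj0 !(mulr0, mul0r).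
rewrite big_filter [RHS]big_mkcond; apply: eq_bigr => j _.
by case: (p j) => //; rewrite !(mul0r, mulr0).
Qed.

Hypothesis M_ge0 : forall r b, 0 <= gram_form r b.

Lemma gram_formB_le r b b' :
  gram_form r (fun k => b k - b' k) <= 2 * gram_form r b + 2 * gram_form r b'.
Proof.
by rewrite -gram_form_parallelogram lerDr.
Qed.

End GramForm.

(** * The frequencies and their separation *)

Section KPFrequency.
Variable R : realType.

Definition kpfreq (l k : int) : R := k%:~R ^+ 3 - l%:~R ^+ 2 / k%:~R.

Lemma intr_ge1 (n : int) : n != 0 -> 1 <= `|n%:~R| :> R.
Proof. by move=> n0; rewrite -intr_norm ler1z -gtz0_ge1 normr_gt0. Qed.

Lemma kpfreqB l k j : k != 0 -> j != 0 -> kpfreq l k - kpfreq l j =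
  (k%:~R - j%:~R) * (k%:~R ^+ 2 + k%:~R * j%:~R + j%:~R ^+ 2 + l%:~R ^+ 2 / (k%:~R * j%:~R)).
Proof.
move=> k0 j0; rewrite /kpfreq; field.
by rewrite !intr_eq0 k0 j0.
Qed.

(** All terms of the second factor in [kpfreqB] are nonnegative when [k] and [j] have the same sign,
    so [l] can only widen the gap. *)
Lemma kpfreq_gap_same l k j : k != j -> 0 < k * j ->
  Num.max `|k%:~R| `|j%:~R| ^+ 2 <= `|kpfreq l k - kpfreq l j| :> R.
Proof.
move=> kj kj0; have /andP[k0 j0] : (k != 0) && (j != 0).
  by rewrite -negb_or -mulf_eq0 gt_eqF.
rewrite kpfreqB// normrM.
have h1 : 1 <= `|k%:~R - j%:~R| :> R by rewrite -intrB intr_ge1// subr_eq0.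
have h2 : 0 < k%:~R * j%:~R :> R by rewrite -intrM ltr0z.
set x := k%:~R : R in h1 h2 *; set y := j%:~R : R in h1 h2 *.
have h3 : 0 <= l%:~R ^+ 2 / (x * y) by rewrite divr_ge0 ?sqr_ge0 ?ltW.
have h4 : Num.max `|x| `|y| ^+ 2 <= x ^+ 2 + x * y + y ^+ 2 + l%:~R ^+ 2 / (x * y).
  have x2 := sqr_ge0 x; have y2 := sqr_ge0 y.
  by case: (leP `|x| `|y|) => _; rewrite real_normK ?num_real//; lra.
apply: le_trans h4 _; apply: le_trans (ler_norm _) _.
by rewrite ler_peMl.
Qed.

(** For opposite signs, the second factor of [kpfreqB] is a nonzero integer divided by [k j], while
    [|k - j| = |k| + |j|]; the quotient [(|k| + |j|) / (|k| |j|)] exceeds [1 / |k|]. The bound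
    involves [k] alone, so it is uniform in [j] and [l]. *)
Lemma kpfreq_gap l k j : k != 0 -> j != 0 -> kpfreq l k != kpfreq l j ->
  `|k%:~R|^-1 <= `|kpfreq l k - kpfreq l j| :> R.
Proof.
move=> k0 j0 wkj; have kj : k != j by apply: contraNneq wkj => ->.
have k1 : 1 <= `|k%:~R| :> R by exact: intr_ge1.
have j1 : 1 <= `|j%:~R| :> R by exact: intr_ge1.
have [kj0|kj0|kj0] := ltgtP 0 (k * j).
- apply: le_trans (kpfreq_gap_same l kj kj0).
  apply: (@le_trans _ _ 1); first by rewrite invf_le1// (lt_le_trans ltr01).
  by apply: (@exprn_ege1 _ 2); rewrite le_max k1.
- have kj1 : k%:~R * j%:~R < 0 :> R by rewrite -intrM ltrz0.
  have E : kpfreq l k - kpfreq l j = (k%:~R - j%:~R) *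
      ((k * j * (k ^+ 2 + k * j + j ^+ 2) + l ^+ 2)%:~R / (k%:~R * j%:~R)) :> R.
    rewrite kpfreqB// !(intrD, intrM, rmorphXn)/=; congr (_ * _); field.
    by rewrite !intr_eq0 k0 j0.
  have n0 : k * j * (k ^+ 2 + k * j + j ^+ 2) + l ^+ 2 != 0.
    apply: contraNneq wkj => n0; move: E; rewrite n0 mul0r mulr0.
    by move/eqP; rewrite subr_eq0.
  rewrite E !normrM normfV normrM; have := intr_ge1 n0.
  set n := `|_%:~R| => n1.
  have -> : `|k%:~R - j%:~R| = `|k%:~R| + `|j%:~R| :> R.
    set x := k%:~R : R in kj1 *; set y := j%:~R : R in kj1 *.
    have [x0|x0|x0] := ltgtP 0 x; last by move: kj1; rewrite -x0 mul0r ltxx.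
      have y0 : y < 0 by rewrite pmulr_rlt0 in kj1.
      by rewrite (gtr0_norm x0) (ltr0_norm y0) gtr0_norm; lra.
    have y0 : 0 < y by rewrite nmulr_rlt0 in kj1.
    by rewrite (ltr0_norm x0) (gtr0_norm y0) ltr0_norm; lra.
  set x := `|k%:~R| in k1 *; set y := `|j%:~R| in j1 *.
  rewrite -[x^-1]mul1r.
  have x0 : x != 0 by rewrite gt_eqF//; lra.
  have y0 : y != 0 by rewrite gt_eqF//; lra.
  rewrite (_ : (x + y) * (n / (x * y)) = (x + y) / y * n / x); last by field; rewrite ?x0 ?y0.
  rewrite ler_wpM2r ?invr_ge0 ?(le_trans ler01 k1)//.
  have : 1 <= (x + y) / y by rewrite ler_pdivlMr ?(lt_le_trans ltr01 j1)// mul1r lerDr (le_trans ler01 k1).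
  by move=> h; rewrite mulr_ege1.
- by move: kj0 => /esym/eqP; rewrite mulf_eq0 (negbTE k0) (negbTE j0).
Qed.

End KPFrequency.

(** * Observability, from the high modes to all modes *)

Section Observability.
Variables (R : realType) (M : int -> int -> R[i]) (C m0 cp : R) (N1 : nat).
Hypotheses (C0 : 0 <= C) (m00 : 0 < m0) (cp0 : 0 < cp).
Hypothesis M_ge0 : forall r b, 0 <= gram_form M r b.
Hypothesis M_upper : forall r b, uniq r -> gram_form M r b <= C * \sum_(k <- r) normsq (b k).
Hypothesis M_bound : forall k j, cabs (M k j) <= C.
Hypothesis M_opp : forall k j, k * j < 0 -> cabs (M k j) <= C / (maxn `|k| `|j|)%:R ^+ 2.
Hypothesis M_diag : forall k, (N1 <= `|k|)%N -> m0 <= Re (M k k).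
Hypothesis M_pair : forall k j b, k != 0 -> j != 0 -> k != j ->
  cp * (normsq (b k) + normsq (b j)) <= gram_form M [:: k; j] b.
Local Notation energy l := (gram_energy M (kpfreq R l)).

(** The constant is chosen before [l]: this is the uniformity in the mode in [y] that lets the
    inequalities for separate [l] be added up. *)
Definition observable (F : pred int) (T : R) := exists2 c, 0 < c & forall l r b, uniq r ->
  {in r, forall k, (k != 0) && F k} -> c * \sum_(k <- r) normsq (b k) <= energy l r b T.

Lemma energy_mono l r b (s t : R) : s <= t -> energy l r b s <= energy l r b t.
Proof.
by apply: derive_ge0_le => [x|x _]; [exact: derive_gram_energy|exact: M_ge0].
Qed.

Lemma observable_mono F T T' : T <= T' -> observable F T -> observable F T'.
Proof.
move=> TT [c c0 h]; exists c => // l r b ur hr; apply: le_trans (h l r b ur hr) _.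
exact: energy_mono.
Qed.

Lemma observable_sub (F F' : pred int) T : (forall k, k != 0 -> F' k -> F k) ->
  observable F T -> observable F' T.
Proof.
move=> FF [c c0 h]; exists c => // l r b ur hr; apply: h => // k kr.
by have /andP[k0 /(FF _ k0) ->] := hr k kr; rewrite k0.
Qed.

Lemma absz_intr (k : int) : `|k|%N%:R = `|k%:~R| :> R.
Proof. by rewrite natr_absz intr_norm. Qed.

(** Equal signs use the time oscillation (the 3) together with boundedness of [M]; opposite signs
    use the decay of [M] together with the trivial bound on the time integral (the [2 T]). Both give
    the same order in [max(|k|, |j|)]. *)
Lemma offdiag_bound l k j T : 0 <= T -> k != 0 -> j != 0 -> k != j ->
  cabs (M k j) * cabs (cisint (kpfreq R l j - kpfreq R l k) T) <=
  C * (3 + 2 * T) / (maxn `|k| `|j|)%:R ^+ 2.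
Proof.
move=> T0 k0 j0 kj; set m := (maxn _ _)%:R ^+ 2.
have m1 : 0 < m :> R.
  by rewrite exprn_gt0// ltr0n leq_max absz_gt0 k0.
have [kj0|kj0|kj0] := ltgtP 0 (k * j).
- have g := kpfreq_gap_same R l kj kj0.
  have mE : m = Num.max `|k%:~R| `|j%:~R| ^+ 2 :> R.
    by rewrite /m natr_max !absz_intr.
  rewrite -mE distrC in g.
  have w0 : kpfreq R l j - kpfreq R l k != 0.
    by rewrite -normr_gt0; exact: lt_le_trans g.
  have h : cabs (cisint (kpfreq R l j - kpfreq R l k) T) <= 3 / m.
    apply: le_trans (cabs_cisint_inv T w0) _.
    by rewrite ler_wpM2l// lef_pV2 ?posrE// (lt_le_trans m1).
  rewrite -mulrA; apply: ler_pM; rewrite ?cabs_ge0//; apply: le_trans h _.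
  by rewrite ler_wpM2r ?invr_ge0 ?(ltW m1)// lerDl mulr_ge0.
- apply: le_trans (ler_pM (cabs_ge0 _) (cabs_ge0 _) (M_opp kj0) (cabs_cisint_le _ T0)) _.
  rewrite -/m mulrAC ler_wpM2r ?invr_ge0 ?(ltW m1)// ler_wpM2l//; lra.
- by move: kj0 => /esym/eqP; rewrite mulf_eq0 (negbTE k0) (negbTE j0).
Qed.

(** A Schur test: the off-diagonal products are split by the arithmetic-geometric inequality, and
    the symmetric majorant [B] has row sums below half of the diagonal. *)
Lemma observable_high T : 0 < T -> exists N, observable (fun k => (N <= `|k|)%N) T.
Proof.
move=> T0; pose C1 := C * (3 + 2 * T).
have C10 : 0 <= C1 by rewrite mulr_ge0//; lra.
(* The row of [k] sums to at most [2 * 3 C1 / |k|]; this choice makes it at most [T m0 / 2] when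
   [|k| >= N]. *)
pose N := maxn (maxn N1 1) (Num.trunc (12 * C1 / (T * m0))).+1.
have N_gt0 : (0 < N)%N by rewrite /N !leq_max ltnS leqnn orbT.
have Tm : 0 < T * m0 by rewrite mulr_gt0.
have hN : 6 * C1 / N%:R <= T * m0 / 2.
  have h1 : 12 * C1 / (T * m0) <= N%:R.
    by apply: ltW; apply: lt_le_trans (truncnS_gt _) _; rewrite ler_nat leq_maxr.
  rewrite ler_pdivrMr ?ltr0n// -ler_pdivrMl ?divr_gt0//.
  by apply: le_trans h1; rewrite le_eqVlt; apply/orP; left; apply/eqP; field; rewrite !gt_eqF.
exists N; exists (T * m0 / 2); first by rewrite divr_gt0.
move=> l r b ur hr.
pose B k j := C1 / (maxn `|k| `|j|)%:R ^+ 2.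
have B0 k j : 0 <= B k j by rewrite divr_ge0 ?sqr_ge0.
have BC k j : B k j = B j k by rewrite /B maxnC.
have sumB k : k \in r -> \sum_(j <- r) B k j <= 6 * C1 / N%:R.
  move=> kr; have /andP[k0 kN] := hr _ kr.
  have h0 n : 0 <= ((maxn `|k| n)%:R ^+ 2)^-1 :> R by rewrite invr_ge0 sqr_ge0.
  have [n hn] := sum_absz_le ur h0.
  rewrite /B -mulr_sumr (_ : 6 * C1 / N%:R = C1 * (6 / N%:R)); last by ring.
  apply: ler_wpM2l => //; apply: le_trans hn _.
  have k1 : (0 < `|k|)%N by rewrite absz_gt0.
  have := sum_inv_max_sq R n k1.
  have : 3 / `|k|%N%:R <= 3 / N%:R :> R.
    by rewrite ler_wpM2l// lef_pV2 ?posrE ?ltr0n// ler_nat.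
  by lra.
pose n k := normsq (b k).
(* [B] is subtracted on the diagonal as well, at no harm, so that full row sums appear. *)
have term k j : k \in r -> j \in r -> (if j == k then T * m0 * n k else 0) -
    (B k j * n k + B k j * n j) / 2 <=
    Re (M k j * (b j * (b k)^*%C) * cisint (kpfreq R l j - kpfreq R l k) T).
  move=> kr jr; have n0 i : 0 <= n i := normsq_ge0 _.
  have [->|jk] := eqVneq j k.
    rewrite subrr /cisint eqxx mulcJ !cE /= !mulr0 !subr0 -/(n k).
    have /andP[k0 kN] := hr _ kr.
    have h : T * m0 * n k <= Re (M k k) * n k * T.
      rewrite [leRHS]mulrAC ler_wpM2r// mulrC ler_wpM2r ?(ltW T0)// M_diag//.
      by rewrite (leq_trans _ kN)// /N !leq_max leqnn.
    by have : 0 <= B k k * n k := mulr_ge0 (B0 _ _) (n0 _); lra.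
  have /andP[k0 _] := hr _ kr; have /andP[j0 _] := hr _ jr.
  have kj : k != j by rewrite eq_sym.
  have := offdiag_bound l (ltW T0) k0 j0 kj; rewrite -/C1 -/(B k j) => h.
  have := ler_Re_cabs (M k j * (b j * (b k)^*%C) * cisint (kpfreq R l j - kpfreq R l k) T).
  rewrite !cabsM cabsJ ler_norml => /andP[+ _].
  apply: le_trans; rewrite sub0r lerN2.
  have h2 : cabs (b j) * cabs (b k) <= (n k + n j) / 2.
    by rewrite /n -!cabs_sq; have := sqr_ge0 (cabs (b j) - cabs (b k)); nra.
  have h3 := ler_pM (mulr_ge0 (cabs_ge0 _) (cabs_ge0 _)) (mulr_ge0 (cabs_ge0 _) (cabs_ge0 _)) h h2.
  by apply: le_trans (le_trans h3 _); rewrite le_eqVlt; apply/orP; left; apply/eqP; ring.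
apply: (@le_trans _ _ (\sum_(k <- r) \sum_(j <- r)
    ((if j == k then T * m0 * n k else 0) - (B k j * n k + B k j * n j) / 2))); last first.
  rewrite /gram_energy big_seq [leRHS]big_seq; apply: ler_sum => k kr.
  by rewrite big_seq [leRHS]big_seq; apply: ler_sum => j jr; exact: term.
have E1 : \sum_(k <- r) \sum_(j <- r)
    ((if j == k then T * m0 * n k else 0) - (B k j * n k + B k j * n j) / 2) =
    \sum_(k <- r) (T * m0 * n k) - \sum_(k <- r) n k * \sum_(j <- r) B k j.
  have -> : \sum_(k <- r) n k * \sum_(j <- r) B k j =
      \sum_(k <- r) \sum_(j <- r) (B k j * n k + B k j * n j) / 2.
    under [RHS]eq_bigr do rewrite -mulr_suml big_split mulrDl.
    rewrite big_split/= -!mulr_suml.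
    rewrite [X in _ = _ + X / 2]exchange_big/=.
    have -> : \sum_(k <- r) n k * \sum_(j <- r) B k j = \sum_(k <- r) \sum_(j <- r) B k j * n k.
      by apply: eq_bigr => k _; rewrite mulr_sumr; apply: eq_bigr => j _; rewrite mulrC.
    rewrite (_ : \sum_(j <- r) \sum_(i <- r) B i j * n j = \sum_(k <- r) \sum_(j <- r) B k j * n k).
      by lra.
    by apply: eq_bigr => j _; apply: eq_bigr => i _; rewrite BC.
  rewrite -sumrB big_seq [RHS]big_seq; apply: eq_bigr => k kr.
  rewrite sumrB; congr (_ - _).
  by rewrite (bigD1_seq k)//= eqxx big1 ?addr0// => j /negbTE ->.
rewrite E1 -mulr_sumr.
have : \sum_(k <- r) n k * \sum_(j <- r) B k j <= \sum_(k <- r) n k * (T * m0 / 2).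
  rewrite big_seq [leRHS]big_seq; apply: ler_sum => k kr.
  by rewrite ler_wpM2l ?normsq_ge0// (le_trans (sumB k kr)).
by rewrite -mulr_suml /n; lra.
Qed.

Lemma energy_ge0 l r b (t : R) : 0 <= t -> 0 <= energy l r b t.
Proof. by move=> t0; rewrite -(gram_energy0 M (kpfreq R l) r b) energy_mono. Qed.

(* Subtracting the rotation by w k0 from the time-shifted signal annihilates the modes of
   frequency w k0. *)
Lemma energy_shift_le l r b mu (T d t : R) : 0 <= T -> 0 <= t <= d ->
  energy l r (fun k => b k * (cis (kpfreq R l k * t) - cis (mu * t))) T <=
  4 * energy l r b (T + d).
Proof.
move=> T0 /andP[t0 td]; set D := fun k => _; set w := kpfreq R l.
have dD := derive_gram_energy M w r D; have db := derive_gram_energy M w r b.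
(* The form of a difference is at most twice the sum of the two forms, and the rotation leaves the
   form unchanged. Over [[0, T]] this yields twice the energies on [[t, T + t]] and on [[0, T]],
   each at most the energy up to [T + d]. *)
have := derive_ge0_le (derive_lin 1 (-1) (derive_lin 2 2 (derive_translate t db) db) dD)
  (a := 0) (b := T) _ T0.
rewrite !gram_energy0 add0r; have e0 : 0 <= energy l r b t by exact: energy_ge0.
have e1 : energy l r b (T + t) <= energy l r b (T + d) by apply: energy_mono; rewrite lerD2l.
have e2 : energy l r b T <= energy l r b (T + d).
  by apply: energy_mono; rewrite lerDl (le_trans t0).
move=> h; have {h} := h _; rewrite -/w in e0 e1 e2 *.
suff h x : 0 <= 1 * (2 * gram_form M r (flow w b (x + t)) + 2 * gram_form M r (flow w b x)) +
    -1 * gram_form M r (flow w D x).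
  by move=> /(_ (fun x _ => h x)); lra.
rewrite (@eq_gram_form _ M r (flow w D x) (fun k => flow w b (x + t) k - flow w b x k * cis (mu * t))).
  have := gram_formB_le M_ge0 r (flow w b (x + t)) (fun k => flow w b x k * cis (mu * t)).
  by rewrite gram_form_rotate; lra.
by move=> k _; rewrite /flow /D -/w [w k * (x + t)]mulrDr cisD; ring.
Qed.

Lemma energy_resonant l r b mu (t : R) : {in r, forall k, kpfreq R l k = mu} ->
  energy l r b t = t * gram_form M r b.
Proof.
move=> h; rewrite /gram_energy /gram_form mulr_sumr big_seq [RHS]big_seq.
apply: eq_bigr => k kr; rewrite mulr_sumr big_seq [RHS]big_seq; apply: eq_bigr => j jr.
by rewrite !h// subrr /cisint eqxx !cE /=; ring.
Qed.

(** Two modes of the same sign have different frequencies, so at most one mode of each sign has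
    frequency [mu]; among three modes two share their sign. The 2 x 2 bound [M_pair] is therefore
    enough. *)
Lemma resonant_coercive l r b mu : uniq r -> {in r, forall k, (k != 0) && (kpfreq R l k == mu)} ->
  cp * \sum_(k <- r) normsq (b k) <= gram_form M r b.
Proof.
have same k j : k != 0 -> kpfreq R l k = mu -> kpfreq R l j = mu -> k != j -> ~~ (0 < k * j).
  move=> k0 hk hj kj; apply/negP => kj0; have := kpfreq_gap_same R l kj kj0.
  rewrite hk hj subrr normr0 leNgt exprn_gt0// lt_max normr_gt0 intr_eq0 k0 //.
case: r => [_ _|k [_ /(_ k (mem_head _ _))/andP[k0 _]|j [|i r]]].
- by rewrite big_nil mulr0.
- have kNk : k != - k by rewrite -subr_eq0 opprK -mulr2n mulrn_eq0.
  (* A single mode is completed to a pair by [- k], with coefficient 0. *)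
  have := @M_pair k (- k) (fun j => if j == k then b j else 0) k0.
  rewrite oppr_eq0 => /(_ k0 kNk).
  rewrite (gram_form_filter M [:: k; - k] (pred1 k) b) /= eqxx [- k == k]eq_sym (negbTE kNk).
  by rewrite big_seq1 [normsq 0]/normsq /= expr0n !addr0.
- rewrite /= inE andbT => kj h.
  have /andP[k0 _] := h k (mem_head _ _).
  have /andP[j0 _] : (j != 0) && (kpfreq R l j == mu) by apply: h; rewrite !inE eqxx orbT.
  by rewrite big_cons big_seq1; exact: M_pair.
- rewrite /= !inE !negb_or => /andP[/and3P[kj ki _] /andP[/andP[ji _] _]] h.
  have /andP[k0 /eqP hk] := h k (mem_head _ _).
  have /andP[j0 /eqP hj] : (j != 0) && (kpfreq R l j == mu) by apply: h; rewrite !inE eqxx !orbT.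
  have /andP[i0 /eqP hi] : (i != 0) && (kpfreq R l i == mu) by apply: h; rewrite !inE eqxx !orbT.
  have h1 := same k j k0 hk hj kj; have h2 := same k i k0 hk hi ki; have h3 := same j i j0 hj hi ji.
  have a1 : 0 < k ^+ 2 by rewrite exprn_even_gt0.
  have a2 : k * j < 0 by rewrite lt_neqAle leNgt h1 mulf_neq0.
  have a3 : k * i < 0 by rewrite lt_neqAle leNgt h2 mulf_neq0.
  have a4 : 0 < (k * j) * (k * i) by rewrite nmulr_rgt0.
  have E : k ^+ 2 * (j * i) = (k * j) * (k * i) by ring.
  by move: h3; rewrite -(pmulr_rgt0 _ a1) E a4.
Qed.

(** The modes [r'] off the frequency of [k0] are bounded first, by the shifted difference and the
    known observability of [F]; the resonant modes [E] are then what remains of the signal, and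
    their form does not vary in time. *)
Lemma observable_add F k0 T d : 0 < T -> 0 < d -> k0 != 0 -> observable F T ->
  observable (fun k => (k == k0) || F k) (T + d).
Proof.
move=> T0 d0 k00 [c c0 hc]; pose Tp := T + d; have Tp0 : 0 < Tp by rewrite addr_gt0.
have nk0 : 0 < `|k0%:~R| :> R by rewrite normr_gt0 intr_eq0.
(* Frequencies different from [mu] are at least [1 / |k0|] away from it, so [|s k * d|] is at least
   this threshold, for every [k] and every [l]. *)
have [kap kap0 hkap] := sinc_bound (divr_gt0 d0 nk0).
pose K1 := 2 / (c * kap); have K10 : 0 < K1 by rewrite divr_gt0 ?mulr_gt0.
pose K2 := (2 + 2 * (C * K1 * Tp)) / (Tp * cp).
have K20 : 0 < K2.
  have h : 0 <= C * K1 * Tp := mulr_ge0 (mulr_ge0 C0 (ltW K10)) (ltW Tp0).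
  by rewrite divr_gt0 ?(mulr_gt0 Tp0)//; lra.
exists (K1 + K2)^-1; first by rewrite invr_gt0 addr_gt0.
move=> l r b ur hr; set w := kpfreq R l; set mu := w k0.
pose p k := w k != mu; pose r' := [seq k <- r | p k]; pose E := [seq k <- r | ~~ p k].
set EN := energy l r b _; have EN0 : 0 <= EN by apply: energy_ge0; exact: ltW.
have ur' : uniq r' by rewrite filter_uniq.
(* The new mode [k0] has frequency [mu], hence does not occur in [r']. *)
have hr' : {in r', forall k, (k != 0) && F k}.
  move=> k; rewrite mem_filter => /andP[pk kr]; have /andP[-> /orP[/eqP kk0|//]] := hr _ kr.
  by rewrite /p kk0 eqxx in pk.
pose A := \sum_(k <- r') normsq (b k).
have hA : A <= K1 * EN.
  pose s k := w k - mu.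
  (* The factor [2 - 2 cos (s k t)] is the squared modulus of [cis (w k t) - cis (mu t)]. At a given
     time it may vanish for some [k], so the inequality is integrated over [t] in [[0, d]] before
     the factor is bounded below. *)
  have h1 t : 0 <= t <= d -> c * \sum_(k <- r') normsq (b k) * (2 - 2 * cos (s k * t)) <= 4 * EN.
    move=> td; apply: le_trans (energy_shift_le l r b mu (ltW T0) td).
    rewrite -/w (_ : (fun k => _) = (fun k => if p k then
      b k * (cis (w k * t) - cis (mu * t)) else 0)); last first.
      apply/funext => k; rewrite /p; case: eqVneq => [->|//].
      by rewrite subrr mulr0.
    rewrite gram_energy_filter; apply: le_trans (hc l r' _ ur' hr').
    rewrite le_eqVlt; apply/orP; left; apply/eqP; congr (_ * _); apply: eq_bigr => k _.
    rewrite normsqM; congr (_ * _); rewrite /s mulrBl cosB /normsq !cE /cis /=.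
    by have := cos2Dsin2 (w k * t); have := cos2Dsin2 (mu * t); lra.
  have dsum : forall x : R, is_derive x 1
      (fun t => \sum_(k <- r') (2 * normsq (b k) * t + - (2 * normsq (b k) / s k) * sin (s k * t)))
      (\sum_(k <- r') (2 * normsq (b k) * 1 + - (2 * normsq (b k) / s k) * (s k * cos (s k * x)))).
    move=> x; apply: (@derive_bigsum R _ r' _ (fun k x => 2 * normsq (b k) * 1 +
      - (2 * normsq (b k) / s k) * (s k * cos (s k * x)))) => k y.
    exact: (derive_lin _ _ (fun x => is_derive_id x 1) (derive_scaled (s k) (@is_derive_sin R))).
  have s0 k : k \in r' -> s k != 0.
    by rewrite mem_filter => /andP[pk _]; rewrite subr_eq0.
  have := derive_ge0_le (derive_lin (4 * EN) (- c) (fun x => is_derive_id x 1) dsum)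
    (a := 0) (b := d) _ (ltW d0).
  rewrite mulr0 add0r [X in _ * X <= _]big1 ?mulr0; last by move=> k _; rewrite !mulr0 sin0 mulr0 addr0.
  have side t : t \in `[0, d] -> 0 <= 4 * EN * 1 + - c * (\sum_(k <- r')
      (2 * normsq (b k) * 1 + - (2 * normsq (b k) / s k) * (s k * cos (s k * t)))).
    rewrite in_itv /= => /h1; rewrite mulr1 mulNr subr_ge0; apply: le_trans.
    rewrite le_eqVlt; apply/orP; left; apply/eqP; congr (_ * _).
    rewrite big_seq [RHS]big_seq; apply: eq_bigr => k /s0 sk0; field.
    exact: sk0.
  move=> /(_ side); rewrite mulNr subr_ge0 => h2.
  have h3 : 2 * d * kap * A <= \sum_(k <- r')
      (2 * normsq (b k) * d + - (2 * normsq (b k) / s k) * sin (s k * d)).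
    rewrite /A mulr_sumr big_seq [leRHS]big_seq; apply: ler_sum => k kr'.
    have sk0 := s0 k kr'; have := kr'; rewrite mem_filter => /andP[pk kr].
    have /andP[kn0 _] := hr _ kr.
    have g : d / `|k0%:~R| <= `|s k * d|.
      rewrite normrM (gtr0_norm d0) mulrC ler_pM2r// /s distrC.
      by apply: kpfreq_gap => //; rewrite eq_sym.
    have := hkap _ g => hs.
    have E1 : sin (s k * d) / (s k * d) * (2 * normsq (b k) * d) = 2 * normsq (b k) / s k * sin (s k * d).
      by field; rewrite sk0 gt_eqF.
    rewrite mulNr -E1.
    have := ler_wpM2r (mulr_ge0 (mulr_ge0 (ler0n R 2) (normsq_ge0 (b k))) (ltW d0)) hs; lra.
  have h4 := le_trans (ler_wpM2l (ltW c0) h3) h2.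
  rewrite -(ler_pM2l (mulr_gt0 (mulr_gt0 c0 kap0) d0)) /K1.
  rewrite (_ : c * kap * d * (2 / (c * kap) * EN) = 2 * EN * d); last first.
    by field; rewrite !gt_eqF.
  by lra.
have hE : \sum_(k <- E) normsq (b k) <= K2 * EN.
  (* At each time the resonant part is the signal minus its part on [r'], so its energy is
     controlled by [EN] and by the sum [A], already bounded in [hA]. *)
  have h1 : energy l E b Tp <= 2 * EN + 2 * energy l r' b Tp.
    have := derive_ge0_le (derive_lin 1 (-1)
      (derive_lin 2 2 (derive_gram_energy M w r b) (derive_gram_energy M w r' b))
      (derive_gram_energy M w E b)) (a := 0) (b := Tp) _ (ltW Tp0).
    have side x : 0 <= 1 * (2 * gram_form M r (flow w b x) + 2 * gram_form M r' (flow w b x)) +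
        -1 * gram_form M E (flow w b x).
      have := gram_formB_le M_ge0 r (flow w b x) (fun k => if p k then flow w b x k else 0).
      rewrite gram_form_filter -/r'.
      rewrite (_ : (fun k => _ - _) = (fun k => if ~~ p k then flow w b x k else 0)).
        by rewrite gram_form_filter -/E; lra.
      by apply/funext => k; case: (p k); rewrite /= ?subrr ?subr0.
    by move=> /(_ (fun x _ => side x)); rewrite !gram_energy0 -/w -/EN; lra.
  have h2 : energy l r' b Tp <= C * A * Tp.
    have := derive_ge0_le (derive_lin (C * A) (-1) (fun x => is_derive_id x 1)
      (derive_gram_energy M w r' b)) (a := 0) (b := Tp) _ (ltW Tp0).
    have side x : 0 <= C * A * 1 + -1 * gram_form M r' (flow w b x).
      have := M_upper (flow w b x) ur'; rewrite (eq_bigr (fun k => normsq (b k))) -/A.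
        by lra.
      by move=> k _; rewrite /flow normsqM normsq_cis mulr1.
    by move=> /(_ (fun x _ => side x)); rewrite !gram_energy0 -/w; lra.
  have h3 : energy l E b Tp = Tp * gram_form M E b.
    apply: (@energy_resonant l E b mu) => k.
    by rewrite mem_filter negbK => /andP[/eqP].
  have h4 : cp * \sum_(k <- E) normsq (b k) <= gram_form M E b.
    apply: (@resonant_coercive l _ _ mu); first by rewrite filter_uniq.
    move=> k; rewrite mem_filter negbK => /andP[-> kr].
    by have /andP[-> _] := hr _ kr.
  have h5 : Tp * (cp * \sum_(k <- E) normsq (b k)) <= energy l E b Tp by rewrite h3 ler_pM2l.
  have h6 : C * A * Tp <= C * K1 * Tp * EN.
    rewrite -[leRHS]mulrA [Tp * EN]mulrC mulrA ler_wpM2r ?(ltW Tp0)//.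
    by rewrite -mulrA ler_wpM2l.
  rewrite /K2 mulrAC ler_pdivlMr ?mulr_gt0// mulrC.
  by move: h1 h2 h5 h6; rewrite mulrA; lra.
rewrite ler_pdivrMl ?addr_gt0// mulrDl.
have -> : \sum_(k <- r) normsq (b k) = A + \sum_(k <- E) normsq (b k).
  by rewrite /A !big_filter (bigID p).
exact: lerD.
Qed.

Theorem observability T : 0 < T -> observable predT T.
Proof.
move=> T0; have T2 : 0 < T / 2 by rewrite divr_gt0.
have [N hN] := observable_high T2.
(* The integers of absolute value less than [N]. The threshold [N] does not depend on [l], so
   finitely many additions serve all [l] together. *)
pose L : seq int := [seq Posz n | n <- iota 0 N] ++ [seq - Posz n | n <- iota 0 N].
(* The second half of the time is shared equally among the additions; the successor covers an empty
   list. *)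
pose d := T / 2 / (size L).+1%:R; have d0 : 0 < d by rewrite divr_gt0.
have step (K : seq int) : observable (fun k => (k \in K) || (N <= `|k|)%N) (T / 2 + d *+ size K).
  elim: K => [|k0 K IH]; first by rewrite addr0; apply: observable_sub hN.
  rewrite [d *+ _]mulrSr addrA; have [k00|k00] := eqVneq k0 0.
    apply: observable_mono (_ : observable _ (T / 2 + d *+ size K)); first by rewrite lerDl ltW.
    by apply: observable_sub IH => k kn0; rewrite inE k00 (negbTE kn0).
  have Tn : 0 < T / 2 + d *+ size K by rewrite ltr_wpDr// mulrn_wge0// ltW.
  apply: observable_sub (observable_add Tn d0 k00 IH) => k _.
  by rewrite inE orbA.
apply: observable_mono (_ : observable _ (T / 2 + d *+ size L)).
  have : d *+ size L <= T / 2.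
    rewrite -[d *+ _]mulr_natr /d -mulrA ler_piMr ?(ltW T2)// mulrC.
    by rewrite ler_pdivrMr ?ltr0n// mul1r ler_nat leqnSn.
  by lra.
apply: observable_sub (step L) => k _ _; have [kN|//] := ltnP `|k| N; last by rewrite orbT.
apply/orP; left; have ji : `|k|%N \in iota 0 N by rewrite mem_iota.
have [j0|j0] := leP 0 k; rewrite mem_cat; apply/orP.
  by left; rewrite -[k]gez0_abs//; apply: (map_f Posz).
right; rewrite -[k]opprK -[- k]gez0_abs ?oppr_ge0 ?ltW// abszN.
exact: (map_f (fun n => - Posz n)).
Qed.

End Observability.

End Observation.

(** * Fourier series on the two-dimensional torus *)

Section Torus.
Variable R : realType.
Local Notation leb1 := (@lebesgue_measure R).
Local Notation leb2 := (leb1 \x leb1)%E.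
Local Notation D1 := (@torus R).
Local Notation D := (@torus2 R).
Local Notation T2 := (measurableTypeR R * measurableTypeR R)%type.

Lemma torus_measurable : measurable D1. Proof. exact: measurable_itv. Qed.
Lemma torus2_measurable : measurable D.
Proof. by apply: measurableX; exact: torus_measurable. Qed.
Let mD1 := torus_measurable.
Let mD := torus2_measurable.

Lemma twopi_gt0 : 0 < 2 * pi :> R. Proof. by rewrite mulr_gt0// pi_gt0. Qed.
Let p0 := twopi_gt0.

Lemma torus_measure : leb1 D1 = (2 * pi)%:E.
Proof. by rewrite lebesgue_measure_itv /= lte_fin p0 sube0. Qed.

Lemma torus2_measure : leb2 D = ((2 * pi) * (2 * pi))%:E.
Proof.
by rewrite (product_measure1E _ _ mD1 mD1) [X in (X * X)%E]torus_measure -EFinM.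
Qed.

Lemma torus_finite : (leb1 D1 < +oo)%E.
Proof. by rewrite torus_measure ltry. Qed.

Lemma torus2_finite : (leb2 D < +oo)%E.
Proof. by rewrite torus2_measure ltry. Qed.

Lemma Rintegral_FTC (f F : R -> R) (a b : R) : a < b ->
  (forall x : R, is_derive x 1 F (f x)) -> continuous f ->
  \int[leb1]_(x in `[a, b]) f x = F b - F a.
Proof.
move=> ab dF cf; rewrite /Rintegral (@continuous_FTC2 _ f F)//.
- exact: continuous_subspaceT.
- have cF := derive_continuous dF; split.
  + by move=> x _; have [] := dF x.
  + by apply: cvg_at_right_filter; exact: cF.
  + by apply: cvg_at_left_filter; exact: cF.
- by move=> x _; rewrite derive1E; have [_ ->] := dF x.
Qed.

Lemma torus_FTC (f F : R -> R) :
  (forall x : R, is_derive x 1 F (f x)) -> continuous f ->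
  \int[leb1]_(x in D1) f x = F (2 * pi) - F 0.
Proof.
move=> dF cf; rewrite /torus Rintegral_itv_bndo_bndc; first exact: Rintegral_FTC.
have := continuous_integrable_cc 0 (2 * pi) cf.
by apply: integrableS => //; exact: subset_itv_co_cc.
Qed.

Lemma prod_patch (a b : R -> R) (z : T2) :
  ((fun z => a z.1 * b z.2) \_ D) z = (a \_ D1) z.1 * (b \_ D1) z.2.
Proof.
case: z => x y; rewrite !patchE /=.
have [/set_mem [/= hx hy]|h] := boolP ((x, y) \in D).
  by rewrite !mem_set.
have [/set_mem hx|_] := boolP (x \in D1); last by rewrite mul0r.
have [/set_mem hy|_] := boolP (y \in D1); last by rewrite mulr0.
by move/negP: h => []; apply/mem_set.
Qed.

Lemma Rintegral_torus2_prod (a b : R -> R) :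
  leb1.-integrable D1 (EFin \o a) -> leb1.-integrable D1 (EFin \o b) ->
  leb2.-integrable D (EFin \o (fun z => a z.1 * b z.2)) ->
  \int[leb2]_(z in D) (a z.1 * b z.2) = \int[leb1]_(x in D1) a x * \int[leb1]_(x in D1) b x.
Proof.
move=> ia ib; rewrite (integrable_mkcond _ mD) => iab.
rewrite [LHS]Rintegral_mkcond [X in _ = X * _]Rintegral_mkcond.
rewrite [X in _ = _ * X]Rintegral_mkcond /Rintegral.
rewrite -integral12_prod_meas1; last first.
  by move: iab; congr integrable; apply/funext => z; rewrite restrict_EFin.
rewrite (_ : fubini_F _ _ =
    (fun x => (\int[leb1]_y ((b \_ D1) y)%:E) * ((a \_ D1) x)%:E)%E); last first.
  apply/funext => x; rewrite /fubini_F.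
  under eq_integral do rewrite prod_patch /= EFinM.
  rewrite integralZl//; first by rewrite muleC.
  by move: ib; rewrite (integrable_mkcond _ mD1) restrict_EFin.
rewrite (integrable_mkcond _ mD1) restrict_EFin in ia.
rewrite (integrable_mkcond _ mD1) restrict_EFin in ib.
have fb := integrable_fin_num measurableT ib.
rewrite -[X in fine (\int[_]_x (X * _))]fineK// integralZl//.
by rewrite -(fineK (integrable_fin_num measurableT ia)) -EFinM /= mulrC.
Qed.

End Torus.

Section BoundedFunctions.
Context d (T : measurableType d) (R : realType) (mu : {measure set T -> \bar R}).
Variables (D : set T) (mD : measurable D).
Hypothesis Dfin : (mu D < +oo)%E.
Implicit Types f g : T -> R[i].

Definition cbounded f := [/\ measurable_fun D (fun x => Re (f x)),
  measurable_fun D (fun x => Im (f x)) & exists B, forall x, D x -> cabs (f x) <= B].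

Lemma bounded_integrable (f : T -> R) B : measurable_fun D f ->
  (forall x, D x -> `|f x| <= B) -> mu.-integrable D (EFin \o f).
Proof.
move=> mf fB; apply: measurable_bounded_integrable => //.
exists B; split; first exact: num_real.
by move=> M BM x Dx /=; apply: le_trans (fB x Dx) (ltW BM).
Qed.

Lemma cbounded_cintble f : cbounded f -> cintble mu D f.
Proof.
move=> [m1 m2 [B hB]]; split; apply: (@bounded_integrable _ B) => // x Dx.
  exact: le_trans (ler_Re_cabs _) (hB x Dx).
exact: le_trans (ler_Im_cabs _) (hB x Dx).
Qed.

Lemma cboundedM f g : cbounded f -> cbounded g -> cbounded (fun x => f x * g x).
Proof.
move=> [f1 f2 [B hB]] [g1 g2 [C hC]]; split.
- by under eq_fun do rewrite ReM; apply: measurable_funB; exact: measurable_funM.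
- by under eq_fun do rewrite ImM; apply: measurable_funD; exact: measurable_funM.
- by exists (B * C) => x Dx; rewrite cabsM ler_pM ?cabs_ge0 ?hB ?hC.
Qed.

Lemma cboundedD f g : cbounded f -> cbounded g -> cbounded (fun x => f x + g x).
Proof.
move=> [f1 f2 [B hB]] [g1 g2 [C hC]]; split.
- by under eq_fun do rewrite ReD; exact: measurable_funD.
- by under eq_fun do rewrite ImD; exact: measurable_funD.
- by exists (B + C) => x Dx; apply: le_trans (cabsD _ _) _; rewrite lerD ?hB ?hC.
Qed.

Lemma cbounded_cst a : cbounded (fun=> a).
Proof. by split; [exact: measurable_cst|exact: measurable_cst|exists (cabs a)]. Qed.

Lemma cboundedJ f : cbounded f -> cbounded (fun x => (f x)^*%C).
Proof.
move=> [f1 f2 [B hB]]; split.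
- by under eq_fun do rewrite ReJ.
- by under eq_fun do rewrite ImJ; exact: measurableT_comp.
- by exists B => x Dx; rewrite cabsJ hB.
Qed.

Lemma cbounded_csqintM f g : cbounded f -> csqint mu D g -> csqint mu D (fun x => f x * g x).
Proof.
move=> [f1 f2 [B hB]] [g1 g2].
have h (p q : T -> R) : measurable_fun D p -> (forall x, D x -> `|p x| <= B) ->
    sqint mu D q -> sqint mu D (fun x => p x * q x).
  move=> mp pB [mq q2]; split; first exact: measurable_funM.
  apply: (le_integrable mD _ _ (integrableZl mD (B ^+ 2) q2)).
    by apply/measurable_EFinP; apply: measurable_funX; exact: measurable_funM.
  move=> x Dx /=; rewrite lee_fin (ger0_norm (sqr_ge0 _)).
  rewrite (ger0_norm (mulr_ge0 (sqr_ge0 _) (sqr_ge0 _))) exprMn.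
  rewrite ler_wpM2r ?sqr_ge0// -real_normK ?num_real// lerXn2r ?nnegrE ?pB//.
  exact: le_trans (normr_ge0 _) (pB x Dx).
have hRe x : D x -> `|Re (f x)| <= B by move=> Dx; exact: le_trans (ler_Re_cabs _) (hB x Dx).
have hIm x : D x -> `|Im (f x)| <= B by move=> Dx; exact: le_trans (ler_Im_cabs _) (hB x Dx).
split.
  under eq_fun do rewrite ReM.
  by apply: sqintB => //; exact: h.
under eq_fun do rewrite ImM -[_ + _]/(_ + _).
have := sqint_lin mD 1 1 (h _ _ f1 hRe g2) (h _ _ f2 hIm g1).
by congr sqint; apply/funext => x; rewrite !mul1r.
Qed.

Lemma cbounded_csqint f : cbounded f -> csqint mu D f.
Proof.
move=> hf; have h1 : csqint mu D (fun=> 1 : R[i]).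
  split; split; try exact: measurable_cst.
    by apply: (@bounded_integrable (fun=> 1 ^+ 2) 1) => // x _; rewrite expr1n normr1.
  by apply: (@bounded_integrable (fun=> 0 ^+ 2) 0) => // x _; rewrite expr0n normr0.
by have := cbounded_csqintM hf h1; congr csqint; apply/funext => x; rewrite mulr1.
Qed.

Lemma csqint_cintble f : csqint mu D f -> cintble mu D f.
Proof.
move=> hf; have := csqintM mD hf (cbounded_csqint (cbounded_cst 1)).
by congr cintble; apply/funext => x; rewrite rmorph1 mulr1.
Qed.

End BoundedFunctions.

Section FourierBasis.
Variable R : realType.
Local Notation leb1 := (@lebesgue_measure R).
Local Notation leb2 := (leb1 \x leb1)%E.
Local Notation D1 := (@torus R).
Local Notation D := (@torus2 R).
Local Notation T2 := (measurableTypeR R * measurableTypeR R)%type.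
Let mD1 := @torus_measurable R.
Let mD := @torus2_measurable R.
Let fD1 := @torus_finite R.
Let fD := @torus2_finite R.

Lemma measurable_torus_fst (a : R -> R) : measurable_fun D1 a ->
  measurable_fun D (fun z : T2 => a z.1).
Proof.
move=> ma; apply: (measurable_comp mD1 _ ma).
  by move=> _ [[x y] [/= hx _] <-].
exact: measurable_funTS.
Qed.

Lemma measurable_torus_snd (a : R -> R) : measurable_fun D1 a ->
  measurable_fun D (fun z : T2 => a z.2).
Proof.
move=> ma; apply: (measurable_comp mD1 _ ma).
  by move=> _ [[x y] [/= _ hy] <-].
exact: measurable_funTS.
Qed.

Lemma cbounded_fst (f : R -> R[i]) : cbounded D1 f -> cbounded D (fun z : T2 => f z.1).
Proof.
move=> [f1 f2 [B hB]]; split; [exact: measurable_torus_fst f1|exact: measurable_torus_fst f2|].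
by exists B => z [Dz _]; exact: hB.
Qed.

Lemma cbounded_snd (f : R -> R[i]) : cbounded D1 f -> cbounded D (fun z : T2 => f z.2).
Proof.
move=> [f1 f2 [B hB]]; split; [exact: measurable_torus_snd f1|exact: measurable_torus_snd f2|].
by exists B => z [_ Dz]; exact: hB.
Qed.

Lemma cintegral_torus2_prod (f g : R -> R[i]) : cbounded D1 f -> cbounded D1 g ->
  cintegral leb2 D (fun z => f z.1 * g z.2) = cintegral leb1 D1 f * cintegral leb1 D1 g.
Proof.
move=> hf hg; have [f1 f2] := cbounded_cintble mD1 fD1 hf.
have [g1 g2] := cbounded_cintble mD1 fD1 hg.
have [mf1 mf2 [B hB]] := hf; have [mg1 mg2 [C hC]] := hg.
have h (a b : R -> R) : measurable_fun D1 a -> measurable_fun D1 b ->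
    (forall x, D1 x -> `|a x| <= B) -> (forall x, D1 x -> `|b x| <= C) ->
    leb2.-integrable D (EFin \o (fun z : T2 => a z.1 * b z.2)).
  move=> ma mb aB bC; apply: (@bounded_integrable _ _ _ _ _ mD fD _ (B * C)).
    by apply: measurable_funM; [exact: measurable_torus_fst|exact: measurable_torus_snd].
  by move=> z [/= z1 z2]; rewrite normrM ler_pM ?aB ?bC.
have fR x : D1 x -> `|Re (f x)| <= B by move=> Dx; exact: le_trans (ler_Re_cabs _) (hB x Dx).
have fI x : D1 x -> `|Im (f x)| <= B by move=> Dx; exact: le_trans (ler_Im_cabs _) (hB x Dx).
have gR x : D1 x -> `|Re (g x)| <= C by move=> Dx; exact: le_trans (ler_Re_cabs _) (hC x Dx).
have gI x : D1 x -> `|Im (g x)| <= C by move=> Dx; exact: le_trans (ler_Im_cabs _) (hC x Dx).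
apply: complexP; rewrite !cE /=.
  under eq_Rintegral do rewrite ReM.
  rewrite (RintegralB mD (h _ _ mf1 mg1 fR gR) (h _ _ mf2 mg2 fI gI)).
  congr (_ - _); apply: Rintegral_torus2_prod => //.
    exact: (h _ _ mf1 mg1 fR gR).
  exact: (h _ _ mf2 mg2 fI gI).
under eq_Rintegral do rewrite ImM.
rewrite (RintegralD mD (h _ _ mf1 mg2 fR gI) (h _ _ mf2 mg1 fI gR)).
congr (_ + _); apply: Rintegral_torus2_prod => //.
  exact: (h _ _ mf1 mg2 fR gI).
exact: (h _ _ mf2 mg1 fI gR).
Qed.

Lemma continuous_cosM (w : R) : continuous (fun x : R => cos (w * x)).
Proof. exact: derive_continuous (derive_scaled w (@is_derive_cos R)). Qed.
Lemma continuous_sinM (w : R) : continuous (fun x : R => sin (w * x)).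
Proof. exact: derive_continuous (derive_scaled w (@is_derive_sin R)). Qed.

Lemma cbounded_cis (w : R) : cbounded D1 (fun x => cis (w * x)).
Proof.
split.
- by apply: measurable_funTS; apply: continuous_measurable_fun; exact: continuous_cosM.
- by apply: measurable_funTS; apply: continuous_measurable_fun; exact: continuous_sinM.
- by exists 1 => x _; rewrite cabs_cis.
Qed.

Lemma cis_2pi (k : int) : cis (k%:~R * (2 * pi)) = 1 :> R[i].
Proof.
have h1 : cis (2 * pi) = 1 :> R[i].
  by apply: complexP; rewrite /= mulr_natl ?cos2pi ?sin2pi.
have hn (n : nat) : cis (n%:R * (2 * pi)) = 1 :> R[i].
  elim: n => [|n IH]; first by rewrite mul0r cis0.
  by rewrite -natr1 mulrDl cisD IH !mul1r h1.
have [k0|k0] := leP 0 k; first by rewrite -(gez0_abs k0) -pmulrn.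
rewrite -[k]opprK -(gez0_abs (_ : 0 <= - k)); last by rewrite oppr_ge0 ltW.
by rewrite rmorphN /= mulNr cisN -pmulrn hn conjc1.
Qed.

Lemma cintegral_cis (k : int) : cintegral leb1 D1 (fun x => cis (k%:~R * x)) =
  if k == 0 then (2 * pi)%:C%C else 0.
Proof.
have E : cintegral leb1 D1 (fun x => cis (k%:~R * x)) = cisint k%:~R (2 * pi).
  have dc (x : R) : is_derive x 1 (fun t => Re (1 * cisint k%:~R t)) (cos (k%:~R * x)).
    by have := derive_cisint 1 k%:~R x; rewrite mul1r.
  have ds (x : R) : is_derive x 1 (fun t => Re (- 'i%C * cisint k%:~R t)) (sin (k%:~R * x)).
    have := derive_cisint (- 'i%C) k%:~R x.
    by rewrite (_ : Re _ = sin (k%:~R * x))// !cE /=; ring.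
  apply: complexP => /=.
    rewrite (torus_FTC dc (@continuous_cosM _)).
    by rewrite cisint0 !mul1r /= subr0.
  rewrite (torus_FTC ds (@continuous_sinM _)).
  by rewrite cisint0 mulr0 !cE /=; ring.
rewrite E /cisint intr_eq0; case: eqP => // k0.
have /(congr1 (fun z : R[i] => (Re z, Im z))) := cis_2pi k.
by rewrite /cis /= => -[-> ->]; rewrite subrr !mulr0.
Qed.

Definition fmode (i : int * int) (z : T2) : R[i] := cis (i.1%:~R * z.1 + i.2%:~R * z.2).

Lemma cbounded_fmode i : cbounded D (fmode i).
Proof.
rewrite /fmode (_ : (fun z : T2 => _) =
  (fun z : T2 => cis (i.1%:~R * z.1) * cis (i.2%:~R * z.2))); last first.
  by apply/funext => z; rewrite cisD.
apply: cboundedM => //.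
  exact: (cbounded_fst (cbounded_cis _)).
exact: (cbounded_snd (cbounded_cis _)).
Qed.

Lemma fmodeMJ i j z : fmode i z * (fmode j z)^*%C = fmode (i.1 - j.1, i.2 - j.2) z.
Proof. by rewrite /fmode -cisN -cisD /= !intrB; congr cis; ring. Qed.

Lemma cintegral_fmode i : cintegral leb2 D (fmode i) =
  if i == (0, 0) then ((2 * pi) ^+ 2)%:C%C else 0.
Proof.
rewrite /fmode (_ : (fun z : T2 => _) =
  (fun z : T2 => cis (i.1%:~R * z.1) * cis (i.2%:~R * z.2))); last first.
  by apply/funext => z; rewrite cisD.
rewrite (cintegral_torus2_prod (cbounded_cis _) (cbounded_cis _)) !cintegral_cis.
case: i => k l /=; rewrite xpair_eqE; case: eqP => _; case: eqP => _; rewrite ?mul0r ?mulr0//.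
by rewrite -rmorphM expr2.
Qed.

End FourierBasis.

(** * Polynomials approximating the indicator of [t < 1/2] on [[0, 1]] *)

Section BernoulliPower.
Variable R : realType.

Lemma bernoulli_ge (a : R) m : 0 <= a <= 1 -> 1 - m%:R * a <= (1 - a) ^+ m.
Proof.
move=> /andP[a0 a1]; elim: m => [|m IH]; first by rewrite mul0r subr0 expr0.
rewrite exprS -natr1; have m0 : 0 <= m%:R :> R by [].
have h : (1 - a) * (1 - m%:R * a) <= (1 - a) * (1 - a) ^+ m by rewrite ler_wpM2l// subr_ge0.
apply: le_trans h; rewrite -subr_ge0 (_ : _ - _ = m%:R * a ^+ 2); last by ring.
by rewrite mulr_ge0 ?sqr_ge0.
Qed.

Lemma bernoulli_plus (a : R) m : 0 <= a -> 1 + m%:R * a <= (1 + a) ^+ m.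
Proof.
move=> a0; elim: m => [|m IH]; first by rewrite mul0r addr0 expr0.
rewrite exprS -natr1; have m0 : 0 <= m%:R :> R by [].
have h : (1 + a) * (1 + m%:R * a) <= (1 + a) * (1 + a) ^+ m by rewrite ler_wpM2l// addr_ge0.
apply: le_trans h; rewrite -subr_ge0 (_ : _ - _ = m%:R * a ^+ 2); last by ring.
by rewrite mulr_ge0 ?sqr_ge0.
Qed.

(** With [p] the square root of [q], Bernoulli's inequality for [1 / p = 1 + h] gives
    [n p ^ n <= 1 / h]; the other factor [p ^ n] tends to 0. *)
Lemma cvg_natM_geometric (q : R) : 0 <= q < 1 -> n%:R * q ^+ n @[n --> \oo] --> (0 : R).
Proof.
move=> /andP[q0 q1]; have [->|qn0] := eqVneq q 0.
  apply: cvg_near_cst; exists 1%N => // n /= n1.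
  by rewrite expr0n gtn_eqF// mulr0.
have qp : 0 < q by rewrite lt_neqAle eq_sym qn0.
pose p := Num.sqrt q; have p0 : 0 < p by rewrite sqrtr_gt0.
have p1 : p < 1 by rewrite -[ltRHS]sqrtr1 ltr_sqrt.
pose h := p^-1 - 1; have h0 : 0 < h by rewrite subr_gt0 invf_gt1.
apply: (@squeeze_cvgr _ _ _ _ (fun=> 0) (geometric h^-1 p)).
- apply: nearW => n; rewrite mulr_ge0 ?exprn_ge0//=.
  rewrite -(sqr_sqrtr q0) -/p -exprM mulnC exprM expr2 mulrA ler_wpM2r ?exprn_ge0 ?(ltW p0)//.
  have := bernoulli_plus n (ltW h0); rewrite (_ : 1 + h = p^-1); last by rewrite /h; ring.
  rewrite exprVn => hb; have pn : 0 < p ^+ n by rewrite exprn_gt0.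
  rewrite -(ler_pM2l h0) mulfV ?gt_eqF//.
  have := ler_wpM2r (ltW pn) hb; rewrite mulVf ?gt_eqF//; lra.
- exact: cvg_cst.
- by apply: cvg_geometric; rewrite ger0_norm// ltW.
Qed.

(* The exponent n * 2 ^ n, rather than the 2 ^ n of the classical proof of the
   Stone-Weierstrass theorem, gives the limit 0 at t = 1/2 too. *)
Definition soft_step (n : nat) (t : R) : R := (1 - t ^+ n) ^+ (n * 2 ^ n).

Lemma soft_step_itv n t : 0 <= t <= 1 -> 0 <= soft_step n t <= 1.
Proof.
move=> /andP[t0 t1]; have h : 0 <= 1 - t ^+ n <= 1.
  by rewrite subr_ge0 exprn_ile1//= lerBlDr lerDl exprn_ge0.
by case/andP: h => h0 h1; rewrite exprn_ge0//= exprn_ile1.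
Qed.

(** With [m = n 2 ^ n] one has [m t ^ n = n (2 t) ^ n]. Below 1/2 this tends to 0, and Bernoulli
    bounds the power below by [1 - m t ^ n]. From 1/2 on it is at least [n], and
    [(1 - a) ^ m (1 + a) ^ m <= 1] bounds the power above by [1 / (n + 1)]. *)
Lemma soft_step_cvg t : 0 <= t <= 1 -> soft_step n t @[n --> \oo] --> ((t < 1 / 2)%R%:R : R).
Proof.
move=> /andP[t0 t1]; have tn n : 0 <= t ^+ n <= 1 by rewrite exprn_ge0//= exprn_ile1.
have [th|th] := ltP t (1 / 2) => /=.
  have c : 1 - n%:R * (2 * t) ^+ n @[n --> \oo] --> (1 - 0 : R).
    by apply: cvgB; [exact: cvg_cst|apply: cvg_natM_geometric; lra].
  rewrite subr0 in c; apply: squeeze_cvgr c (@cvg_cst _ _ _ _ _); apply: nearW => n.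
  have /andP[_ ->] := soft_step_itv n (introT andP (conj t0 t1)); rewrite andbT.
  have := bernoulli_ge (n * 2 ^ n) (tn n); apply: le_trans.
  by rewrite natrM natrX exprMn mulrA.
have c : (n.+1%:R^-1 : R) @[n --> \oo] --> (0 : R) by exact: cvg_harmonic.
apply: squeeze_cvgr (@cvg_cst _ _ _ _ _) c; apply: nearW => n.
have /andP[-> _] := soft_step_itv n (introT andP (conj t0 t1)) => /=.
have /andP[a0 a1] := tn n; set m := (n * 2 ^ n)%N.
have h1 : (1 - t ^+ n) ^+ m * (1 + t ^+ n) ^+ m <= 1.
  rewrite -exprMn exprn_ile1//; first by rewrite mulr_ge0; lra.
  by rewrite -subr_ge0 (_ : _ - _ = (t ^+ n) ^+ 2) ?sqr_ge0//; ring.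
have h2 : n.+1%:R <= (1 + t ^+ n) ^+ m.
  apply: le_trans (bernoulli_plus m a0); rewrite -natr1 addrC lerD2l /m natrM natrX -mulrA -exprMn.
  by rewrite ler_peMr// exprn_ege1//; lra.
have b0 : 0 <= (1 - t ^+ n) ^+ m by rewrite exprn_ge0// subr_ge0.
rewrite -[leRHS]mul1r ler_pdivlMr ?ltr0n//; apply: le_trans h1.
by rewrite ler_wpM2l.
Qed.

End BernoulliPower.

(** * Completeness of the exponentials in L^2 of the torus *)

Section Totality.
Variable R : realType.
Local Notation leb1 := (@lebesgue_measure R).
Local Notation leb2 := (leb1 \x leb1)%E.
Local Notation D1 := (@torus R).
Local Notation D := (@torus2 R).
Local Notation T2 := (measurableTypeR R * measurableTypeR R)%type.
Let mD1 := @torus_measurable R.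
Let mD := @torus2_measurable R.
Let fD := @torus2_finite R.
Variable v : T2 -> R[i].
Hypothesis hv : csqint leb2 D v.
Hypothesis v0 : forall i, cintegral leb2 D (fun z => v z * (fmode i z)^*%C) = 0.
Implicit Types f : T2 -> R[i].

Let X i z := v z * fmode i z.

Let iX f i : cbounded D f -> cintble leb2 D (fun z => f z * X i z).
Proof.
move=> hf; apply: (csqint_cintble mD fD); apply: (cbounded_csqintM mD hf).
have := cbounded_csqintM mD (@cbounded_fmode R i) hv.
by congr csqint; apply/funext => z; rewrite mulrC.
Qed.

(** The bounded multipliers [f] such that all Fourier coefficients of [f * v] vanish. Starting from
    1, the class is enlarged by trigonometric polynomials, bounded limits and the Dynkin lemma until
    it contains every measurable indicator. *)
Definition annih f := cbounded D f /\ forall i, cintegral leb2 D (fun z => f z * X i z) = 0.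

Lemma annih1 : annih (fun=> 1).
Proof.
split=> [|i]; first exact: cbounded_cst.
rewrite -(v0 (- i.1, - i.2)); apply: eq_cintegral => z _; rewrite mul1r /X; congr (_ * _).
by rewrite /fmode -cisN /=; congr cis; rewrite !rmorphN /=; ring.
Qed.

Lemma annih_lin a f g : annih f -> annih g -> annih (fun z => a * f z + g z).
Proof.
move=> [bf hf] [bg hg]; split=> [|i].
  by apply: cboundedD => //; apply: cboundedM => //; exact: cbounded_cst.
rewrite (@eq_cintegral _ _ _ leb2 D _ (fun z => a * (f z * X i z) + g z * X i z)).
  by rewrite cintegral_lin ?hf ?hg ?mulr0 ?addr0//; exact: iX.
by move=> z _; ring.
Qed.

Lemma annihZ a f : annih f -> annih (fun z => a * f z).
Proof.
move=> hf; have := annih_lin (a - 1) hf hf.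
by congr annih; apply/funext => z; ring.
Qed.

Lemma annih_ext f g : f =1 g -> annih f -> annih g.
Proof. by move=> /funext ->. Qed.

Lemma annih_fmode j f : annih f -> annih (fun z => f z * fmode j z).
Proof.
move=> [bf hf]; split=> [|i].
  by apply: cboundedM => //; exact: cbounded_fmode.
rewrite -(hf (i.1 + j.1, i.2 + j.2)); apply: eq_cintegral => z _.
rewrite -mulrA /X; congr (_ * _); rewrite mulrCA; congr (_ * _).
by rewrite /fmode -cisD /=; congr cis; rewrite !intrD; ring.
Qed.

Lemma annih_cos (j : int * int) c f : annih f ->
  annih (fun z => (cos (j.1%:~R * z.1 + j.2%:~R * z.2 - c))%:C%C * f z).
Proof.
move=> hf.
have := annih_lin (cis (- c) / 2) (annih_fmode j hf)
  (annihZ (cis c / 2) (annih_fmode (- j.1, - j.2) hf)).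
apply: annih_ext => z.
have -> : fmode (- j.1, - j.2) z = cis (- (j.1%:~R * z.1 + j.2%:~R * z.2)).
  by rewrite /fmode /=; congr cis; rewrite !rmorphN /=; ring.
rewrite /fmode; set y := _ + j.2%:~R * z.2.
have -> : (cos (y - c))%:C%C = (cis (- c) * cis y + cis c * cis (- y)) / 2 :> R[i].
  rewrite -!cisD; have -> : c - y = - (y - c) by ring.
  rewrite [- c + y]addrC; apply: (mulIf (_ : (2 : R[i]) != 0)); first by rewrite pnatr_eq0.
  rewrite divfK ?pnatr_eq0//; apply: complexP; rewrite !cE /= ?cosN ?sinN; ring.
by ring.
Qed.

(** The argument is a trigonometric polynomial that is below 1/2 exactly where the cosine exceeds
    [r]; the division by 4 keeps it in [[0, 1]] when [|r| <= 1]. *)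
Lemma annih_soft_step (j : int * int) c r n f : annih f ->
  annih (fun z => (soft_step n (1 / 2 - (cos (j.1%:~R * z.1 + j.2%:~R * z.2 - c) - r) / 4))%:C%C * f z).
Proof.
move=> hf; pose t (z : T2) := 1 / 2 - (cos (j.1%:~R * z.1 + j.2%:~R * z.2 - c) - r) / 4.
have step g : annih g -> annih (fun z => (t z)%:C%C * g z).
  move=> hg; have := annih_lin (- (1 / 4))%:C%C (annih_cos j c hg) (annihZ (1 / 2 + r / 4)%:C%C hg).
  apply: annih_ext => z; rewrite mulrA -mulrDl -rmorphM -rmorphD; congr (_%:C%C * _).
  by rewrite /t; ring.
have pow m g : annih g -> annih (fun z => (t z ^+ m)%:C%C * g z).
  move=> hg; elim: m => [|m IH]; first by apply: annih_ext hg => z; rewrite expr0 mul1r.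
  by apply: annih_ext (step _ IH) => z; rewrite exprS rmorphM mulrA.
have pow1 g : annih g -> annih (fun z => (1 - t z ^+ n)%:C%C * g z).
  move=> hg; apply: annih_ext (annih_lin (-1) (pow n _ hg) hg) => z.
  by rewrite rmorphB rmorph1; ring.
rewrite -[fun z => _]/(fun z => (soft_step n (t z))%:C%C * f z) /soft_step.
elim: (n * 2 ^ n)%N => [|m IH]; first by apply: annih_ext hf => z; rewrite expr0 mul1r.
by apply: annih_ext (pow1 _ IH) => z; rewrite exprS rmorphM mulrA.
Qed.

(** Dominated convergence: as the multipliers [q_ n] stay in [[0, 1]], the integrable product itself
    dominates. *)
Lemma annih_lim (q_ : nat -> T2 -> R) (q : T2 -> R) f : annih f ->
  measurable_fun D q -> (forall n z, D z -> 0 <= q_ n z <= 1) ->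
  (forall z, D z -> q_ n z @[n --> \oo] --> q z) ->
  (forall n, annih (fun z => (q_ n z)%:C%C * f z)) -> annih (fun z => (q z)%:C%C * f z).
Proof.
move=> [bf hf] mq q01 qlim hq.
have q1 z : D z -> 0 <= q z <= 1.
  move=> Dz; have c := qlim z Dz; rewrite -(cvg_lim (@Rhausdorff R) c).
  by apply/andP; split; [apply: limr_ge|apply: limr_le];
    [exact: cvgP c|apply: nearW => n; have /andP[] := q01 n z Dz|
     exact: cvgP c|apply: nearW => n; have /andP[] := q01 n z Dz].
have bq : cbounded D (fun z => (q z)%:C%C).
  split => //=; exists 1 => z Dz; rewrite cabs_real; have /andP[a b] := q1 z Dz.
  by rewrite ger0_norm.
split; first exact: cboundedM.
move=> i; have [iR iI] := iX i bf.
have lim0 (h : T2 -> R) : leb2.-integrable D (EFin \o h) ->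
    (forall n, measurable_fun D (fun z => q_ n z * h z)) ->
    (forall n, \int[leb2]_(z in D) (q_ n z * h z) = 0) -> \int[leb2]_(z in D) (q z * h z) = 0.
  move=> ih mqh h0; have mh : measurable_fun D h.
    by have /integrableP[/measurable_EFinP] := ih.
  have [] := @dominated_convergence _ _ _ leb2 D mD (fun n z => (q_ n z * h z)%:E)
    (fun z => (q z * h z)%:E) (fun z => `|h z|%:E).
  - by move=> n; apply/measurable_EFinP.
  - by apply/measurable_EFinP; exact: measurable_funM.
  - apply: nearW => z Dz; apply: cvg_EFin; first exact: nearW.
    by apply: cvgM; [exact: qlim|exact: cvg_cst].
  - exact: integrable_norm.
  - apply: nearW => z n Dz; rewrite /= lee_fin normrM ler_piMl//.
    by have /andP[a b] := q01 n z Dz; rewrite ger0_norm.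
  move=> i1 _; rewrite -(fineK (integrable_fin_num mD i1)) => /fine_cvg.
  rewrite (_ : fine \o _ = fun=> 0); last by apply/funext => n; exact: h0.
  by move=> c; apply: (cvg_unique (@Rhausdorff R) c); exact: cvg_cst.
have mX (p : R[i] -> R) : p = Re \/ p = Im -> forall n,
    measurable_fun D (fun z => q_ n z * p (f z * X i z)).
  move=> hp n; have [bn _] := hq n.
  have [/integrableP[/measurable_EFinP m1 _] /integrableP[/measurable_EFinP m2 _]] := iX i bn.
  case: hp => ->.
    by move: m1; congr measurable_fun; apply/funext => z; rewrite !cE /=; ring.
  by move: m2; congr measurable_fun; apply/funext => z; rewrite !cE /=; ring.
apply: complexP => /=.
  under eq_Rintegral do rewrite -mulrA ReM /= mul0r subr0.
  apply: lim0 => //; first by apply: mX; left.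
  move=> n; have [_ /(_ i)/(congr1 Re) /= h] := hq n; rewrite -[RHS]h.
  by apply: eq_Rintegral => z _; rewrite -mulrA !ReM /= !(mul0r, subr0).
under eq_Rintegral do rewrite -mulrA ImM /= mul0r addr0.
apply: lim0 => //; first by apply: mX; right.
move=> n; have [_ /(_ i)/(congr1 Im) /= h] := hq n; rewrite -[RHS]h.
by apply: eq_Rintegral => z _; rewrite -mulrA !ImM /= !(mul0r, addr0).
Qed.

(** Relative to a multiplier [f], so that indicators in the two coordinates can be multiplied, one
    after the other, into the indicator of a rectangle. *)
Definition annih_set f (S : set T2) := annih (fun z => (\1_S z)%:C%C * f z).

Lemma annih_setT f : annih f -> annih_set f setT.
Proof. by apply: annih_ext => z; rewrite indicT mul1r. Qed.

Lemma annih_setC f S : annih f -> annih_set f S -> annih_set f (~` S).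
Proof.
move=> hf hS; apply: annih_ext (annih_lin (-1) hS hf) => z.
rewrite !indicE in_setC; case: (z \in S) => /=; first by ring.
by rewrite mul0r mul1r mulr0 add0r.
Qed.

Lemma annih_bigcup f (F : (set T2)^nat) : annih f -> (forall n, measurable (F n)) ->
  trivIset setT F -> (forall n, annih_set f (F n)) -> annih_set f (\bigcup_n F n).
Proof.
move=> hf mF tF hF; pose U n := \big[setU/set0]_(k < n) F k.
have mU n : measurable (U n) by exact: bigsetU_measurable.
have inU n z : (z \in U n) = `[< exists2 k, (k < n)%N & F k z >].
  apply/idP/asboolP => [/set_mem|[k kn Fz]].
    by rewrite /U -bigcup_mkord => -[k /= kn Fz]; exists k.
  by apply/mem_set; rewrite /U -bigcup_mkord; exists k.
apply: (@annih_lim (fun n => \1_(U n)) (\1_(\bigcup_n F n)) f) => //.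
- by apply: measurable_indic; exact: bigcupT_measurable.
- by move=> n z _; rewrite indicE; case: (z \in _); rewrite /= ?ler01 ?lexx.
- move=> z _; apply: cvg_near_cst.
  have [[k _ Fz]|nF] := pselect ((\bigcup_n F n) z).
    exists k.+1 => // n /= kn; rewrite !indicE [in RHS]mem_set; last by exists k.
    by rewrite inU; case: asboolP => // -[]; exists k.
  apply: nearW => n; rewrite !indicE [in RHS]memNset// inU.
  by case: asboolP => // -[k _ Fz]; case: nF; exists k.
elim=> [|n IH].
  by apply: annih_ext (annihZ 0 hf) => z; rewrite /U big_ord0 indic0 mul0r.
apply: annih_ext (annih_lin 1 IH (hF n)) => z; rewrite mul1r -mulrDl -rmorphD; congr (_%:C%C * _).
rewrite !indicE !inU -natrD; congr (_%:R).
have [Fz|nFz] := pselect (F n z).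
  rewrite mem_set// (_ : `[< exists2 k, (k < n)%N & F k z >] = false) ?add0n.
    by apply/esym/congr1; apply/asboolP; exists n.
  apply/asboolP => -[k kn Fk]; have : F k `&` F n !=set0 by exists z.
  by move=> /(tF k n I I) kE; rewrite kE ltnn in kn.
rewrite memNset// addn0; congr (nat_of_bool _); apply/asboolP/asboolP => -[k kn Fk].
  by exists k => //; rewrite ltnS ltnW.
by exists k => //; move: kn; rewrite ltnS leq_eqVlt => /orP[/eqP kE|//]; rewrite kE in Fk.
Qed.

Definition axis (b : bool) (z : T2) : R := if b then z.1 else z.2.
Definition axis_freq (b : bool) : int * int := if b then (1, 0) else (0, 1).

Lemma axis_freqE b z : (axis_freq b).1%:~R * z.1 + (axis_freq b).2%:~R * z.2 = axis b z.
Proof. by case: b; rewrite /= ?mul1r ?mul0r ?addr0 ?add0r. Qed.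

Lemma axis_torus b z : D z -> 0 <= axis b z < 2 * pi.
Proof. by case: b => -[/= h1 h2]; move: h1 h2; rewrite /torus /= !in_itv. Qed.

Lemma measurable_axis b : measurable_fun setT (axis b).
Proof. by case: b; [exact: measurable_fst|exact: measurable_snd]. Qed.

Lemma axis_null b : leb2.-negligible [set z | D z /\ axis b z = 0].
Proof.
have m0 : measurable [set 0 : measurableTypeR R] by exact: measurable_set1.
have l0 : leb1 [set 0 : measurableTypeR R] = 0 by rewrite lebesgue_measure_set1.
case: b; [exists ([set 0] `*` D1)|exists (D1 `*` [set 0])]; split;
  try (by apply: measurableX => //; exact: measurable_itv).
- by rewrite product_measure1E// [X in (X * _)%E]l0 mul0e.
- by move=> z /= [[_ h2] h]; split.
- by rewrite product_measure1E// [X in (_ * X)%E]l0 mule0.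
- by move=> z /= [[h2 _] h]; split.
Qed.

Lemma annih_ae b f g : annih f -> cbounded D g ->
  (forall z, D z -> axis b z != 0 -> f z = g z) -> annih g.
Proof.
move=> [bf hf] bg fg; split=> // i; have [f1 f2] := iX i bf; have [g1 g2] := iX i bg.
have ae (p : R[i] -> R) : leb2.-integrable D (fun z => (p (f z * X i z))%:E) ->
    leb2.-integrable D (fun z => (p (g z * X i z))%:E) ->
    \int[leb2]_(z in D) p (g z * X i z) = \int[leb2]_(z in D) p (f z * X i z).
  move=> /integrableP[mf _] /integrableP[mg _]; congr fine; apply: ae_eq_integral => //.
  apply: negligibleS (axis_null b) => z /=; move/not_implyP => [Dz h]; split=> //.
  by apply/eqP; apply: contrapT => /negP z0; apply: h; rewrite fg.
rewrite -(hf i); apply: complexP => /=; exact: ae.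
Qed.

(** For [y] in []0, 2 pi[], the condition [y < x] says that [y] is within [x / 2] of the midpoint of
    []0, x[], that is [cos (y - x / 2) > cos (x / 2)]. The equivalence fails at [y = 0] only, a null
    set. *)
Lemma annih_ray b f (x : R) : annih f -> annih_set f (axis b @^-1` `]-oo, x[).
Proof.
move=> hf; pose S := axis b @^-1` `]-oo, x[%classic.
have mS : measurable S by rewrite -[S]setTI; apply: measurable_axis => //; exact: measurable_itv.
have bS : cbounded D (fun z => (\1_S z)%:C%C * f z).
  apply: cboundedM; last by case: hf.
  split => //=; first by apply: measurable_funTS; exact: measurable_indic.
  by exists 1 => z _; rewrite cabs_real indicE; case: (_ \in _); rewrite /= ?normr1 ?normr0.
have inS z : (z \in S) = (axis b z < x).
  by apply/idP/idP => [/set_mem|h]; [|apply/mem_set]; rewrite /S /= in_itv.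
have [x0|x0] := leP x 0.
  apply: (annih_ae (b := b) (annihZ 0 hf) bS) => z Dz _; rewrite mul0r indicE inS.
  by have /andP[z0 _] := axis_torus b Dz; rewrite ltNge (le_trans x0 z0) mul0r.
have [x2|x2] := ltP x (2 * pi); last first.
  apply: (annih_ae (b := b) hf bS) => z Dz _; rewrite indicE inS.
  by have /andP[_ z1] := axis_torus b Dz; rewrite (lt_le_trans z1 x2) mul1r.
pose r := cos (x / 2); pose t z : R := 1 / 2 - (cos (axis b z - x / 2) - r) / 4.
have t01 z : 0 <= t z <= 1.
  have := cos_max (axis b z - x / 2); have := cos_max (x / 2); rewrite !ler_norml.
  by move=> /andP[a1 a2] /andP[a3 a4]; rewrite /t /r; apply/andP; lra.
have mt : measurable_fun setT t.
  have -> : t = (fun y : R => 1 / 2 - (cos (y - x / 2) - r) / 4) \o axis b by [].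
  apply: measurableT_comp (measurable_axis b); apply: continuous_measurable_fun.
  have dc y : is_derive (y : R) 1 (fun y : R => cos (y + - (x / 2))) (- sin (y + - (x / 2))).
    exact: (derive_translate (- (x / 2)) (@is_derive_cos R)).
  rewrite (_ : (fun y : R => _) =
      (fun y : R => - (1 / 4) * cos (y + - (x / 2)) + (1 / 2 + r / 4) * 1)); last first.
    by apply/funext => y; ring.
  exact: derive_continuous (derive_lin _ _ dc (fun y => is_derive_cst (1 : R) y 1)).
have h1 : annih (fun z => ((t z < 1 / 2)%R%:R : R)%:C%C * f z).
  apply: (@annih_lim (fun n z => soft_step n (t z))) => //.
  - rewrite (_ : (fun _ => _) = \1_(t @^-1` `]-oo, (1 / 2)[%classic)).
      apply: measurable_funTS; apply: measurable_indic.
      by rewrite -[_ @^-1` _]setTI; apply: mt => //; exact: measurable_itv.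
    apply/funext => z; rewrite indicE; congr (_%:R); congr (nat_of_bool _).
    by apply/idP/idP => [h|/set_mem]; [apply/mem_set|]; rewrite /= in_itv.
  - by move=> n z _; exact: soft_step_itv.
  - by move=> z _; exact: soft_step_cvg.
  - move=> n; apply: annih_ext (annih_soft_step (axis_freq b) (x / 2) r n hf) => z.
    by rewrite axis_freqE.
apply: (annih_ae (b := b) h1 bS) => z Dz z0; rewrite indicE inS; congr ((_%:R)%:C%C * _).
congr (nat_of_bool _); have /andP[a0 a1] := axis_torus b Dz.
have ap : 0 < axis b z by rewrite lt_neqAle eq_sym z0.
rewrite /t /r; set y := axis b z in ap a1 *.
have -> : (1 / 2 - (cos (y - x / 2) - cos (x / 2)) / 4 < 1 / 2 :> R) =
    (cos (x / 2) < cos (y - x / 2)) by apply/idP/idP; lra.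
have <- : cos `|y - x / 2| = cos (y - x / 2).
  by case: (leP 0 (y - x / 2)) => h; [rewrite ger0_norm|rewrite ltr0_norm ?cosN].
(* Past [pi] the cosine is reflected: [2 pi - (y - x / 2)] lies between [x / 2] and [pi], so the
   cosine is again below [cos (x / 2)], in agreement with [y >= x]. *)
have [yx|yx] := leP (y - x / 2) pi; last first.
  have pi0 := @pi_gt0 R.
  rewrite ger0_norm; last by lra.
  rewrite (_ : (y < x) = false); last by apply/negbTE; rewrite -leNgt; lra.
  apply/negbTE; rewrite -leNgt; have -> : cos (y - x / 2) = cos (2 * pi - (y - x / 2)).
    rewrite -cosN -(@cosD2pi R (- (y - x / 2))) -mulr_natl; congr cos; ring.
  by apply: ltW; rewrite ltr_cos ?in_itv/=; lra.
rewrite ltr_cos; last 2 first.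
- by rewrite in_itv/= normr_ge0 ler_norml; lra.
- by rewrite in_itv/=; lra.
by rewrite ltr_norml; apply/idP/idP; lra.
Qed.

(** Dynkin's lemma on the rays, which are stable under intersection. *)
Lemma annih_borel b f (A : set (measurableTypeR R)) : annih f -> measurable A ->
  annih_set f (axis b @^-1` A).
Proof.
move=> hf mA.
have mpre (B : set (measurableTypeR R)) : measurable B -> measurable (axis b @^-1` B).
  by move=> mB; rewrite -[_ @^-1` _]setTI; apply: measurable_axis.
have genE : @measurable _ (measurableTypeR R) = <<s @RGenInftyO.G R >>.
  exact: RGenInftyO.measurableE.
apply: (@dynkin_induction _ (measurableTypeR R) (@RGenInftyO.G R)
  (fun B => annih_set f (axis b @^-1` B))) => //.
- move=> _ _ [x ->] [y ->]; exists (Num.min x y).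
  by apply/seteqP; split=> z /=; rewrite !in_itv /= lt_min => /andP.
- by rewrite preimage_setT; exact: annih_setT.
- by move=> _ [x ->]; exact: annih_ray.
- by move=> S _ hS; rewrite preimage_setC; exact: annih_setC.
- move=> F mF tF hF; rewrite preimage_bigcup; apply: annih_bigcup => //.
    by move=> n; exact: mpre.
  move=> i j _ _ [z [Fi Fj]]; apply: tF => //.
  by exists (axis b z).
- by rewrite -genE.
Qed.

Lemma annih_measurable (S : set T2) : measurable S -> annih (fun z => (\1_S z)%:C%C).
Proof.
move=> mS; apply: (annih_ext (f := fun z => (\1_S z)%:C%C * 1)) => [z|]; first by rewrite mulr1.
apply: (@dynkin_induction _ T2 [set A `*` B | A in measurable & B in measurable]
  (fun S => annih_set (fun=> 1) S)) => //.
- exact: measurable_prod_measurableType.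
- move=> _ _ [A mA [B mB <-]] [A' mA' [B' mB' <-]].
  exists (A `&` A'); first exact: measurableI.
  by exists (B `&` B'); [exact: measurableI|rewrite setXI].
- exact: annih_setT annih1.
- move=> _ [A mA [B mB <-]].
  apply: annih_ext (annih_borel false (annih_borel true annih1 mA) mB) => z.
  rewrite mulrA -rmorphM !indicE; congr (_%:C%C * _).
  case: z => x y; rewrite -natrM mulnb; congr (_%:R); congr (nat_of_bool _).
  apply/andP/idP => [[/set_mem hx /set_mem hy]|/set_mem [hx hy]]; first exact/mem_set.
  by split; exact/mem_set.
- by move=> S' _ hS'; exact: annih_setC annih1 hS'.
- by move=> F mF tF hF; exact: annih_bigcup annih1 mF tF hF.
- by rewrite -measurable_prod_measurableType.
Qed.

Lemma fourier_total : {ae leb2, forall z, D z -> v z = 0}.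
Proof.
have [[mR _] [mI _]] := hv; have [iR iI] := csqint_cintble mD fD hv.
have key (p : R[i] -> R) : leb2.-integrable D (fun z => (p (v z))%:E) ->
    (forall S, measurable S -> \int[leb2]_(z in D) (\1_S z * p (v z)) = 0) ->
    {ae leb2, forall z, D z -> (p (v z))%:E = 0%E}.
  move=> ip hp; apply: (integral_ae_eq mD ip) => [|S SD mS]; first exact: measurable_cst.
  rewrite integral0; have iS : leb2.-integrable S (fun z => (p (v z))%:E) by exact: integrableS ip.
  rewrite -[LHS](fineK (integrable_fin_num mS iS)) -[RHS]/((0 : R)%:E) -(hp S mS); congr (_%:E).
  rewrite -[LHS]/(Rintegral leb2 S (fun z => p (v z))) -{1}(setIidr SD) Rintegral_mkcondr.
  apply: eq_Rintegral => z _; rewrite patchE indicE.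
  by case: (z \in S); rewrite ?mul1r ?mul0r.
have hS S : measurable S -> cintegral leb2 D (fun z => (\1_S z)%:C%C * v z) = 0.
  move=> mS; have [_ /(_ (0, 0)) <-] := annih_measurable mS.
  by apply: eq_cintegral => z _; rewrite /X /fmode /= !mul0r addr0 cis0 mulr1.
have aR : {ae leb2, forall z, D z -> (Re (v z))%:E = 0%E}.
  apply: key => // S /hS /(congr1 Re) /= h; rewrite -[RHS]h.
  by apply: eq_Rintegral => z _; rewrite ReM /= mul0r subr0.
have aI : {ae leb2, forall z, D z -> (Im (v z))%:E = 0%E}.
  apply: key => // S /hS /(congr1 Im) /= h; rewrite -[RHS]h.
  by apply: eq_Rintegral => z _; rewrite ImM /= mul0r addr0.
apply: filterS2 aR aI => z h1 h2 Dz; apply: complexP => /=.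
  by have [] := h1 Dz.
by have [] := h2 Dz.
Qed.

End Totality.

Section TorusL2.
Variable R : realType.
Local Notation leb1 := (@lebesgue_measure R).
Local Notation leb2 := (leb1 \x leb1)%E.
Local Notation D := (@torus2 R).
Local Notation T2 := (measurableTypeR R * measurableTypeR R)%type.

Definition torus_l2 := l2fun leb2 (@torus2_measurable R).
Local Notation E := torus_l2.

Definition torus_hilbert : hilbert E :=
  Hilbert (@l2_ip_lin _ _ _ leb2 _ (@torus2_measurable R)) (@l2_ipC _ _ _ _ _ _)
    (@l2_ip_ge0 _ _ _ _ _ _) (@l2_complete _ _ _ _ _ _).
Local Notation H := torus_hilbert.

Lemma nsqE (x : E) : nsq H x = \int[leb2]_(z in D) normsq (x z).
Proof. by rewrite /nsq -[hip H x x]/(l2_ip x x) l2_ipxx. Qed.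

Lemma integral_normsq (v : T2 -> R[i]) : csqint leb2 D v ->
  (\int[leb2]_(z in D) (normsq (v z))%:E)%E = (\int[leb2]_(z in D) normsq (v z))%:E.
Proof.
move=> [[_ h1] [_ h2]]; rewrite fineK//; apply: integrable_fin_num; first exact: (@torus2_measurable R).
rewrite (_ : (fun _ => _) = (fun z => (Re (v z) ^+ 2)%:E + (Im (v z) ^+ 2)%:E)%E)//.
by apply: integrableD => //; exact: (@torus2_measurable R).
Qed.

Lemma L2norm_sq (v : field2 R) :
  (L2norm v `^ 2)%E = (\int[leb2]_(z in D) (normsq (v z))%:E)%E.
Proof.
rewrite /L2norm poweR_Lnorm// [RHS]integral_mkcond; apply: eq_integral => z _.
rewrite !patchE; case: ifP => _; last by rewrite abse0 poweR0r.
by rewrite normcE /= powR_mulrn ?normr_ge0// real_normK ?num_real// cabs_sq.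
Qed.

Lemma L2normE (v : field2 R) : csqint leb2 D v ->
  L2norm v = (Num.sqrt (\int[leb2]_(z in D) normsq (v z)))%:E.
Proof.
move=> hv; have := L2norm_sq v; rewrite integral_normsq//.
have : (0 <= L2norm v)%E by exact: Lnorm_ge0.
case: (L2norm v) => [r r0 /= []|_|//]; last by rewrite poweRyr.
by rewrite powR_mulrn// => <-; rewrite sqrtr_sqr ger0_norm.
Qed.

Lemma L2_csqint (v : field2 R) : L2 v <-> csqint leb2 D v.
Proof.
split=> [[mR mI fin]|hv]; last first.
  by split; [have [[]]:= hv|have [_ []]:= hv|rewrite L2normE// ltry].
have m1 : measurable_fun D (fun z => (Re (v z) ^+ 2)) by exact: measurable_funX.
have m2 : measurable_fun D (fun z => (Im (v z) ^+ 2)) by exact: measurable_funX.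
have fin2 : (\int[leb2]_(z in D) (normsq (v z))%:E < +oo)%E.
  by rewrite -L2norm_sq poweR_lty.
have iv : leb2.-integrable D (fun z => (normsq (v z))%:E).
  apply/integrableP; split; first by apply/measurable_EFinP; exact: measurable_funD.
  under eq_integral do rewrite gee0_abs ?lee_fin ?normsq_ge0 //.
  exact: fin2.
split; split=> //.
  apply: le_integrable iv => [||z _]; [exact: (@torus2_measurable R)|exact/measurable_EFinP|].
  by rewrite lee_fin ger0_norm ?sqr_ge0// ger0_norm ?normsq_ge0// lerDl sqr_ge0.
apply: le_integrable iv => [||z _]; [exact: (@torus2_measurable R)|exact/measurable_EFinP|].
by rewrite lee_fin ger0_norm ?sqr_ge0// ger0_norm ?normsq_ge0// lerDr sqr_ge0.
Qed.

Definition of_L2 (v : field2 R) (hv : L2 v) : E :=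
  mkl2 (@torus2_measurable R) ((L2_csqint v).1 hv).

Lemma torus_l2P (x : E) : L2 x.
Proof. by apply/L2_csqint; exact: l2fun_csqint. Qed.

Lemma L2norm_nrm (x : E) : L2norm x = (nrm H x)%:E.
Proof. by rewrite L2normE ?/nrm ?nsqE//; exact: l2fun_csqint. Qed.

Lemma L2dist_nrm (x y : E) : L2dist x y = (nrm H (x - y))%:E.
Proof. by rewrite -L2norm_nrm. Qed.

Lemma mkl2E (f : T2 -> R[i]) (hf : csqint leb2 D f) z :
  mkl2 (@torus2_measurable R) hf z = f z.
Proof. by []. Qed.

Definition torus_mode (i : int * int) : T2 -> R[i] :=
  fun z => ((2 * pi)^-1)%:C%C * fmode i z.

Lemma torus_modeJ i z : (torus_mode i z)^*%C = ((2 * pi)^-1)%:C%C * (fmode i z)^*%C.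
Proof. by apply: complexP; rewrite !cE /=; ring. Qed.

Lemma csqint_mode i : csqint leb2 D (torus_mode i).
Proof.
apply: (cbounded_csqint (@torus2_measurable R) (@torus2_finite R)).
by apply: cboundedM; [exact: cbounded_cst|exact: cbounded_fmode].
Qed.

Lemma hip_mode (x : E) i : hip H x (mkl2 (@torus2_measurable R) (csqint_mode i)) =
  ((2 * pi)^-1)%:C%C * cintegral leb2 D (fun z => x z * (fmode i z)^*%C).
Proof.
rewrite -cintegralZ; last 2 first.
- exact: torus2_measurable.
- apply: (csqintM (@torus2_measurable R)); first exact: l2fun_csqint.
  apply: (cbounded_csqint (@torus2_measurable R) (@torus2_finite R)).
  exact: cbounded_fmode.
by apply: eq_cintegral => z _; rewrite mkl2E torus_modeJ; ring.
Qed.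

Lemma torus_mode_orth i j :
  hip H (mkl2 (@torus2_measurable R) (csqint_mode i)) (mkl2 (@torus2_measurable R) (csqint_mode j)) =
  (i == j)%:R.
Proof.
rewrite hip_mode (@eq_cintegral _ _ _ leb2 D _ (fun z => ((2 * pi)^-1)%:C%C *
    fmode (i.1 - j.1, i.2 - j.2) z)); last first.
  by move=> z _; rewrite mkl2E -fmodeMJ /torus_mode mulrA.
rewrite cintegralZ; last 2 first.
- exact: torus2_measurable.
- apply: (cbounded_cintble (@torus2_measurable R) (@torus2_finite R)).
  exact: cbounded_fmode.
rewrite cintegral_fmode xpair_eqE !subr_eq0 -xpair_eqE -!surjective_pairing.
case: eqP => _; last by rewrite !mulr0.
by rewrite mulrA -!rmorphM -expr2 exprVn mulVf// expf_neq0// gt_eqF// twopi_gt0.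
Qed.

Lemma torus_mode_total (x : E) :
  (forall i, hip H x (mkl2 (@torus2_measurable R) (csqint_mode i)) = 0) ->
  {ae leb2, forall z, D z -> x z = 0}.
Proof.
move=> h; have pi0 : (2 * pi)^-1 != 0 :> R by rewrite invr_neq0// gt_eqF// twopi_gt0.
apply: fourier_total => [|i]; first exact: l2fun_csqint.
have /eqP := h i; rewrite hip_mode mulf_eq0 => /orP[/eqP/(congr1 Re)/= e|/eqP//].
by rewrite e eqxx in pi0.
Qed.

Lemma nsq_ae0 (x : E) : {ae leb2, forall z, D z -> x z = 0} -> nsq H x = 0.
Proof.
move=> ae0; have hx := l2fun_csqint x.
rewrite nsqE; apply: EFin_inj; rewrite -integral_normsq//.
rewrite -[RHS](@integral0 _ _ _ leb2 D); apply: ae_eq_integral => //.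
- exact: torus2_measurable.
- by have [[? _] [? _]] := hx; apply/measurable_EFinP; apply: measurable_funD; exact: measurable_funX.
- by apply: filterS ae0 => z h0 Dz; rewrite h0// /normsq /= expr0n/= addr0.
Qed.

Definition torus_basis : hbasis H (int * int)%type :=
  HBasis torus_mode_orth (fun x h => nsq_ae0 (torus_mode_total h)).
Local Notation e := torus_basis.

(** [fourier] divides the integral by the area [(2 pi) ^ 2], whereas the normalized modes divide it
    by [2 pi]. *)
Lemma fourier_coef (x : E) k l :
  fourier x k l = ((2 * pi)^-1)%:C%C * coef e x (k, l).
Proof.
rewrite /coef hip_mode mulrA -rmorphM -expr2 exprVn; congr (_ * _).
by apply: eq_cintegral => z _; congr (_ * _); rewrite /fmode -cisN -cexp_iR rmorphN mulrN.
Qed.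

Lemma L2eq_coef (x y : E) : (forall i, coef e x i = coef e y i) -> L2eq x y.
Proof.
move=> h; have ae0 : {ae leb2, forall z, D z -> (x - y) z = 0}.
  by apply: torus_mode_total => i; rewrite -[LHS]/(coef e (x - y) i) coefB h subrr.
by apply: filterS ae0 => z h0 Dz; apply/eqP; rewrite -subr_eq0 -l2_subE h0.
Qed.

End TorusL2.

(** * The control operator *)

Section SliceFubini.
Context d1 d2 (T1 : measurableType d1) (T2 : measurableType d2) (R : realType).
Variables (m1 : {sigma_finite_measure set T1 -> \bar R}).
Variables (m2 : {sigma_finite_measure set T2 -> \bar R}).
Variables (D1 : set T1) (D2 : set T2).
Hypotheses (mD1 : measurable D1) (mD2 : measurable D2).
Local Notation D := (D1 `*` D2).
Local Notation m12 := (m1 \x m2)%E.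

Let mD : measurable D. Proof. exact: measurableX. Qed.

Lemma patch_slice (f : T1 * T2 -> \bar R) x y :
  (f \_ D) (x, y) = ((fun y => ((fun x => f (x, y)) \_ D1) x) \_ D2) y.
Proof.
rewrite !patchE; have [/set_mem [/= hx hy]|h] := boolP ((x, y) \in D).
  by rewrite !mem_set.
have [/set_mem hy|//] := boolP (y \in D2).
have [/set_mem hx|//] := boolP (x \in D1).
by move/negP: h => []; apply/mem_set.
Qed.

Lemma fubini_slice (f : T1 * T2 -> \bar R) :
  fubini_G m1 (f \_ D) = (fun y => \int[m1]_(x in D1) f (x, y))%E \_ D2.
Proof.
apply/funext => y; rewrite /fubini_G.
under eq_integral do rewrite patch_slice.
rewrite patchE; case: ifPn => hy.
  by rewrite [RHS]integral_mkcond; apply: eq_integral => x _; rewrite patchE hy.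
by under eq_integral do rewrite patchE (negbTE hy); rewrite integral0.
Qed.

Lemma slice_integrable (f : T1 * T2 -> \bar R) : m12.-integrable D f ->
  {ae m2, forall y, D2 y -> m1.-integrable D1 (fun x => f (x, y))}.
Proof.
rewrite (integrable_mkcond _ mD) => /ae_integrable2; apply: filterS => y h Dy.
rewrite (integrable_mkcond _ mD1); move: h; congr integrable; apply/funext => x.
by rewrite patch_slice patchE mem_set.
Qed.

Lemma slice_tonelli (f : T1 * T2 -> \bar R) : measurable_fun D f ->
  (forall z, D z -> 0 <= f z)%E ->
  measurable_fun D2 (fun y => \int[m1]_(x in D1) f (x, y))%E /\
  (\int[m12]_(z in D) f z)%E = (\int[m2]_(y in D2) \int[m1]_(x in D1) f (x, y))%E.
Proof.
move=> mf f0; have mp : measurable_fun setT (f \_ D) by apply/measurable_restrict => //; rewrite setTI.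
have p0 z : (0 <= (f \_ D) z)%E.
  by rewrite patchE; case: ifPn => // /set_mem; exact: f0.
split; last first.
  by rewrite integral_mkcond fubini_tonelli2// fubini_slice [RHS]integral_mkcond.
have := measurable_fun_fubini_tonelli_G (m1 := m1) _ mp p0.
rewrite fubini_slice => h.
by have := (measurable_restrict _ mD2 measurableT).2 h; rewrite setTI.
Qed.

Lemma Rintegral_slice (f : T1 * T2 -> R) : m12.-integrable D (EFin \o f) ->
  measurable_fun D2 (fun y => \int[m1]_(x in D1) f (x, y)) /\
  \int[m12]_(z in D) f z = \int[m2]_(y in D2) \int[m1]_(x in D1) f (x, y).
Proof.
move=> hf; have ae := slice_integrable hf.
have hf' := hf; rewrite (integrable_mkcond _ mD) in hf'.
have mG : measurable_fun D2 (fun y => \int[m1]_(x in D1) (f (x, y))%:E)%E.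
  have := measurable_fubini_G hf'; rewrite fubini_slice => h.
  by have := (measurable_restrict _ mD2 measurableT).2 h; rewrite setTI.
have mf : measurable_fun D2 (fun y => \int[m1]_(x in D1) f (x, y)).
  apply: (measurableT_comp (f := fine)) mG.
  exact: fine_measurable.
split=> //; rewrite /Rintegral integral_mkcond -integral21_prod_meas1// fubini_slice.
rewrite -integral_mkcond; congr fine; apply: ae_eq_integral => //.
  exact/measurable_EFinP.
apply: filterS ae => y h Dy; rewrite fineK//; apply: integrable_fin_num => //.
exact: h.
Qed.

Lemma cintegral_slice (f : T1 * T2 -> R[i]) : cintble m12 D f ->
  [/\ measurable_fun D2 (fun y => Re (cintegral m1 D1 (fun x => f (x, y)))),
      measurable_fun D2 (fun y => Im (cintegral m1 D1 (fun x => f (x, y)))),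
      {ae m2, forall y, D2 y -> cintble m1 D1 (fun x => f (x, y))} &
      cintegral m12 D f = cintegral m2 D2 (fun y => cintegral m1 D1 (fun x => f (x, y)))].
Proof.
move=> [hR hI]; have [mR eR] := Rintegral_slice hR; have [mI eI] := Rintegral_slice hI.
split=> //; last by congr Complex.
by apply: filterS2 (slice_integrable hR) (slice_integrable hI) => y h1 h2 Dy; split; [exact: h1|exact: h2].
Qed.

Lemma ae_cintegral0 (f : T2 -> R[i]) :
  measurable_fun D2 (fun y => Re (f y)) -> measurable_fun D2 (fun y => Im (f y)) ->
  {ae m2, forall y, D2 y -> f y = 0} -> cintegral m2 D2 f = 0.
Proof.
move=> mR mI f0; apply: complexP => /=; rewrite /Rintegral.
  rewrite (ae_eq_integral (cst 0%E)) ?integral0//; first exact/measurable_EFinP.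
  by apply: filterS f0 => y h Dy; rewrite h.
rewrite (ae_eq_integral (cst 0%E)) ?integral0//; first exact/measurable_EFinP.
by apply: filterS f0 => y h Dy; rewrite h.
Qed.

End SliceFubini.

Section ControlOp.
Variable R : realType.
Local Notation leb1 := (@lebesgue_measure R).
Local Notation leb2 := (leb1 \x leb1)%E.
Local Notation D1 := (@torus R).
Local Notation D := (@torus2 R).
Local Notation T2 := (measurableTypeR R * measurableTypeR R)%type.
Let mD1 := @torus_measurable R.
Let mD := @torus2_measurable R.
Let fD1 := @torus_finite R.
Let fD := @torus2_finite R.

Variables (g : R -> R) (B : R).
Hypothesis g_cont : continuous g.
Hypothesis g_ge0 : forall x, 0 <= g x.
Hypothesis g_le : forall x, D1 x -> g x <= B.
Hypothesis g_int : \int[leb1]_(x in D1) g x = 1.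

Let mg : measurable_fun D1 g.
Proof. by apply: measurable_funTS; exact: continuous_measurable_fun. Qed.

Lemma cbounded_weight : cbounded D1 (fun x => (g x)%:C%C).
Proof.
split; [exact: mg|exact: measurable_cst|].
by exists B => x Dx; rewrite cabs_real ger0_norm ?g_le.
Qed.

Let ig : leb1.-integrable D1 (EFin \o g).
Proof. by have [] := cbounded_cintble mD1 fD1 cbounded_weight. Qed.

Lemma cintegral_weight : cintegral leb1 D1 (fun x => (g x)%:C%C) = 1.
Proof. by apply: complexP => /=; rewrite ?g_int// Rintegral_cst// mul0r. Qed.

(** The variance of [f] for the probability [g dx] is nonnegative. *)
Lemma weighted_jensen (f : R -> R) : measurable_fun D1 f ->
  leb1.-integrable D1 (fun x => (g x * f x ^+ 2)%:E) ->
  (\int[leb1]_(x in D1) (g x * f x)) ^+ 2 <= \int[leb1]_(x in D1) (g x * f x ^+ 2).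
Proof.
move=> mf i2; have i1 : leb1.-integrable D1 (fun x => (g x * f x)%:E).
  apply: (le_integrable mD1 _ _ (integrableD mD1 ig i2)).
    by apply/measurable_EFinP; exact: measurable_funM.
  move=> x Dx /=; rewrite lee_fin normrM (ger0_norm (g_ge0 x)).
  apply: le_trans (_ : g x + g x * f x ^+ 2 <= _); last exact: ler_norm.
  rewrite -{2}[g x]mulr1 -mulrDr ler_wpM2l// ler_norml.
  by apply/andP; split; nra.
set c := \int[leb1]_(x in D1) (g x * f x).
have : 0 <= \int[leb1]_(x in D1) (g x * (f x - c) ^+ 2).
  by apply: Rintegral_ge0 => x _; rewrite mulr_ge0// sqr_ge0.
rewrite (_ : (fun x => g x * (f x - c) ^+ 2) =
  (fun x => (g x * f x ^+ 2 + (- (2 * c)) * (g x * f x)) + c ^+ 2 * g x)); last first.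
  by apply/funext => x; ring.
have i1' : leb1.-integrable D1 (fun x => (- (2 * c) * (g x * f x))%:E).
  by have := integrableZl mD1 (- (2 * c)) i1.
have i0' : leb1.-integrable D1 (fun x => (c ^+ 2 * g x)%:E).
  by have := integrableZl mD1 (c ^+ 2) ig.
rewrite RintegralD//; last by have := integrableD mD1 i2 i1'.
rewrite RintegralD// !RintegralZl// g_int -/c.
by rewrite -subr_ge0; congr (_ <= _); ring.
Qed.

Lemma sqint_weighted_mean (f : T2 -> R) : sqint leb2 D f ->
  sqint leb2 D (fun z => \int[leb1]_(x in D1) (g x * f (x, z.2))).
Proof.
move=> hf; have [mf f2] := hf.
have [sg _] := cbounded_csqint mD fD (cbounded_fst cbounded_weight).
have i1 : leb2.-integrable D (EFin \o (fun z : T2 => g z.1 * f z)) by have := sqintM mD sg hf.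
have [mgz _] := sg.
have i2 : leb2.-integrable D (fun z : T2 => (g z.1 * f z ^+ 2)%:E).
  apply: (le_integrable mD _ _ (integrableZl mD B f2)).
    by apply/measurable_EFinP; apply: measurable_funM => //; exact: measurable_funX.
  move=> z Dz /=; rewrite lee_fin.
  rewrite (ger0_norm (mulr_ge0 (g_ge0 _) (sqr_ge0 _))).
  apply: le_trans (_ : B * f z ^+ 2 <= _); last exact: ler_norm.
  by rewrite ler_wpM2r ?sqr_ge0//; apply: g_le; case: Dz.
pose M y := \int[leb1]_(x in D1) (g x * f (x, y)).
have [mM _] := Rintegral_slice mD1 mD1 i1.
have mMz : measurable_fun D (fun z : T2 => M z.2) by exact: (@measurable_torus_snd R M).
split=> //; apply/integrableP; split; first by apply/measurable_EFinP; exact: measurable_funX.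
have [_ ->] := @slice_tonelli _ _ _ _ R leb1 leb1 D1 D1 mD1 mD1
  (fun z : T2 => `|(M z.2 ^+ 2)%:E|%E)
  ltac:(apply: measurableT_comp => //; apply/measurable_EFinP; exact: measurable_funX)
  (fun z _ => abse_ge0 _).
have [mS eS] := @slice_tonelli _ _ _ _ R leb1 leb1 D1 D1 mD1 mD1
  (fun z : T2 => (g z.1 * f z ^+ 2)%:E) (measurable_int _ i2)
  (fun z _ => ltac:(rewrite lee_fin mulr_ge0 ?sqr_ge0//)).
apply: (@le_lt_trans _ _ (\int[leb1]_(y in D1)
    ((2 * pi)%:E * \int[leb1]_(x in D1) (g x * f (x, y) ^+ 2)%:E))%E).
  have S0 y : D1 y -> (0 <= \int[leb1]_(x in D1) (g x * f (x, y) ^+ 2)%:E)%E.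
    by move=> _; apply: integral_ge0 => x _; rewrite lee_fin mulr_ge0 ?sqr_ge0.
  have tp : (0 <= (2 * pi)%:E :> \bar R)%E by rewrite lee_fin ltW// twopi_gt0.
  (* The mean does not depend on [x], so integrating its square over the first circle only
     multiplies it by [2 pi]. *)
  rewrite (eq_integral (fun y => ((2 * pi)%:E * (M y ^+ 2)%:E)%E)); last first.
    move=> y _; rewrite muleC -(@torus_measure R) -(integral_cst leb1 mD1).
    by apply: eq_integral => x _; rewrite gee0_abs// lee_fin sqr_ge0.
  apply: ae_ge0_le_integral => //.
  - by move=> y _; rewrite mule_ge0// lee_fin sqr_ge0.
  - by apply: measurable_funeM; apply/measurable_EFinP; exact: measurable_funX.
  - by move=> y Dy; rewrite mule_ge0// S0.
  - exact: measurable_funeM.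
  (* Measurability of almost every slice is read off from the integrability of [f], which holds
     because the torus has finite area. *)
  have hm : {ae leb1, forall y, D1 y -> measurable_fun D1 (fun x => f (x, y))}.
    have cf : csqint leb2 D (fun z => Complex (f z) 0).
      split=> //; split; first exact: measurable_cst.
      by under eq_fun do rewrite /= expr0n/=; exact: integrable0.
    have [if1 _] := csqint_cintble mD fD cf.
    apply: filterS (slice_integrable mD1 mD1 if1) => y h Dy.
    by have /measurable_int/measurable_EFinP := h Dy.
  apply: filterS2 hm (slice_integrable mD1 mD1 i2) => y h1 h2 Dy.
  apply: lee_wpmul2l => //; rewrite -[leRHS]fineK; last exact: integrable_fin_num (h2 Dy).
  by rewrite lee_fin; apply: weighted_jensen; [exact: h1|exact: h2].
rewrite ge0_integralZl_EFin//; last 2 first.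
- by move=> y _; apply: integral_ge0 => x _; rewrite lee_fin mulr_ge0 ?sqr_ge0.
- by rewrite ltW// twopi_gt0.
rewrite -eS; rewrite -(fineK (integrable_fin_num mD i2)) -EFinM; exact: ltry.
Qed.

Definition weighted_mean (h : T2 -> R[i]) (y : R) : R[i] :=
  cintegral leb1 D1 (fun x => (g x)%:C%C * h (x, y)).

Lemma csqint_weight (h : T2 -> R[i]) : csqint leb2 D h ->
  csqint leb2 D (fun z => (g z.1)%:C%C * h z).
Proof. by apply: cbounded_csqintM => //; exact: (cbounded_fst cbounded_weight). Qed.

Lemma csqint_mean (h : T2 -> R[i]) : csqint leb2 D h ->
  csqint leb2 D (fun z => weighted_mean h z.2).
Proof.
move=> [hR hI]; split.
  move: (sqint_weighted_mean hR); congr sqint; apply/funext => z /=.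
  by apply: eq_Rintegral => x _; rewrite ReM /= mul0r subr0.
move: (sqint_weighted_mean hI); congr sqint; apply/funext => z /=.
by apply: eq_Rintegral => x _; rewrite ImM /= mul0r addr0.
Qed.

Lemma csqintB (f h : T2 -> R[i]) : csqint leb2 D f -> csqint leb2 D h ->
  csqint leb2 D (fun z => f z - h z).
Proof.
move=> hf hh; have := csqint_lin mD (-1) hh hf.
by congr csqint; apply/funext => z; rewrite mulN1r addrC.
Qed.

Lemma csqint_fluct (h : T2 -> R[i]) : csqint leb2 D h ->
  csqint leb2 D (fun z => h z - weighted_mean h z.2).
Proof. by move=> hh; apply: csqintB => //; exact: csqint_mean. Qed.

Lemma csqint_control (h : T2 -> R[i]) : csqint leb2 D h -> csqint leb2 D (control_op g h).
Proof. by move=> hh; apply: csqint_weight; exact: csqint_fluct. Qed.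

(** On almost every slice, [q] is constant and the integral of [g] times the fluctuation vanishes
    because [g] has integral 1. Both the self-adjointness of the control operator and the zero mean
    of its range come from this. *)
Lemma fluct_orth (h : T2 -> R[i]) (q : R -> R[i]) : csqint leb2 D h ->
  csqint leb2 D (fun z => q z.2) ->
  cintegral leb2 D (fun z => (g z.1)%:C%C * (h z - weighted_mean h z.2) * (q z.2)^*%C) = 0.
Proof.
move=> hh hq.
have [m1 m2 _ ->] := cintegral_slice mD1 mD1 (csqintM mD (csqint_control hh) hq).
apply: (ae_cintegral0 (D2 := D1) mD1 m1 m2).
have [_ _ a _] := cintegral_slice mD1 mD1 (csqint_cintble mD fD (csqint_weight hh)).
have iw := cbounded_cintble mD1 fD1 cbounded_weight.
apply: filterS a => y iy Dy; have {}iy := iy Dy.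
rewrite (@eq_cintegral _ _ _ leb1 D1 _ (fun x => (q y)^*%C *
   ((g x)%:C%C * h (x, y) - weighted_mean h y * (g x)%:C%C))); last first.
  by move=> x _; rewrite -[control_op g h _]/((g x)%:C%C * (h (x, y) - weighted_mean h y)) /=; ring.
rewrite cintegralZ//; last by apply: cintbleB => //; exact: cintbleZ.
rewrite cintegralB//; last exact: cintbleZ.
by rewrite cintegralZ// cintegral_weight mulr1 subrr mulr0.
Qed.

Local Notation E := (torus_l2 R).
Local Notation H := (torus_hilbert R).
Local Notation e := (torus_basis R).

Definition control (x : E) : E := mkl2 mD (csqint_control (l2fun_csqint x)).

Definition control_form (x y : E) : R[i] := cintegral leb2 D (fun z =>
  (g z.1)%:C%C * (x z - weighted_mean x z.2) * (y z - weighted_mean y z.2)^*%C).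

(** By [fluct_orth] the mean of [y] may be subtracted for free, which puts [x] and [y] in symmetric
    roles. *)
Lemma ip_control x y : hip H (control x) y = control_form x y.
Proof.
have hx := csqint_control (l2fun_csqint x); have hy := l2fun_csqint y.
have hm := csqint_mean hy.
rewrite -[LHS]subr0 -(fluct_orth (l2fun_csqint x) hm) -[hip _ _ _]/(cintegral _ _ _).
rewrite -cintegralB//; [|exact: csqintM|exact: csqintM].
apply: eq_cintegral => z _; set m := weighted_mean y z.2.
rewrite rmorphB /= -[control_op g x z]/((g z.1)%:C%C * (x z - weighted_mean x z.2)).
by ring.
Qed.

Lemma control_formC x y : control_form y x = (control_form x y)^*%C.
Proof.
rewrite /control_form -cintegral_conj//; last first.
  by apply: (csqintM mD (csqint_control (l2fun_csqint x)) (csqint_fluct (l2fun_csqint y))).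
apply: eq_cintegral => z _; apply: complexP; rewrite !cE /=; ring.
Qed.

Lemma control_selfadjoint x y : hip H (control x) y = hip H x (control y).
Proof. by rewrite (hipC H (control y) x) !ip_control control_formC. Qed.

(** One factor [g] is bounded by [B] in the integral of [g ^ 2 |x - mean| ^ 2], so the square of the
    norm is at most [B] times the product of [control x] with [x]; Cauchy-Schwarz then lets one norm
    cancel. *)
Lemma control_bound x : nrm H (control x) <= B * nrm H x.
Proof.
have B0 : 0 <= B by apply: le_trans (g_ge0 0) (g_le _); rewrite /torus /= in_itv /= lexx mulr_gt0// pi_gt0.
have hc := l2fun_csqint (control x).
have h1 : nsq H (control x) <= B * Re (control_form x x).
  rewrite nsqE -[Re (control_form x x)]/(Rintegral _ _ _).
  have ic := csqintM mD (csqint_control (l2fun_csqint x)) (csqint_fluct (l2fun_csqint x)).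
  have [icR _] := ic; rewrite -RintegralZl//.
  apply: le_Rintegral => //; last move=> z Dz.
  - by have [iN _] := csqintM mD hc hc; move: iN; congr integrable; apply/funext => z; rewrite mulcJ.
  - by have := integrableZl mD B icR.
  rewrite -mulrA mulcJ -[control x z]/((g z.1)%:C%C * (x z - weighted_mean x z.2)) normsqM.
  rewrite !cE /= !mul0r subr0 mulrA {1}/normsq /= expr0n addr0.
  rewrite ler_wpM2r ?normsq_ge0// expr2 ler_wpM2r//.
  by apply: g_le; case: Dz.
have h2 : Re (control_form x x) <= nrm H (control x) * nrm H x.
  rewrite -ip_control; apply: le_trans (cabs_ip _ _ _).
  exact: le_trans (ler_norm _) (ler_Re_cabs _).
have [->|n0] := eqVneq (nrm H (control x)) 0; first by rewrite mulr_ge0 ?nrm_ge0.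
rewrite -(ler_pM2l (_ : 0 < nrm H (control x))); last by rewrite lt_neqAle eq_sym n0 nrm_ge0.
rewrite -expr2 nrm_sq; apply: le_trans h1 _.
by rewrite mulrCA ler_wpM2l.
Qed.

Lemma coef_mode (x : E) i :
  coef e x i = ((2 * pi)^-1)%:C%C * cintegral leb2 D (fun z => x z * (fmode i z)^*%C).
Proof. exact: hip_mode. Qed.

Lemma coef_control0 x l : coef e (control x) (0, l) = 0.
Proof.
rewrite coef_mode [X in _ * X](_ : _ = 0) ?mulr0//.
rewrite -[RHS](fluct_orth (q := fun y => cis (l%:~R * y)) (l2fun_csqint x)).
  by apply: eq_cintegral => z _; rewrite /fmode mul0r add0r.
have := cbounded_csqint mD fD (@cbounded_fmode R (0, l)).
by congr csqint; apply/funext => z; rewrite /fmode mul0r add0r.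
Qed.

Definition weight_coef (n : int) : R[i] :=
  cintegral leb1 D1 (fun x => (g x)%:C%C * cis (n%:~R * x)).

Definition weight_gram (k j : int) : R[i] :=
  weight_coef (j - k) - weight_coef j * weight_coef (- k).

(** The weight depends on [x] only, so modes in [y] do not interact. The normalization leaves
    [1 / (2 pi)]: two factors from the modes, one [2 pi] regained from the integral in [y]. *)
Lemma coef_control_mode (i j : int * int) : coef e (control (e i)) j =
  if i.2 == j.2 then ((2 * pi)^-1)%:C%C * weight_gram j.1 i.1 else 0.
Proof.
have cw n : cbounded D1 (fun x => (g x)%:C%C * cis (n%:~R * x)).
  by apply: cboundedM; [exact: cbounded_weight|exact: cbounded_cis].
have iw n := cbounded_cintble mD1 fD1 (cw n).
have mE y : weighted_mean (e i) y = ((2 * pi)^-1)%:C%C * cis (i.2%:~R * y) * weight_coef i.1.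
  rewrite -cintegralZ//; apply: eq_cintegral => x _.
  by rewrite -[e i _]/(torus_mode i _) /torus_mode /fmode cisD; ring.
pose f x := ((2 * pi)^-1)%:C%C * (- weight_coef i.1 * ((g x)%:C%C * cis ((- j.1)%:~R * x)) +
  (g x)%:C%C * cis ((i.1 - j.1)%:~R * x)).
rewrite coef_mode (@eq_cintegral _ _ _ leb2 D _ (fun z =>
  f z.1 * cis ((i.2 - j.2)%:~R * z.2))); last first.
  move=> z _; rewrite -[control (e i) z]/((g z.1)%:C%C * (e i z - weighted_mean (e i) z.2)) mE.
  rewrite -[e i _]/(torus_mode i _) /f /torus_mode /fmode -cisN !rmorphB !rmorphN /=.
  by rewrite !(mulrDl, mulNr, opprD, cisD); ring.
have hf : cbounded D1 f.
  apply: cboundedM; first exact: cbounded_cst.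
  apply: cboundedD => //; apply: cboundedM => //; exact: cbounded_cst.
rewrite (cintegral_torus2_prod hf (cbounded_cis _)).
rewrite cintegral_cis subr_eq0; case: eqP => _; last by rewrite !mulr0.
rewrite cintegralZ//; last exact: cintble_lin.
rewrite cintegral_lin// -![cintegral _ _ _]/(weight_coef _) mulNr addrC -/(weight_gram _ _).
have tp : 2 * pi != 0 :> R by rewrite gt_eqF// twopi_gt0.
congr (_ * _); rewrite mulrC mulrA -rmorphM /= divff// mul1r.
by [].
Qed.

End ControlOp.

(** * The Gram matrix of the weighted exponentials *)

Section ThreeExponentials.
Variable R : realType.
Implicit Types z u v w : R[i].

Lemma normsqD_le z w : normsq (z + w) <= 2 * normsq z + 2 * normsq w.
Proof.
rewrite /normsq !cE; case: z w => [x y] [x' y'] /=.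
by have := sqr_ge0 (x - x'); have := sqr_ge0 (y - y'); lra.
Qed.

Lemma normsqB_le z w : normsq (z - w) <= 2 * normsq z + 2 * normsq w.
Proof. by rewrite -(normsqN w) normsqD_le. Qed.

Lemma normsq_cisB1 (t : R) : normsq (cis t - 1) = 2 - 2 * cos t.
Proof. by rewrite /normsq !cE /= -[RHS]addr0 -(subrr (cos t ^+ 2 + sin t ^+ 2)) {4}cos2Dsin2; ring. Qed.

(** The step is adapted to the frequency so that [|n t|] lies in [[d, pi]], where the cosine is at
    most [cos d]; the bound no longer depends on [n]. *)
Lemma normsq_cisB1_ge (n : int) (d t : R) : n != 0 -> 0 < d <= pi ->
  t = Num.min d (pi / `|n%:~R|) -> 2 - 2 * cos d <= normsq (cis (n%:~R * t) - 1).
Proof.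
move=> n0 /andP[d0 dpi] tE; rewrite normsq_cisB1 lerD2l lerN2 ler_pM2l//.
have n1 : 1 <= `|n%:~R : R| by rewrite -intr_norm (ler_int R 1) -gtz0_ge1 normr_gt0.
have pi0 := @pi_gt0 R; have n_gt0 : 0 < `|n%:~R : R| by lra.
have t0 : 0 < t by rewrite tE lt_min d0 divr_gt0.
have tle : t <= pi / `|n%:~R| by rewrite tE ge_min lexx orbT.
have nt : `|n%:~R * t| <= pi by rewrite normrM (gtr0_norm t0) mulrC -ler_pdivlMr.
have dnt : d <= `|n%:~R * t|.
  rewrite normrM (gtr0_norm t0) tE; case: (leP d (pi / _)) => _; first by rewrite ler_peMl// ltW.
  by rewrite mulrC divfK ?gt_eqF.
have -> : cos (n%:~R * t) = cos `|n%:~R * t|.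
  by case: (leP 0 (n%:~R * t)) => h; [rewrite ger0_norm|rewrite ltr0_norm ?cosN].
rewrite leNgt ltr_cos ?in_itv/= ?normr_ge0 ?nt ?dpi ?(ltW d0)// -leNgt.
exact: dnt.
Qed.

Definition trig (a0 a1 a2 : R[i]) (k j : int) (x : R) : R[i] :=
  a0 + a1 * cis (k%:~R * x) + a2 * cis (j%:~R * x).

(* Two finite differences in [x] annihilate the modes 0 and [j]. *)
Lemma trig_difference a0 a1 a2 k j (t s x : R) :
  trig a0 a1 a2 k j (x + t + s) - trig a0 a1 a2 k j (x + s) -
    cis (j%:~R * s) * (trig a0 a1 a2 k j (x + t) - trig a0 a1 a2 k j x) =
  a1 * (cis (k%:~R * t) - 1) * (cis ((k - j)%:~R * s) - 1) * cis (j%:~R * s) * cis (k%:~R * x).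
Proof.
have e : cis (k%:~R * s) = cis ((k - j)%:~R * s) * cis (j%:~R * s) :> R[i].
  by rewrite -cisD rmorphB /=; congr cis; ring.
by rewrite /trig !mulrDr !cisD e; ring.
Qed.

Lemma trig_primitive a0 a1 a2 k j : exists F : R -> R, forall x : R,
  is_derive x 1 F (normsq (trig a0 a1 a2 k j x)).
Proof.
(* The squared modulus of a sum is the Gram form of the matrix with all entries 1. The integers 0,
   1, 2 are labels, so that the frequencies 0, [k], [j] may coincide. *)
pose b (n : int) := if n == 0 then a0 else if n == 1 then a1 else a2.
pose w (n : int) : R := if n == 0 then 0 else if n == 1 then k%:~R else j%:~R.
exists (gram_energy (fun _ _ => 1) w [:: 0; 1; 2] b) => x.
have := @derive_gram_energy R (fun _ _ => 1) w [:: 0; 1; 2] b x; congr is_derive.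
rewrite /gram_form !big_cons !big_nil /flow /b /w /= mul0r cis0 mulr1 !mul1r /trig.
by rewrite /normsq !cE; ring.
Qed.

Lemma trig_coercive (p q : R) : p < q -> exists2 c, 0 < c & forall a0 a1 a2 k j (F : R -> R),
  k != 0 -> k != j ->
  (forall x : R, is_derive x 1 F (normsq (trig a0 a1 a2 k j x))) ->
  c * normsq a1 <= F q - F p.
Proof.
move=> pq; have pi0 := @pi_gt0 R.
(* With [d <= (q - p) / 4] the interval [[p, q - 2 d]] keeps at least half of the length. The four
   terms, each with a factor 4, account for the rest of the 32. *)
pose d := Num.min pi ((q - p) / 4).
have d0 : 0 < d by rewrite lt_min pi0 divr_gt0// subr_gt0.
have dpi : d <= pi by rewrite ge_min lexx.
have dq : d <= (q - p) / 4 by rewrite ge_min lexx orbT.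
pose s2 := 2 - 2 * cos d.
have s20 : 0 < s2.
  have : cos d < 1 by rewrite -[X in _ < X]cos0 ltr_cos ?in_itv/= ?lexx ?dpi ?(ltW d0) ?(ltW pi0).
  by rewrite /s2; lra.
exists (s2 ^+ 2 * (q - p) / 32); first by rewrite divr_gt0// mulr_gt0 ?exprn_gt0// subr_gt0.
move=> a0 a1 a2 k j F k0 kj dF.
pose t : R := Num.min d (pi / `|k%:~R|); pose s : R := Num.min d (pi / `|(k - j)%:~R|).
have kj0 : k - j != 0 by rewrite subr_eq0.
have t0 : 0 <= t by rewrite le_min (ltW d0) divr_ge0// ltW.
have s0 : 0 <= s by rewrite le_min (ltW d0) divr_ge0// ltW.
have td : t <= d by rewrite ge_min lexx.
have sd : s <= d by rewrite ge_min lexx.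
have At : s2 <= normsq (cis (k%:~R * t) - 1) by apply: normsq_cisB1_ge; rewrite ?d0.
have As : s2 <= normsq (cis ((k - j)%:~R * s) - 1) by apply: normsq_cisB1_ge; rewrite ?d0.
set f := trig a0 a1 a2 k j.
have key x : normsq a1 * s2 ^+ 2 <= 4 * (normsq (f (x + t + s)) + normsq (f (x + s)) +
    normsq (f (x + t)) + normsq (f x)).
  apply: (@le_trans _ _ (normsq (f (x + t + s) - f (x + s) - cis (j%:~R * s) * (f (x + t) - f x)))).
    rewrite trig_difference !normsqM !normsq_cis !mulr1 expr2 -mulrA ler_wpM2l ?normsq_ge0//.
    by rewrite ler_pM// ltW.
  have := normsqB_le (f (x + t + s) - f (x + s)) (cis (j%:~R * s) * (f (x + t) - f x)).
  rewrite [normsq (cis _ * _)]normsqM normsq_cis mul1r.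
  have := normsqB_le (f (x + t + s)) (f (x + s)); have := normsqB_le (f (x + t)) (f x).
  by lra.
have Fmono x y : x <= y -> F x <= F y.
  by apply: derive_ge0_le => // z _; exact: normsq_ge0.
pose P x := 1 * (1 * (1 * F (x + (t + s)) + 1 * F (x + s)) + 1 * (1 * F (x + t) + 1 * F x)) +
  (- (normsq a1 * s2 ^+ 2 / 4)) * x.
pose Q x := (1 * (1 * (1 * normsq (f (x + (t + s))) + 1 * normsq (f (x + s))) +
    1 * (1 * normsq (f (x + t)) + 1 * normsq (f x))) + (- (normsq a1 * s2 ^+ 2 / 4)) * 1).
have dP (x : R) : is_derive x 1 P (Q x).
  have tr (u : R) : forall y : R, is_derive y 1 (fun x => F (x + u)) (normsq (f (y + u))).
    exact: derive_translate.
  have h1 := derive_lin 1 1 (tr (t + s)) (tr s); have h2 := derive_lin 1 1 (tr t) dF.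
  exact: (derive_lin _ _ (derive_lin 1 1 h1 h2) (fun y : R => is_derive_id y (1 : R))).
have : P p <= P (q - 2 * d).
  apply: (@derive_ge0_le R P Q p (q - 2 * d) dP) => [x _|]; last by lra.
  rewrite /Q; have := key x; rewrite [x + (t + s)]addrA; lra.
rewrite /P.
have h1 := Fmono p (p + (t + s)) ltac:(lra); have h2 := Fmono p (p + s) ltac:(lra).
have h3 := Fmono p (p + t) ltac:(lra).
have h4 := Fmono (q - 2 * d + (t + s)) q ltac:(lra); have h5 := Fmono (q - 2 * d + s) q ltac:(lra).
have h6 := Fmono (q - 2 * d + t) q ltac:(lra); have h7 := Fmono (q - 2 * d) q ltac:(lra).
set A := normsq a1 * s2 ^+ 2 => h8.
have A0 : 0 <= A by rewrite mulr_ge0 ?normsq_ge0 ?sqr_ge0.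
rewrite (_ : _ * _ = A * (q - p) / 32); last by rewrite /A; ring.
have : A / 4 * ((q - p) / 2) <= A / 4 * (q - 2 * d - p).
  by rewrite ler_wpM2l ?divr_ge0//; lra.
by lra.
Qed.

End ThreeExponentials.

Section WeightCoef.
Variable R : realType.
Local Notation leb1 := (@lebesgue_measure R).
Local Notation D1 := (@torus R).
Let mD1 := @torus_measurable R.
Let fD1 := @torus_finite R.

Lemma torus_continuous_integrable (f : R -> R) : continuous f -> leb1.-integrable D1 (EFin \o f).
Proof.
move=> cf; have := continuous_integrable_cc 0 (2 * pi) cf.
by apply: integrableS => //; exact: subset_itv_co_cc.
Qed.

Lemma continuous_torus_bounded (f : R -> R) : continuous f ->
  exists2 B, 0 <= B & forall x, x \in `[0, 2 * pi] -> `|f x| <= B.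
Proof.
move=> cf; have tp : 0 <= 2 * pi :> R by rewrite ltW// twopi_gt0.
have cn : {within `[0, 2 * pi], continuous (fun x => `|f x|)}.
  by apply: continuous_subspaceT => x; apply: cvg_norm; exact: cf.
by have [c _ hc] := EVT_max tp cn; exists `|f c|.
Qed.

Variable g : R -> R.
Hypothesis gC2 : C2 g.
Hypothesis g_per : forall x, g (x + 2 * pi) = g x.
Hypothesis g_ge0 : forall x, 0 <= g x.
Hypothesis g_int : \int[leb1]_(x in D1) g x = 1.

Lemma weight_derive (x : R) : is_derive x 1 g (derive1 g x).
Proof. by have [h _ _] := gC2; rewrite derive1E; apply/derivableP; exact: h. Qed.

Lemma weight_derive2 (x : R) : is_derive x 1 (derive1 g) (derive1 (derive1 g) x).
Proof. by have [_ h _] := gC2; rewrite [in X in is_derive _ _ _ X]derive1E; apply/derivableP; exact: h. Qed.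

Lemma weight_continuous : continuous g.
Proof. exact: derive_continuous weight_derive. Qed.

Lemma weight_bounded : exists2 B, 0 <= B & forall x, D1 x -> g x <= B.
Proof.
have [B B0 hB] := continuous_torus_bounded weight_continuous; exists B => // x Dx.
by apply: le_trans (ler_norm _) (hB x _); exact: subset_itv_co_cc Dx.
Qed.

Lemma weight_derive_per x : derive1 g (x + 2 * pi) = derive1 g x.
Proof.
have h1 := derive_translate (2 * pi) weight_derive x.
rewrite (_ : (fun t => g (t + 2 * pi)) = g) in h1; last by apply/funext => y; exact: g_per.
have [_ e1] := h1; have [_ e2] := weight_derive x; by rewrite -e1 -e2.
Qed.

(** Two integrations by parts. The phase [c] covers cosine and sine together. *)
Lemma weight_cos_decay : exists2 C, 0 <= C & forall (n : int) (c : R), n != 0 ->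
  `|\int[leb1]_(x in D1) (g x * cos (n%:~R * x + c))| <= C / n%:~R ^+ 2.
Proof.
have [_ _ cg2] := gC2; have [B B0 hB] := continuous_torus_bounded cg2.
exists (B * (2 * pi)); first by rewrite mulr_ge0// ltW// twopi_gt0.
move=> n c n0; have w0 : n%:~R != 0 :> R by rewrite intr_eq0.
set w : R := n%:~R in w0 *.
have dcos (x : R) : is_derive x 1 (fun t => cos (w * t + c)) (w * - sin (w * x + c)).
  have h := derive_translate c (@is_derive_cos R).
  exact: (derive_scaled w h).
have dsin (x : R) : is_derive x 1 (fun t => sin (w * t + c)) (w * cos (w * x + c)).
  have h := derive_translate c (@is_derive_sin R).
  exact: (derive_scaled w h).
have ccos := derive_continuous dcos; have csin := derive_continuous dsin.
(* The boundary terms of both integrations by parts; they cancel over a period, and the derivative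
   is the integrand plus the remainder [r] containing the second derivative of [g]. *)
pose F x := w^-1 * (g x * sin (w * x + c)) + (w ^+ 2)^-1 * (derive1 g x * cos (w * x + c)).
pose r x := (w ^+ 2)^-1 * (derive1 (derive1 g) x * cos (w * x + c)).
have dF (x : R) : is_derive x 1 F (g x * cos (w * x + c) + r x).
  have h1 (y : R) : is_derive y 1 (fun t => g t * sin (w * t + c))
      (g y * (w * cos (w * y + c)) + sin (w * y + c) * derive1 g y).
    exact: (is_deriveM (weight_derive y) (dsin y)).
  have h2 (y : R) : is_derive y 1 (fun t => derive1 g t * cos (w * t + c))
      (derive1 g y * (w * - sin (w * y + c)) + cos (w * y + c) * derive1 (derive1 g) y).
    exact: (is_deriveM (weight_derive2 y) (dcos y)).
  have := derive_lin w^-1 (w ^+ 2)^-1 h1 h2 x; congr is_derive.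
  by rewrite /r; field.
have cM (u v : R -> R) : continuous u -> continuous v -> continuous (fun x : R => u x * v x).
  by move=> cu cv x; apply: cvgM; [exact: cu|exact: cv].
have cr : continuous r by apply: (cM); [move=> x; exact: cvg_cst|exact: cM].
have cgc : continuous (fun x => g x * cos (w * x + c)) by apply: (cM) => //; exact: weight_continuous.
have cF : continuous (fun x => g x * cos (w * x + c) + r x).
  by move=> x; apply: cvgD; [exact: cgc|exact: cr].
have := torus_FTC dF cF.
rewrite RintegralD//; [|exact: torus_continuous_integrable|exact: torus_continuous_integrable].
have -> : F (2 * pi) = F 0.
  have cp : cis (w * (2 * pi) + c) = cis c by rewrite cisD cis_2pi mul1r.
  have g1 := g_per 0; have g2 := weight_derive_per 0; rewrite add0r in g1 g2.
  by rewrite /F mulr0 add0r g1 g2; have [-> ->] := cp.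
rewrite subrr => /addr0_eq e0; rewrite -normrN e0.
apply: le_trans (le_normr_Rintegral mD1 (torus_continuous_integrable cr)) _.
apply: (@le_trans _ _ (\int[leb1]_(x in D1) (B / w ^+ 2))).
  apply: le_Rintegral => //.
  - by apply: torus_continuous_integrable => x; apply: cvg_norm; exact: cr.
  - by apply: torus_continuous_integrable => x; exact: cvg_cst.
  move=> x Dx; rewrite /r normrM ger0_norm ?invr_ge0 ?sqr_ge0// mulrC.
  rewrite ler_wpM2r ?invr_ge0 ?sqr_ge0// normrM -[B]mulr1.
  by rewrite ler_pM ?cos_max// hB//; exact: subset_itv_co_cc Dx.
rewrite Rintegral_cst// (_ : fine _ = 2 * pi); last by rewrite [X in fine X]torus_measure.
by rewrite mulrAC.
Qed.

(** If [g] vanished on []0, 2 pi[] its integral would be 0; continuity then spreads a positive value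
    to an interval, shrunk to stay inside the fundamental domain. *)
Lemma weight_positive : exists p q ep : R, [/\ p < q, 0 < p, q < 2 * pi, 0 < ep &
  forall x, x \in `[p, q] -> ep <= g x].
Proof.
have [x0 /andP[x00 x02] gx0] : exists2 x, 0 < x < 2 * pi & 0 < g x.
  apply: contrapT => /forallPNP h; have : \int[leb1]_(x in D1) g x = 0; last first.
    by rewrite g_int => /eqP; rewrite oner_eq0.
  have ig := torus_continuous_integrable weight_continuous.
  rewrite /torus -Rintegral_itv_obnd_cbnd; last first.
    by apply: integrableS ig => //; exact: subset_itv_oo_co.
  under eq_Rintegral => x /set_mem; first rewrite /= in_itv /= => xi.
    rewrite (_ : g x = 0); last by apply/eqP; rewrite eq_le g_ge0 andbT leNgt; apply/negP; exact: h.
  by over.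
  by rewrite Rintegral_cst// mul0r.
have /(cvgr_gt (g x0)) := weight_continuous (x := x0).
move=> /(_ _ (midf_lt gx0).2)/nbhs_ballP[d /= d0 hd].
pose r := Num.min (d / 2) (Num.min (x0 / 2) ((2 * pi - x0) / 2)).
have r0 : 0 < r by rewrite !lt_min !divr_gt0 ?subr_gt0.
have r1 : r <= d / 2 by rewrite ge_min lexx.
have r2 : r <= x0 / 2 by rewrite !ge_min lexx /= orbT.
have r3 : r <= (2 * pi - x0) / 2 by rewrite !ge_min lexx !orbT.
exists (x0 - r), (x0 + r), ((0 + g x0) / 2); split; try by lra.
move=> x; rewrite in_itv /= => xi; apply/ltW/hd.
by rewrite /ball /= ltr_norml; lra.
Qed.

Lemma cbounded_continuous (f : R -> R) : continuous f -> cbounded D1 (fun x => (f x)%:C%C).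
Proof.
move=> cf; split.
- by apply: measurable_funTS; exact: continuous_measurable_fun.
- exact: measurable_cst.
have [B B0 hB] := continuous_torus_bounded cf; exists B => x Dx.
by rewrite cabs_real hB//; exact: subset_itv_co_cc Dx.
Qed.

Lemma normsq_sum (r : seq int) (z : int -> R[i]) :
  normsq (\sum_(k <- r) z k) = \sum_(k <- r) \sum_(j <- r) Re (z j * (z k)^*%C).
Proof.
transitivity (Re ((\sum_(j <- r) z j) * (\sum_(k <- r) z k)^*%C)); first by rewrite mulcJ.
rewrite rmorph_sum mulr_sumr Re_sum; apply: eq_bigr => k _.
by rewrite mulr_suml Re_sum.
Qed.

Lemma gram_form_integral (rho : R -> R) (p : int -> R -> R[i]) r b :
  cbounded D1 (fun x => (rho x)%:C%C) -> (forall k, cbounded D1 (p k)) ->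
  gram_form (fun k j => cintegral leb1 D1 (fun x => (rho x)%:C%C * (p j x * (p k x)^*%C))) r b =
  \int[leb1]_(x in D1) (rho x * normsq (\sum_(k <- r) b k * p k x)).
Proof.
move=> hrho hp.
have ci k j : cintble leb1 D1 (fun x => (rho x)%:C%C * (p j x * (p k x)^*%C)).
  apply: (cbounded_cintble mD1 fD1); apply: cboundedM => //; apply: cboundedM => //.
  exact: cboundedJ.
transitivity (Re (cintegral leb1 D1 (fun x => \sum_(k <- r) \sum_(j <- r)
    (b j * (b k)^*%C) * ((rho x)%:C%C * (p j x * (p k x)^*%C))))); last first.
  apply: eq_Rintegral => x _; rewrite normsq_sum mulr_sumr Re_sum; apply: eq_bigr => k _.
  rewrite mulr_sumr Re_sum; apply: eq_bigr => j _.
  rewrite (_ : _ * _ = (rho x)%:C%C * (b j * p j x * (b k * p k x)^*%C)).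
    by rewrite [in LHS]ReM /= mul0r subr0.
  by rewrite rmorphM /=; ring.
rewrite cintegral_sum//; last by move=> k; apply: cintble_sum => // j; exact: cintbleZ.
rewrite Re_sum; apply: eq_bigr => k _.
rewrite cintegral_sum//; last by move=> j; exact: cintbleZ.
rewrite Re_sum; apply: eq_bigr => j _.
by rewrite cintegralZ// mulrC.
Qed.

Local Notation wc := (weight_coef g).
Local Notation wg := (weight_gram g).

Let cbg : cbounded D1 (fun x => (g x)%:C%C).
Proof. exact: cbounded_continuous weight_continuous. Qed.

Let icis (n : int) : cintble leb1 D1 (fun x => (g x)%:C%C * cis (n%:~R * x)).
Proof. by apply: (cbounded_cintble mD1 fD1); apply: cboundedM => //; exact: cbounded_cis. Qed.

Let ig : cintble leb1 D1 (fun x => (g x)%:C%C).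
Proof. exact: (cbounded_cintble mD1 fD1). Qed.

Lemma weight_coef0 : wc 0 = 1.
Proof.
rewrite -(cintegral_weight g_int); apply: eq_cintegral => x _.
by rewrite mul0r cis0 mulr1.
Qed.

Lemma weight_coefN n : wc (- n) = (wc n)^*%C.
Proof.
rewrite /weight_coef -cintegral_conj//; apply: eq_cintegral => x _.
by rewrite rmorphN mulNr cisN; apply: complexP; rewrite !cE /=; ring.
Qed.

Lemma weight_coef_decay : exists2 C, 0 <= C & forall n, n != 0 ->
  cabs (wc n) <= C / `|n|%N%:R ^+ 2.
Proof.
have [C C0 hC] := weight_cos_decay; exists (2 * C); first by rewrite mulr_ge0.
move=> n n0; have -> : `|n|%N%:R ^+ 2 = n%:~R ^+ 2 :> R.
  by rewrite absz_intr real_normK ?num_real.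
apply: le_trans (cabs_le _) _; rewrite -mulrA mulr_natl mulr2n; apply: lerD.
  rewrite /= (_ : Rintegral _ _ _ = \int[leb1]_(x in D1) (g x * cos (n%:~R * x + 0))).
    exact: hC.
  by apply: eq_Rintegral => x _; rewrite addr0 mul0r subr0.
rewrite /= (_ : Rintegral _ _ _ = \int[leb1]_(x in D1) (g x * cos (n%:~R * x + - (pi / 2)))).
  exact: hC.
by apply: eq_Rintegral => x _; rewrite cosBpihalf mul0r addr0.
Qed.

(** The entries are covariances of exponentials under the probability [g dx], which is why the form
    is nonnegative. *)
Lemma weight_gramE k j : wg k j = cintegral leb1 D1 (fun x =>
  (g x)%:C%C * ((cis (j%:~R * x) - wc j) * (cis (k%:~R * x) - wc k)^*%C)).
Proof.
rewrite (@eq_cintegral _ _ _ leb1 D1 _ (fun x =>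
  ((g x)%:C%C * cis ((j - k)%:~R * x) - (wc k)^*%C * ((g x)%:C%C * cis (j%:~R * x))) -
  (wc j * ((g x)%:C%C * cis ((- k)%:~R * x)) - (wc j * (wc k)^*%C) * (g x)%:C%C))); last first.
  move=> x _; have -> : cis ((j - k)%:~R * x) = cis (j%:~R * x) * (cis (k%:~R * x))^*%C.
    by rewrite rmorphB mulrBl cisD cisN.
  by rewrite rmorphN mulNr cisN conjB; ring.
have i1 n := @cintbleZ _ _ _ _ _ mD1 (wc n) _ (icis (- k)).
have i2 := @cintbleZ _ _ _ _ _ mD1 ((wc k)^*%C) _ (icis j).
have i3 := @cintbleZ _ _ _ _ _ mD1 (wc j * (wc k)^*%C) _ ig.
rewrite cintegralB//; [|exact: cintbleB|exact: cintbleB].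
rewrite !cintegralB// !cintegralZ// -![cintegral _ _ _]/(weight_coef _ _).
by rewrite cintegral_weight// weight_coefN /weight_gram weight_coefN mulr1 subrr subr0 [wc j * _]mulrC.
Qed.

Lemma weight_gram_form r b : gram_form wg r b =
  \int[leb1]_(x in D1) (g x * normsq (\sum_(k <- r) b k * (cis (k%:~R * x) - wc k))).
Proof.
rewrite -(gram_form_integral (p := fun k x => cis (k%:~R * x) - wc k))//.
  apply: eq_bigr => k _; apply: eq_bigr => j _; congr (Re (_ * _)).
  exact: weight_gramE.
move=> k; have := cboundedD (cbounded_cis k%:~R) (cbounded_cst D1 (- wc k)); exact.
Qed.

Lemma weight_gram_ge0 r b : 0 <= gram_form wg r b.
Proof.
by rewrite weight_gram_form; apply: Rintegral_ge0 => x _; rewrite mulr_ge0// normsq_ge0.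
Qed.

(** Dropping the means increases the form, [g] is bounded by [B], and the remaining integral is
    evaluated by orthogonality of the exponentials on the circle. *)
Lemma weight_gram_upper : exists2 C, 0 <= C & forall r b, uniq r ->
  gram_form wg r b <= C * \sum_(k <- r) normsq (b k).
Proof.
have [B B0 hB] := weight_bounded; exists (B * (2 * pi)).
  by rewrite mulr_ge0// ltW// twopi_gt0.
move=> r b ur; have cc k := @cbounded_cis R k%:~R.
have eM (rho : R -> R) : (forall k j, cintegral leb1 D1 (fun x => (rho x)%:C%C *
    (cis (j%:~R * x) * (cis (k%:~R * x))^*%C)) =
    cintegral leb1 D1 (fun x => (rho x)%:C%C * cis ((j - k)%:~R * x))).
  by move=> k j; apply: eq_cintegral => x _; rewrite rmorphB mulrBl cisD cisN.
have h1 : gram_form wg r b <= gram_form (fun k j => wc (j - k)) r b.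
  rewrite -subr_ge0; have := normsq_ge0 (\sum_(k <- r) b k * wc k).
  rewrite normsq_sum /gram_form -sumrB; congr (_ <= _); apply: eq_bigr => k _.
  rewrite -sumrB; apply: eq_bigr => j _.
  rewrite -ReN -ReD; congr (Re _).
  by rewrite conjM /weight_gram weight_coefN; ring.
apply: le_trans h1 _.
have -> : gram_form (fun k j => wc (j - k)) r b =
    \int[leb1]_(x in D1) (g x * normsq (\sum_(k <- r) b k * cis (k%:~R * x))).
  rewrite -(gram_form_integral (p := fun k x => cis (k%:~R * x)))//.
  by apply: eq_bigr => k _; apply: eq_bigr => j _; rewrite eM.
have cB : cbounded D1 (fun=> (B%:C%C : R[i])) by exact: cbounded_cst.
have -> : B * (2 * pi) * \sum_(k <- r) normsq (b k) =
    \int[leb1]_(x in D1) (B * normsq (\sum_(k <- r) b k * cis (k%:~R * x))).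
  rewrite -(gram_form_integral (rho := fun=> B) (p := fun k x => cis (k%:~R * x)))//.
  rewrite /gram_form mulr_sumr; apply: eq_big_seq => k kr.
  rewrite (big_rem k)//= big1_seq ?addr0 => [|j /andP[_ jr]].
    rewrite eM subrr cintegralZ//; last first.
      by apply: (cbounded_cintble mD1 fD1); exact: (cc 0).
    by rewrite cintegral_cis eqxx mulcJ -!rmorphM.
  rewrite eM cintegralZ//; last first.
    by apply: (cbounded_cintble mD1 fD1); exact: (cc (j - k)).
  rewrite cintegral_cis subr_eq0; move: jr; rewrite mem_rem_uniq// inE => /andP[/negbTE -> _].
  by rewrite mulr0 mul0r.
have ib (rho : R -> R) : cbounded D1 (fun x => (rho x)%:C%C) ->
    leb1.-integrable D1 (EFin \o (fun x => rho x * normsq (\sum_(k <- r) b k * cis (k%:~R * x)))).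
  move=> hrho; pose S x := \sum_(k <- r) b k * cis (k%:~R * x).
  have cS : cbounded D1 S.
    rewrite /S; elim: (r) => [|k r' IH].
      by under eq_fun do rewrite big_nil; exact: cbounded_cst.
    under eq_fun do rewrite big_cons.
    by apply: cboundedD => //; apply: cboundedM => //; exact: cbounded_cst.
  have [] := cbounded_cintble mD1 fD1 (cboundedM hrho (cboundedM cS (cboundedJ cS))).
  move=> + _; congr integrable; apply/funext => x /=.
  by rewrite mulcJ !cE /= mul0r subr0.
apply: le_Rintegral => //; [exact: ib|exact: ib|].
by move=> x Dx; rewrite ler_wpM2r ?normsq_ge0// hB.
Qed.

(** On the interval where [g >= ep], the integrand is the squared modulus of a sum of three
    exponentials whose constant term absorbs the means. [trig_coercive] bounds either coefficient,
    and averaging the two bounds costs the factor 2. *)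
Lemma weight_gram_pair : exists2 c, 0 < c & forall k j b, k != 0 -> j != 0 -> k != j ->
  c * (normsq (b k) + normsq (b j)) <= gram_form wg [:: k; j] b.
Proof.
have [p [q [ep [pq p0 q2 ep0 hep]]]] := weight_positive.
have [c c0 hc] := trig_coercive pq.
exists (ep * c / 2); first by rewrite divr_gt0// mulr_gt0.
move=> k j b k0 j0 kj; rewrite weight_gram_form.
pose a0 := - (b k * wc k + b j * wc j); pose f := trig a0 (b k) (b j) k j.
have fE x : \sum_(i <- [:: k; j]) b i * (cis (i%:~R * x) - wc i) = f x.
  by rewrite !big_cons big_nil /f /trig /a0; ring.
under eq_Rintegral do rewrite fE.
have [F dF] := trig_primitive a0 (b k) (b j) k j.
have h1 : c * normsq (b k) <= F q - F p by apply: (hc a0 _ (b j) k j).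
have h2 : c * normsq (b j) <= F q - F p.
  apply: (hc a0 _ (b k) j k) => //; first by rewrite eq_sym.
  by move=> x; have := dF x; congr is_derive; congr normsq; rewrite /trig addrAC.
apply: (@le_trans _ _ (ep * (F q - F p))).
  rewrite -!mulrA ler_pM2l//; lra.
have lin (u v : R -> R) : continuous u -> continuous v ->
    forall s t : R, continuous (fun x => s * u x + t * v x).
  move=> cu cv s t x.
  have u1 : s * u y @[y --> x] --> s * u x by apply: cvgM; [exact: cvg_cst|exact: cu].
  have v1 : t * v y @[y --> x] --> t * v x by apply: cvgM; [exact: cvg_cst|exact: cv].
  exact: cvgD u1 v1.
have ceq (u v : R -> R) : continuous u -> u =1 v -> continuous v by move=> cu /funext <-.
have cR (z w : R[i]) : continuous (fun x : R => Re (z * cis (k%:~R * x) + w * cis (j%:~R * x))).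
  have h n (y : R[i]) := lin _ _ (@continuous_cosM R n%:~R) (@continuous_sinM R n%:~R) (Re y) (- Im y).
  by apply: (ceq _ _ (lin _ _ (h k z) (h j w) 1 1)) => x; rewrite !cE /=; ring.
have cF1 (z w v : R[i]) : continuous (fun x : R => Re (v + z * cis (k%:~R * x) + w * cis (j%:~R * x))).
  have c1 : continuous (fun _ : R => 1 : R) by move=> x; exact: cvg_cst.
  by apply: (ceq _ _ (lin _ _ (cR z w) c1 1 (Re v))) => x; rewrite !ReD; ring.
have cM (u v : R -> R) : continuous u -> continuous v -> continuous (fun x : R => u x * v x).
  by move=> cu cv x; apply: cvgM; [exact: cu|exact: cv].
have cf : continuous (fun x : R => normsq (f x)).
  have h1' := cF1 (b k) (b j) a0.
  have h2' := cF1 (- 'i%C * b k) (- 'i%C * b j) (- 'i%C * a0).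
  apply: (ceq _ _ (lin _ _ (cM _ _ h1' h1') (cM _ _ h2' h2') 1 1)) => x.
  by rewrite /normsq /f /trig !cE /=; ring.
rewrite -(Rintegral_FTC pq dF cf).
have sub : `[p, q] `<=` D1.
  by move=> x; rewrite /torus /= !in_itv /= => /andP[px xq]; apply/andP; split; lra.
have igf := torus_continuous_integrable (cM _ _ weight_continuous cf).
have iff := torus_continuous_integrable cf.
have mpq : @measurable _ (measurableTypeR R) `[p, q] by exact: measurable_itv.
have ipq := integrableS mD1 mpq sub iff.
rewrite -RintegralZl//; apply: (@le_trans _ _ (\int[leb1]_(x in `[p, q]) (g x * normsq (f x)))).
  apply: le_Rintegral => //.
  - by have := integrableZl mpq ep ipq.
  - exact: integrableS igf.
  - by move=> x Dx; rewrite ler_wpM2r ?normsq_ge0// hep.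
rewrite -lee_fin !fineK ?integrable_fin_num//; last exact: integrableS igf.
apply: ge0_subset_integral => //; first exact: measurable_int igf.
by move=> x _; rewrite lee_fin mulr_ge0 ?normsq_ge0.
Qed.

Theorem weight_observability T : 0 < T -> observable wg predT T.
Proof.
have [Cd Cd0 hd] := weight_coef_decay; have [Cu Cu0 hu] := weight_gram_upper.
have [cp cp0 hp] := weight_gram_pair.
pose K := 1 + Cd; have K0 : 0 <= K by rewrite addr_ge0.
have hK n : cabs (wc n) <= K.
  have [->|n0] := eqVneq n 0; first by rewrite weight_coef0 (cabs_real 1) normr1 lerDl.
  apply: le_trans (hd n n0) _; apply: (@le_trans _ _ Cd); last by rewrite lerDr.
  rewrite ler_pdivrMr ?exprn_gt0 ?ltr0n ?absz_gt0// ler_peMr//.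
  by rewrite exprn_ege1// ler1n absz_gt0.
have hM k j : cabs (wg k j) <= cabs (wc (j - k)) + cabs (wc j) * cabs (wc k).
  by apply: le_trans (cabsD _ _) _; rewrite cabsN cabsM weight_coefN cabsJ.
pose C := Cu + (K + K * K + Cd * (1 + K)).
have KK : 0 <= K * K by rewrite mulr_ge0.
have CK : 0 <= Cd * (1 + K) by rewrite mulr_ge0// addr_ge0.
have C0 : 0 <= C by rewrite /C; lra.
(* From this rank on [|c k| <= Cd / |k| <= 1 / 2], so the diagonal entry [1 - |c k| ^ 2] is at least
   3/4. *)
pose N1 := (Num.trunc (2 * Cd)).+1.
apply: (@observability R wg C (1 / 2) cp N1) => //.
- exact: weight_gram_ge0.
- move=> r b ur; apply: le_trans (hu r b ur) _; rewrite ler_wpM2r//.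
    by apply: sumr_ge0 => k _; exact: normsq_ge0.
  by rewrite /C; lra.
- move=> k j; apply: le_trans (hM k j) _; have := hK (j - k).
  have : cabs (wc j) * cabs (wc k) <= K * K by rewrite ler_pM ?cabs_ge0.
  by rewrite /C; lra.
(* For opposite signs [|j - k| = |j| + |k|], so both terms of the entry have a Fourier coefficient
   of index at least the maximum. *)
- move=> k j kj; have kjE : (maxn `|k| `|j| <= `|j - k|)%N by nia.
  have k0 : k != 0 by apply: contraTneq kj => ->; rewrite mul0r.
  have j0 : j != 0 by apply: contraTneq kj => ->; rewrite mulr0.
  have jk0 : j - k != 0.
    apply: contraTneq kj => /eqP; rewrite subr_eq0 => /eqP ->.
    by rewrite -leNgt -expr2 sqr_ge0.
  set m := maxn `|k| `|j| in kjE *.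
  have m0 : 0 < m%:R ^+ 2 :> R by rewrite exprn_gt0// ltr0n /m leq_max absz_gt0 k0.
  have dm n : n != 0 -> (m <= `|n|)%N -> cabs (wc n) <= Cd / m%:R ^+ 2.
    move=> n0 mn; apply: le_trans (hd n n0) _; rewrite ler_wpM2l// lef_pV2 ?posrE//.
      by rewrite lerXn2r ?nnegrE ?ler_nat.
    by rewrite exprn_gt0// ltr0n absz_gt0.
  have h2 : cabs (wc j) * cabs (wc k) <= Cd / m%:R ^+ 2 * K.
    have [kj'|kj'] := leqP `|k| `|j|; last rewrite mulrC.
      by rewrite ler_pM ?cabs_ge0// dm// /m (maxn_idPr kj').
    by rewrite ler_pM ?cabs_ge0// dm// /m (maxn_idPl (ltnW kj')).
  apply: le_trans (hM k j) _; apply: le_trans (lerD (dm _ jk0 kjE) h2) _.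
  rewrite -[X in X + _]mulr1 -mulrDr mulrAC ler_wpM2r ?invr_ge0 ?(ltW m0)//.
  by rewrite /C; lra.
- move=> k Nk; have k0 : k != 0 by rewrite -absz_gt0; exact: leq_trans Nk.
  have h : cabs (wc k) <= 1 / 2.
    apply: le_trans (hd k k0) _; have kn : 0 < `|k|%N%:R :> R by rewrite ltr0n absz_gt0.
    rewrite ler_pdivrMr ?exprn_gt0//.
    have : 2 * Cd < `|k|%N%:R.
      apply: lt_le_trans (_ : N1%:R <= _); last by rewrite ler_nat.
      exact: truncnS_gt.
    have : `|k|%N%:R <= `|k|%N%:R ^+ 2 :> R by rewrite ler_eXnr// ler1n absz_gt0.
    by lra.
  have -> : Re (wg k k) = 1 - normsq (wc k).
    by rewrite /weight_gram subrr weight_coef0 weight_coefN mulcJ !cE.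
  by rewrite -cabs_sq; have := cabs_ge0 (wc k); nra.
Qed.

End WeightCoef.

(** * Coercivity of the Gramian of the KP flow *)

Lemma sum_fibers (V : nmodType) (I : eqType) (J : eqType) (s : seq I) (p : I -> J) (F : I -> V) :
  \sum_(i <- s) F i = \sum_(l <- undup (map p s)) \sum_(i <- s | p i == l) F i.
Proof.
rewrite (exchange_big_dep predT)//= [RHS]big_seq [LHS]big_seq; apply: eq_bigr => i si.
have pi_in : p i \in undup (map p s) by rewrite mem_undup map_f.
rewrite (big_rem (p i) pi_in) /= eqxx big1_seq ?addr0// => l /andP[/eqP <-].
by rewrite mem_rem_uniq ?undup_uniq// inE eqxx.
Qed.

Section KPEvolution.
Variable R : realType.
Local Notation leb1 := (@lebesgue_measure R).
Local Notation E := (torus_l2 R).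
Local Notation H := (torus_hilbert R).
Local Notation e := (torus_basis R).

Definition kp_om (i : int * int) : R := kpfreq R i.2 i.1.

(** The group on the whole of L^2. As the inverse of 0 is 0, the modes with [k = 0] get frequency 0
    and are fixed. *)
Definition kp_flow (t : R) (x : E) : E :=
  xget 0 [set z | forall i, coef e z i = cis (t * kp_om i) * coef e x i].

Lemma coef_kp_flow t x i : coef e (kp_flow t x) i = cis (t * kp_om i) * coef e x i.
Proof.
move: i; rewrite -[forall i, _]/([set z | forall i, coef e z i = cis (t * kp_om i) * coef e x i] _).
apply: xgetPex; have [|y hy] := @multiplier_exists R E H _ e (fun i => cis (t * kp_om i)) x.
  by move=> i; rewrite normsq_cis.
by exists y.
Qed.

Lemma Rintegral_FTC_oo (f F : R -> R) (a b : R) : a < b ->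
  (forall x : R, is_derive x 1 F (f x)) -> continuous f ->
  \int[leb1]_(x in `]a, b[) f x = F b - F a.
Proof.
move=> ab dF cf; rewrite -(Rintegral_FTC ab dF cf).
have i1 := continuous_integrable_cc a b cf.
rewrite Rintegral_itv_obnd_cbnd; last by apply: integrableS i1 => //; exact: subset_itv_oo_cc.
by rewrite Rintegral_itv_bndo_bndc//; apply: integrableS i1 => //; exact: subset_itv_co_cc.
Qed.

Lemma continuous_gram_flow (M : int -> int -> R[i]) w r b :
  continuous (fun t => gram_form M r (flow w b t)).
Proof.
have dz (z : R[i]) (v x : R) :
    is_derive x 1 (fun t => Re (z * cis (v * t))) (Re (z * ('i%C * v%:C%C) * cis (v * x))).
  have := derive_lin (Re z) (- Im z) (derive_scaled v (@is_derive_cos R))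
     (derive_scaled v (@is_derive_sin R)) x.
  rewrite (_ : (fun t => _) = (fun t => Re (z * cis (v * t)))); last first.
    by apply/funext => t; rewrite !cE /=; ring.
  by congr is_derive; rewrite !cE /=; ring.
have -> : (fun t => gram_form M r (flow w b t)) = (fun t => \sum_(k <- r) \sum_(j <- r)
    Re (M k j * (b j * (b k)^*%C) * cis ((w j - w k) * t))).
  apply/funext => t; apply: eq_bigr => k _; apply: eq_bigr => j _; congr complex.Re.
  by rewrite /flow conjM -cisN mulrBl cisD; ring.
have d1 k (x : R) := @derive_bigsum R _ r (fun j t =>
  Re (M k j * (b j * (b k)^*%C) * cis ((w j - w k) * t))) _
  (fun j y => dz (M k j * (b j * (b k)^*%C)) (w j - w k) y) x.
exact: derive_continuous (derive_bigsum r d1).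
Qed.

Variables (g : R -> R) (B : R).
Hypothesis g_cont : continuous g.
Hypothesis g_ge0 : forall x, 0 <= g x.
Hypothesis g_le : forall x, @torus R x -> g x <= B.
Hypothesis g_int : \int[leb1]_(x in @torus R) g x = 1.
Local Notation G := (control g_cont g_ge0 g_le g_int).
Local Notation wg := (weight_gram g).
Let HG := control_selfadjoint g_cont g_ge0 g_le g_int.
Let BG := control_bound g_cont g_ge0 g_le g_int.

Let fiber (s : seq (int * int)) (l : int) : seq int := [seq i.1 | i <- s & i.2 == l].

Let sum_fiber (V : nmodType) s (F : int * int -> V) :
  \sum_(i <- s) F i = \sum_(l <- undup (map snd s)) \sum_(k <- fiber s l) F (k, l).
Proof.
rewrite (sum_fibers _ snd); apply: eq_bigr => l _; rewrite big_map big_filter.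
by apply: eq_bigr => -[k l'] /= /eqP ->.
Qed.

(** The form is block diagonal in the mode [l]: each block is the Gram form over the [x]-frequencies
    occurring with that [l]. *)
Lemma Re_ip_control_comb (s : seq (int * int)) c : Re (hip H (G (comb e s c)) (comb e s c)) =
  (2 * pi)^-1 * \sum_(l <- undup (map snd s)) gram_form wg (fiber s l) (fun k => c (k, l)).
Proof.
rewrite ip_comb Re_sum sum_fiber mulr_sumr; apply: eq_bigr => l _.
rewrite mulr_sumr; apply: eq_bigr => k _.
rewrite (coefG_comb e HG) mulr_sumr Re_sum.
rewrite (eq_bigr (fun j : int * int => if j.2 == l then
    (2 * pi)^-1 * Re (wg k j.1 * (c j * (c (k, l))^*%C)) else 0)); last first.
  move=> j _; rewrite coef_control_mode /=; case: ifP => _; last by rewrite !mulr0.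
  by rewrite !cE /=; ring.
rewrite -big_mkcond big_map big_filter mulr_sumr /=.
by apply: eq_bigr => -[j l'] /= /eqP ->.
Qed.

(** Observability is summed over the finitely many [l] that occur; this is where a constant
    independent of [l] is required. *)
Lemma kp_coercive T c0 : 0 < T -> 
  (forall l r b, uniq r -> {in r, forall k, k != 0} ->
    c0 * \sum_(k <- r) normsq (b k) <= gram_energy wg (kpfreq R l) r b T) ->
  forall s c, uniq s -> {in s, forall i, i.1 != 0} ->
  (2 * pi)^-1 * c0 * \sum_(i <- s) normsq (c i) <=
  Re (tint 0 T (fun t => hip H (G (kp_flow t (comb e s c))) (kp_flow t (comb e s c)))).
Proof.
move=> T0 hobs s c us hs.
have -> : Re (tint 0 T (fun t => hip H (G (kp_flow t (comb e s c))) (kp_flow t (comb e s c)))) =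
   \int[leb1]_(t in `]0, T[) ((2 * pi)^-1 * \sum_(l <- undup (map snd s))
     gram_form wg (fiber s l) (flow (kpfreq R l) (fun k => c (k, l)) t)).
  apply: eq_Rintegral => t _.
  set p := comb e s (fun i => c i * cis (kp_om i * t)).
  have pE : nrm H (kp_flow t (comb e s c) - p) = 0.
    apply: (eq_coef (e := e)) => i; rewrite coef_kp_flow !coef_comb//.
    by case: ifP => _; rewrite ?mulr0// mulrC [t * _]mulrC.
  rewrite (ip_eqvr _ pE) HG (ip_eqvl _ pE) -HG Re_ip_control_comb; congr (_ * _).
have dF (x : R) : is_derive x 1 (fun t => (2 * pi)^-1 * \sum_(l <- undup (map snd s))
     gram_energy wg (kpfreq R l) (fiber s l) (fun k => c (k, l)) t)
   ((2 * pi)^-1 * \sum_(l <- undup (map snd s))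
     gram_form wg (fiber s l) (flow (kpfreq R l) (fun k => c (k, l)) x)).
  have h (l : int) (y : R) := derive_gram_energy wg (kpfreq R l) (fiber s l) (fun k => c (k, l)) y.
  have := derive_lin (2 * pi)^-1 0 (derive_bigsum (undup (map snd s)) h)
    (fun y => is_derive_cst (0 : R) y 1) x.
  rewrite (_ : (fun t => _) = (fun t => (2 * pi)^-1 * \sum_(l <- undup (map snd s))
     gram_energy wg (kpfreq R l) (fiber s l) (fun k => c (k, l)) t)).
    by congr is_derive; rewrite mul0r addr0.
  by apply/funext => t; rewrite mul0r addr0.
have cf : continuous (fun t : R => (2 * pi)^-1 * \sum_(l <- undup (map snd s))
     gram_form wg (fiber s l) (flow (kpfreq R l) (fun k => c (k, l)) t)).
  move=> x; apply: cvgM; first exact: cvg_cst.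
  elim: (undup _) => [|l L IH].
    by under eq_fun do rewrite big_nil; rewrite big_nil; exact: cvg_cst.
  under eq_fun do rewrite big_cons.
  by rewrite big_cons; apply: cvgD IH; exact: continuous_gram_flow.
rewrite (Rintegral_FTC_oo T0 dF cf).
rewrite [X in _ - _ * X]big1 ?mulr0 ?subr0; last by move=> l _; rewrite gram_energy0.
rewrite -mulrA ler_wpM2l ?invr_ge0 ?(ltW (twopi_gt0 R))// sum_fiber mulr_sumr.
apply: ler_sum => l _; apply: hobs.
  rewrite map_inj_in_uniq ?filter_uniq// => -[k j] [k' j'].
  by rewrite !mem_filter /= => /andP[/eqP -> _] /andP[/eqP -> _] ->.
by move=> _ /mapP[i + ->]; rewrite mem_filter => /andP[_ /hs].
Qed.

Definition zero_mean (x : E) : Prop := forall l, coef e x (0, l) = 0.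

Theorem kp_gramian_surjective T d : 0 < T -> observable wg predT T -> zero_mean d ->
  exists2 x, zero_mean x & nrm H (duhamel e kp_flow G x T - d) = 0.
Proof.
move=> T0 [c0 c00 hobs] hd; have tp := twopi_gt0 R.
have B0 : 0 <= B by apply: le_trans (g_ge0 0) (g_le _); rewrite /torus /= in_itv /= lexx mulr_gt0// pi_gt0.
have hobs' l r b : uniq r -> {in r, forall k, k != 0} ->
    c0 * \sum_(k <- r) normsq (b k) <= gram_energy wg (kpfreq R l) r b T.
  by move=> ur hr; apply: hobs => // k kr; rewrite hr.
pose J (i : int * int) := i.1 != 0.
have kap0 : 0 < (2 * pi)^-1 * c0 by rewrite mulr_gt0 ?invr_gt0.
have GJ x (i : int * int) : ~~ J i -> coef e (G x) i = 0.
  by case: i => k l; rewrite negbK => /eqP /= ->; exact: coef_control0.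
have hdJ : supported e J d.
  by case=> k l; rewrite negbK => /eqP /= ->; exact: hd.
have [x [xJ hx]] := gramian_surjective coef_kp_flow HG B0 BG T0 kap0 GJ (kp_coercive T0 hobs') hdJ.
exists x; last exact: hx.
by move=> l; apply: (xJ (0, l)); rewrite /J eqxx.
Qed.

End KPEvolution.

(** * Bochner integrals *)

(** The integral of a nonnegative function is a supremum over simple functions below it, hence
    monotone without measurability, which is not known for the distances inside a Bochner
    integral. *)
Lemma ge0_integral_mono d (T : measurableType d) (R : realType)
    (mu : {measure set T -> \bar R}) (D : set T) (f h : T -> \bar R) :
  (forall x, D x -> 0 <= f x)%E -> (forall x, D x -> f x <= h x)%E ->
  (\int[mu]_(x in D) f x <= \int[mu]_(x in D) h x)%E.
Proof.
move=> f0 fh; have h0 x : D x -> (0 <= h x)%E by move=> Dx; exact: le_trans (f0 x Dx) (fh x Dx).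
rewrite !ge0_integralE//; apply: ereal_sup_le => _ [k /= hk <-]; exists k => // x.
apply: le_trans (hk x) _; rewrite !patchE; case: ifPn => // /set_mem; exact: fh.
Qed.

Lemma ecvg0P (R : realType) (I : Type) (F : set_system I) (FF : Filter F) (f : I -> \bar R) :
  (forall i, 0 <= f i)%E ->
  (f i @[i --> F] --> 0%E) <-> (forall eps, 0 < eps -> \forall i \near F, (f i <= eps%:E)%E).
Proof.
move=> f0; split=> [/fine_cvgP[ffin /cvgrPdist_le fc] eps e0|h].
  apply: filterS2 ffin (fc eps e0) => i fi; rewrite sub0r normrN -lee_fin /= => hi.
  by rewrite -[f i]fineK//; apply: le_trans hi; rewrite lee_fin ler_norm.
have fin : \forall i \near F, f i \is a fin_num.
  by apply: filterS (h 1 ltr01) => i hi; rewrite ge0_fin_numE// (le_lt_trans hi)// ltry.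
apply/fine_cvgP; split=> //; apply/cvgrPdist_le => eps e0.
apply: filterS2 fin (h eps e0) => i fi hi; rewrite sub0r normrN /=.
by rewrite ger0_norm ?fine_ge0// -lee_fin fineK.
Qed.

Section Bochner.
Variable R : realType.
Local Notation leb1 := (@lebesgue_measure R).
Local Notation E := (torus_l2 R).
Local Notation H := (torus_hilbert R).
Local Notation e := (torus_basis R).

Lemma itv_finite (t : R) : (leb1 (`]0%R, t[%classic : set (measurableTypeR R)) < +oo)%E.
Proof. by rewrite lebesgue_measure_itv /=; case: ifP => _; rewrite ?ltry. Qed.

Lemma l2val_sum n (c : 'I_n -> R[i]) (v : 'I_n -> E) :
  (fun z => \sum_(i < n) c i * v i z) = \sum_(i < n) c i *: v i.
Proof. by apply/funext => z; rewrite l2_sumE. Qed.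

Lemma of_L2E (x : E) (h : L2 x) : of_L2 h = x.
Proof. exact: val_inj. Qed.

Definition simple_value (s : L2simple R) i : E := of_L2 (@L2_value R s i).

Definition simple_l2 (s : L2simple R) (t : R) : E :=
  \sum_(i < ncell s) (\1_(cell i) t)%:C%C *: simple_value i.

Definition simple_integral_l2 D (s : L2simple R) : E :=
  \sum_(i < ncell s) (fine (leb1 (cell i `&` D)))%:C%C *: simple_value i.

Lemma simple_funE s t : simple_fun s t = simple_l2 s t.
Proof. exact: (l2val_sum (fun i => (\1_(cell i) t)%:C%C) (@simple_value s)). Qed.

Lemma simple_integralE D s : simple_integral D s = simple_integral_l2 D s.
Proof.
exact: (l2val_sum (fun i => (fine (leb1 (cell i `&` D)))%:C%C) (@simple_value s)).
Qed.

Lemma coef_simple_integral t s i :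
  tintble 0 t (fun r => coef e (simple_l2 s r) i) /\
  coef e (simple_integral_l2 `]0, t[%classic s) i = tint 0 t (fun r => coef e (simple_l2 s r) i).
Proof.
have mD : @measurable _ (measurableTypeR R) `]0, t[%classic by exact: measurable_itv.
have Dfin := itv_finite t.
pose F (j : 'I_(ncell s)) r : R[i] := coef e (simple_value j) i * (\1_(cell j) r)%:C%C.
have cF (j : 'I_(ncell s)) : tintble 0 t (fun r => (\1_(cell j) r)%:C%C).
  apply: (cbounded_cintble mD Dfin); split.
  - by apply: measurable_funTS; apply: measurable_indic; exact: measurable_cell.
  - exact: measurable_cst.
  by exists 1 => r _; rewrite cabs_real indicE; case: (_ \in _); rewrite ?normr1 ?normr0.
have iF (j : 'I_(ncell s)) : tintble 0 t (F j) by exact: cintbleZ.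
have eF : (fun r => coef e (simple_l2 s r) i) = (fun r => \sum_(j < ncell s) F j r).
  by apply/funext => r; rewrite coef_sum; apply: eq_bigr => j _; rewrite coefZ mulrC.
rewrite eF; split; first exact: cintble_sum.
rewrite cintegral_sum// coef_sum; apply: eq_bigr => j _; rewrite coefZ mulrC cintegralZ//.
congr (_ * _); apply: complexP => /=; last by rewrite Rintegral_cst// mul0r.
by rewrite /Rintegral integral_indic//; exact: measurable_cell.
Qed.

(** Whatever the approximating simple functions, a Bochner integral has the coefficients of the weak
    integral. This determines the end state of an arbitrary mild solution. *)
Lemma bochner_coef (Phi : R -> E) t w (hw : L2 w) : 0 <= t -> ucont H Phi ->
  is_bochner_integral `]0, t[%classic (fun r => Phi r) w ->
  forall i, coef e (of_L2 hw) i = tint 0 t (fun r => coef e (Phi r) i).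
Proof.
move=> t0 uP [_ _ [s [_ s1 s2]]] i.
have mD : @measurable _ (measurableTypeR R) `]0, t[%classic by exact: measurable_itv.
have iP := ucont_tintble e i 0 t uP.
apply/eqP; rewrite -subr_eq0; apply/eqP/normsq_eq0; rewrite -cabs_sq.
rewrite [cabs _](_ : _ = 0) ?expr0n//; apply/eqP; rewrite eq_le cabs_ge0 andbT.
apply/ler_addgt0Pr => eps e0; rewrite add0r.
have e3 : 0 < eps / 3 by rewrite divr_gt0.
have d0 v : (0 <= L2norm v :> \bar R)%E by exact: Lnorm_ge0.
move/ecvg0P : s1 => /(_ (fun n => integral_ge0 _ (fun r _ => d0 _)) _ e3) s1.
move/ecvg0P : s2 => /(_ (fun n => d0 _) _ e3) s2.
have [n [h1 h2]] := filter_ex (filterI s1 s2).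
have [iS cS] := coef_simple_integral t (s n) i.
set S := simple_integral_l2 _ _ in cS.
have k1 : cabs (coef e (of_L2 hw) i - coef e S i) <= eps / 3.
  rewrite -coefB; apply: le_trans (cabs_coef e _ i) _; rewrite nrmBC.
  by rewrite -lee_fin -L2dist_nrm -simple_integralE.
pose psi r := coef e (Phi r) i - coef e (simple_l2 (s n) r) i.
have [pR pI] := cintbleB mD iP iS.
have kpsi (p : R[i] -> R) : (forall z, `|p z| <= cabs z) ->
    leb1.-integrable (`]0, t[%classic : set (measurableTypeR R)) (fun r => (p (psi r))%:E) ->
    `|\int[leb1]_(r in `]0, t[) p (psi r)| <= eps / 3.
  move=> hp ip; apply: le_trans (le_normr_Rintegral mD ip) _.
  rewrite -lee_fin /Rintegral fineK; last first.
    by apply: integrable_fin_num => //; exact: integrable_abse ip.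
  apply: le_trans h1; apply: ge0_integral_mono => r _; first by rewrite lee_fin.
  rewrite simple_funE L2dist_nrm lee_fin; apply: le_trans (hp _) _.
  by rewrite /psi -coefB cabs_coef.
have k2 : cabs (tint 0 t psi) <= eps / 3 + eps / 3.
  apply: le_trans (cabs_le _) _; apply: lerD; apply: kpsi => //.
    exact: ler_Re_cabs.
  exact: ler_Im_cabs.
rewrite cintegralB// -cS in k2.
rewrite (_ : _ - _ = (coef e (of_L2 hw) i - coef e S i) -
  (tint 0 t (fun r => coef e (Phi r) i) - coef e S i)); last by ring.
apply: le_trans (cabsD _ _) _; rewrite cabsN; apply: le_trans (lerD k1 k2) _.
by lra.
Qed.

Section Steps.
Variables (Phi : R -> E) (t : R).

Definition step_cell n (j : 'I_n.+1) : set (measurableTypeR R) :=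
  `[t * j%:R / n.+1%:R, t * j.+1%:R / n.+1%:R[%classic.

Definition step_simple n : L2simple R :=
  {| ncell := n.+1; cell := @step_cell n;
     value := fun j : 'I_n.+1 => Phi (t * j%:R / n.+1%:R);
     measurable_cell := fun j => measurable_itv _;
     L2_value := fun j => torus_l2P _ |}.

Lemma step_simpleE n r : 0 < r < t -> exists u, simple_l2 (step_simple n) r = Phi u /\
  `|r - u| <= t / n.+1%:R.
Proof.
move=> /andP[r0 rt]; have t0 : 0 < t by exact: lt_trans rt.
have n0 : 0 < n.+1%:R :> R by [].
(* The integer part of [q] is the number of the cell containing [r]; the value there is taken at the
   left end of the cell. *)
pose q := r * n.+1%:R / t; have q0 : 0 <= q by rewrite divr_ge0 ?mulr_ge0// ltW.
have /andP[j1 j2] := truncn_itv q0; set j := Num.trunc q in j1 j2.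
have jn : (j < n.+1)%N.
  by rewrite truncn_lt_nat// /q ltr_pdivrMr// mulrC ltr_pM2l.
have cE (k : nat) : (t * k%:R / n.+1%:R <= r) = (k%:R <= q).
  by rewrite /q ler_pdivrMr// ler_pdivlMr// mulrC.
have lE (k : nat) : (r < t * k%:R / n.+1%:R) = (q < k%:R) by rewrite !ltNge cE.
exists (t * j%:R / n.+1%:R); split.
  rewrite /simple_l2 /= (bigD1 (Ordinal jn))//= big1 ?addr0 => [|k kj].
    rewrite indicE mem_set; last by rewrite /step_cell /= in_itv /= cE lE j1.
    by rewrite [(_%:R)%:C%C](_ : _ = 1)// scale1r /simple_value of_L2E.
  rewrite indicE memNset ?scale0r// /step_cell /= in_itv /= cE lE => kq.
  move/eqP: kj; apply; apply: val_inj => /=; rewrite /j; symmetry.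
  exact: truncn_def.
have l1 : t * j%:R / n.+1%:R <= r by rewrite cE.
have : r < t * j.+1%:R / n.+1%:R by rewrite lE.
rewrite -natr1 mulrDr mulr1 mulrDl => l2.
by rewrite ger0_norm ?subr_ge0// lerBlDl ltW.
Qed.

Hypotheses (t0 : 0 <= t) (uP : ucont H Phi).

Lemma step_uniform eps : 0 < eps -> \forall n \near \oo, forall r, `]0, t[%classic r ->
  nrm H (Phi r - simple_l2 (step_simple n) r) <= eps.
Proof.
move=> e0; have [d [d0 hd]] := uP e0; near=> n => r /=; rewrite in_itv /= => hr.
have [u [-> ru]] := step_simpleE n hr; apply: hd; apply: le_trans ru _.
rewrite ler_pdivrMr// mulrC -ler_pdivrMr//.
apply: le_trans (ltW (truncnS_gt _)) _; rewrite ler_nat ltnS.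
by near: n; exact: nbhs_infty_ge.
Unshelve. all: by end_near.
Qed.

(** Step functions on equal cells converge uniformly to a uniformly continuous integrand, which
    gives the three limits of the definition at once. *)
Lemma bochner_ucont z : (forall i, coef e z i = tint 0 t (fun r => coef e (Phi r) i)) ->
  is_bochner_integral `]0, t[%classic (fun r => Phi r) z.
Proof.
move=> hz; have mD : @measurable _ (measurableTypeR R) `]0, t[%classic by exact: measurable_itv.
have d0 v : (0 <= L2norm v :> \bar R)%E by exact: Lnorm_ge0.
split; [by move=> r _; exact: torus_l2P|exact: torus_l2P|exists step_simple; split].
- apply/aeW => r Dr; apply/ecvg0P => [n|eps e0]; first exact: d0.
  by apply: filterS (step_uniform e0) => n hn; rewrite simple_funE L2dist_nrm lee_fin hn.
- apply/ecvg0P => [n|eps e0]; first by apply: integral_ge0 => r _; exact: d0.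
  have e1 : 0 < eps / (t + 1) by rewrite divr_gt0// ltr_wpDl.
  apply: filterS (step_uniform e1) => n hn.
  apply: (@le_trans _ _ (\int[leb1]_(r in `]0%R, t[) (eps / (t + 1))%:E)%E).
    apply: ge0_integral_mono => r Dr; first exact: d0.
    by rewrite simple_funE L2dist_nrm lee_fin hn.
  rewrite integral_cst// -[X in (_ * X)%E]fineK; last first.
    by rewrite ge0_fin_numE ?measure_ge0//; exact: itv_finite.
  rewrite itvD_measure// subr0 -EFinM lee_fin mulrC.
  by apply: mulr_div1D => //; exact: ltW.
- apply/ecvg0P => [n|eps e0]; first exact: d0.
  have e1 : 0 < eps / (t + 1) by rewrite divr_gt0// ltr_wpDl.
  apply: filterS (step_uniform e1) => n hn.
  rewrite simple_integralE L2dist_nrm lee_fin nrmBC.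
  apply: le_trans (_ : t * (eps / (t + 1)) <= _); last first.
    by apply: mulr_div1D => //; exact: ltW.
  rewrite -[X in X * _]subr0.
  set v := simple_l2 (step_simple n); pose Psi r := Phi r - v r.
  have cPsi i : (fun r => coef e (Psi r) i) = (fun r => coef e (Phi r) i - coef e (v r) i).
    by apply/funext => r; rewrite /Psi coefB.
  have iP i := ucont_tintble e i 0 t uP.
  have h1 i : tintble 0 t (fun r => coef e (Psi r) i).
    by have [iS _] := coef_simple_integral t (step_simple n) i; rewrite cPsi; exact: cintbleB.
  have h2 r : r \in `]0, t[ -> nrm H (Psi r) <= eps / (t + 1) by move=> rt; exact: hn.
  apply: (vint_bound t0 (ltW e1) h1 h2) => i.
  have [iS cS] := coef_simple_integral t (step_simple n) i.
  transitivity (tint 0 t (fun r => coef e (Phi r) i - coef e (v r) i)).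
    rewrite (cintegralB mD (iP i) iS) -hz -cS.
    exact: coefB.
  by congr (cintegral _ _ _); rewrite cPsi.
Qed.

End Steps.

End Bochner.

(** * Mild solutions and controllability *)

Lemma ucont_eqv (R : realType) (E : lmodType R[i]) (H : hilbert E) (F F' : R -> E) :
  (forall s, nrm H (F' s - F s) = 0) -> ucont H F -> ucont H F'.
Proof.
move=> h uF eps e0; have [d [d0 hd]] := uF eps e0; exists d; split=> // s s' ss.
apply: le_trans (nrm_tri _ (F s) _ _) _; rewrite h add0r.
apply: le_trans (nrm_tri _ (F s') _ _) _; rewrite [X in _ + X]nrmBC h addr0.
exact: hd.
Qed.

Lemma nrm_eqv_trans (R : realType) (E : lmodType R[i]) (H : hilbert E) (x y z : E) :
  nrm H (x - y) = 0 -> nrm H (y - z) = 0 -> nrm H (x - z) = 0.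
Proof.
move=> xy yz; apply/eqP; rewrite eq_le nrm_ge0 andbT.
by apply: le_trans (nrm_tri _ y _ _) _; rewrite xy yz addr0.
Qed.

Section Duhamel.
Variable R : realType.
Local Notation leb1 := (@lebesgue_measure R).

Lemma tint_chasles (f : R -> R[i]) s t : 0 <= s -> s < t ->
  cintble leb1 (`]0, t[%classic : set (measurableTypeR R)) f ->
  tint 0 t f - tint 0 s f = tint s t f.
Proof.
move=> s0 st [fR fI].
have mt : @measurable _ (measurableTypeR R) `]0, t[%classic by exact: measurable_itv.
have ms : @measurable _ (measurableTypeR R) `]0, s[%classic by exact: measurable_itv.
have sub : (`]0, s[ : set (measurableTypeR R)) `<=` `]0, t[.
  by move=> x /=; rewrite !in_itv /= => /andP[-> xs] /=; exact: lt_trans st.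
have key (p : R -> R) : leb1.-integrable (`]0, t[%classic : set (measurableTypeR R)) (EFin \o p) ->
    \int[leb1]_(x in `]0, t[) p x - \int[leb1]_(x in `]0, s[) p x = \int[leb1]_(x in `]s, t[) p x.
  move=> ip; rewrite -(@Rintegral_itvB _ _ _ _ s ip).
  - by rewrite [X in _ - X = _]Rintegral_itv_bndo_bndc//;
      exact: (integrableS mt ms sub ip).
  - by rewrite bnd_simp.
  - by rewrite bnd_simp.
by apply: complexP; rewrite ReD ReN || rewrite ImD ImN; exact: key.
Qed.

Variables (E : lmodType R[i]) (H : hilbert E) (I : countType) (e : hbasis H I).
Variables (U : R -> E -> E) (om : I -> R) (G : E -> E) (CG : R).
Hypothesis HU : forall t x i, coef e (U t x) i = cis (t * om i) * coef e x i.
Hypothesis HG : forall x y, hip H (G x) y = hip H x (G y).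
Hypothesis CG0 : 0 <= CG.
Hypothesis nrmG : forall x, nrm H (G x) <= CG * nrm H x.

Lemma duhamel_lipschitz x s t : 0 <= s -> s <= t ->
  nrm H (duhamel e U G x t - duhamel e U G x s) <= (t - s) * (CG * nrm H x).
Proof.
move=> s0; rewrite le_eqVlt => /orP[/eqP <-|st]; first by rewrite !subrr nrm0 mul0r.
have t0 : 0 <= t by apply: ltW; exact: le_lt_trans st.
have up := ucont_pullback HU HG CG0 nrmG x.
apply: (@vint_bound _ _ _ _ e s t (pullback U G x)) => //.
- exact: ltW.
- by rewrite mulr_ge0 ?nrm_ge0.
- by move=> i; exact: ucont_tintble.
- by move=> r _; exact: (nrm_pullback HU nrmG).
move=> i; rewrite coefB !(coef_duhamel HU HG CG0 nrmG)//.
by apply: tint_chasles => //; exact: ucont_tintble.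
Qed.

(** Freezing the vector at time [t] leaves the orbit of a fixed vector, continuous by [ucontU]; the
    change of vector is Lipschitz and [U s] preserves its norm. *)
Lemma ucont_flow_duhamel y x t eps : 0 < eps -> 0 <= t ->
  exists d, 0 < d /\ forall s, 0 <= s -> `|s - t| <= d ->
    nrm H (U s (y + duhamel e U G x s) - U t (y + duhamel e U G x t)) <= eps.
Proof.
move=> e0 t0; have e2 : 0 < eps / 2 by rewrite divr_gt0.
have [d [d0 hd]] := ucontU HU (y + duhamel e U G x t) e2.
pose L := CG * nrm H x + 1; have L0 : 0 < L by rewrite ltr_wpDl// mulr_ge0 ?nrm_ge0.
exists (Num.min d (eps / 2 / L)); split; first by rewrite lt_min d0 divr_gt0.
move=> s' s0; rewrite le_min => /andP[sd sL].
apply: le_trans (nrm_tri _ (U s' (y + duhamel e U G x t)) _ _) _.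
rewrite (_ : eps = eps / 2 + eps / 2); last by lra.
apply: lerD; last exact: hd.
rewrite (nrmUB HU) [X in nrm H X](_ : _ = duhamel e U G x s' - duhamel e U G x t); last first.
  by rewrite opprD addrACA subrr add0r.
have lip : nrm H (duhamel e U G x s' - duhamel e U G x t) <= `|s' - t| * (CG * nrm H x).
  have [h|h] := leP s' t.
    by rewrite nrmBC distrC ger0_norm ?subr_ge0//; exact: duhamel_lipschitz.
  by rewrite ger0_norm ?subr_ge0 ?(ltW h)//; apply: duhamel_lipschitz => //; exact: ltW.
apply: le_trans lip _; apply: le_trans (_ : `|s' - t| * L <= _).
  by rewrite ler_wpM2l// /L lerDl.
by rewrite -ler_pdivlMr.
Qed.

End Duhamel.

Section KPGroup.
Variable R : realType.
Local Notation E := (torus_l2 R).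
Local Notation H := (torus_hilbert R).
Local Notation e := (torus_basis R).

(** With [dx = i k] and [dy = i l] the symbol equals [i (k ^ 3 - l ^ 2 / k)]. At [k = 0] both sides
    use the inverse of 0 being 0. *)
Lemma cexp_kp_symbol (t : R) (k l : int) :
  cexp (t%:C%C * kp_symbol R k l) = cis (t * kpfreq R l k).
Proof.
rewrite -cexp_iR; congr cexp; rewrite /kp_symbol /kpfreq.
have ii : 'i%C * 'i%C = -1 :> R[i] by apply: complexP; rewrite !cE /=; ring.
have intC (n : int) : n%:~R = (n%:~R)%:C%C :> R[i] by rewrite rmorph_int.
have [->|k0] := eqVneq k 0.
  by rewrite !mulr0z !mulr0 !expr0n /= !invr0 !(mul0r, mulr0, addr0, oppr0, subr0).
have kR : (k%:~R)%:C%C != 0 :> R[i] by rewrite -intC intr_eq0.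
have i0 : 'i%C != 0 :> R[i].
  apply/eqP => h; move: ii; rewrite h mul0r => /eqP.
  by rewrite eq_sym oppr_eq0 oner_eq0.
rewrite !intC [in RHS]rmorphM [in RHS]rmorphB fmorph_div !rmorphXn /=.
rewrite (_ : ('i%C * _)^-1 = - 'i%C / (k%:~R)%:C%C); last first.
  by rewrite invfM; congr (_ * _); apply: (mulfI i0); rewrite mulrN ii opprK mulfV.
set K := (k%:~R)%:C%C in kR *; set L := (l%:~R)%:C%C.
have -> : ('i%C * K) ^+ 3 = - ('i%C * K ^+ 3) :> R[i].
  by rewrite (_ : _ ^+ 3 = ('i%C * 'i%C) * 'i%C * K ^+ 3); [rewrite ii mulN1r mulNr|ring].
have -> : ('i%C * L) ^+ 2 = - (L ^+ 2) :> R[i].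
  by rewrite (_ : _ ^+ 2 = ('i%C * 'i%C) * L ^+ 2); [rewrite ii mulN1r|ring].
by rewrite [LHS](_ : _ = t%:C%C * ('i%C * (K ^+ 3 - L ^+ 2 / K))); ring.
Qed.

Lemma zero_meanP (x : E) : zero_mean x <-> L20 x.
Proof.
have tp : ((2 * pi)^-1)%:C%C != 0 :> R[i].
  by apply/eqP => /(congr1 Re) /= /eqP; rewrite invr_eq0 gt_eqF// twopi_gt0.
split=> [hx|[_ hx] l]; first by split=> [|l]; [exact: torus_l2P|rewrite fourier_coef hx mulr0].
by have /eqP := hx l; rewrite fourier_coef mulf_eq0 (negbTE tp) /= => /eqP.
Qed.

Lemma zero_mean_flow t (x : E) : zero_mean x -> zero_mean (kp_flow t x).
Proof. by move=> hx l; rewrite coef_kp_flow hx mulr0. Qed.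

(** The flow witnesses that the choice behind [kp_group] is not the default; the chosen function
    then has the coefficients of the flow, so it is at distance 0 from it. *)
Lemma kp_group_spec t (x : E) : zero_mean x -> L20 (kp_group t x) /\
  forall h : L2 (kp_group t x), nrm H (of_L2 h - kp_flow t x) = 0.
Proof.
move=> hx; have tp : ((2 * pi)^-1)%:C%C != 0 :> R[i].
  by apply/eqP => /(congr1 Re) /= /eqP; rewrite invr_eq0 gt_eqF// twopi_gt0.
have [h1 h2] : [set w | L20 w /\ forall k l, fourier w k l =
    cexp (t%:C%C * kp_symbol R k l) * fourier x k l] (kp_group t x).
  apply: xgetPex; exists (l2val (kp_flow t x)); split; first exact/zero_meanP/zero_mean_flow.
  by move=> k l; rewrite !fourier_coef coef_kp_flow cexp_kp_symbol mulrCA.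
split=> // h; apply: (eq_coef (e := e)) => -[k l]; rewrite coef_kp_flow.
have := h2 k l; rewrite -[kp_group t x]/(l2val (of_L2 h)) !fourier_coef cexp_kp_symbol mulrCA.
exact: mulfI.
Qed.

End KPGroup.

Section Controllability.
Variable R : realType.
Local Notation leb1 := (@lebesgue_measure R).
Local Notation leb2 := (leb1 \x leb1)%E.
Local Notation E := (torus_l2 R).
Local Notation H := (torus_hilbert R).
Local Notation e := (torus_basis R).
Variables (g : R -> R) (B : R).
Hypothesis g_cont : continuous g.
Hypothesis g_ge0 : forall x, 0 <= g x.
Hypothesis g_le : forall x, @torus R x -> g x <= B.
Hypothesis g_int : \int[leb1]_(x in @torus R) g x = 1.
Local Notation G := (control g_cont g_ge0 g_le g_int).
Local Notation U := (@kp_flow R).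
Let HU := @coef_kp_flow R.
Let HG := control_selfadjoint g_cont g_ge0 g_le g_int.
Let BG := control_bound g_cont g_ge0 g_le g_int.
Let B0 : 0 <= B.
Proof.
by apply: le_trans (g_ge0 0) (g_le _); rewrite /torus /= in_itv /= lexx mulr_gt0// pi_gt0.
Qed.

Variable alpha : E.
Hypothesis alpha0 : zero_mean alpha.
Local Notation I t := (duhamel e U G alpha t).

Definition kp_control (t : R) : field2 R := kp_group t alpha.

Let h_l2 t : L2 (kp_control t). Proof. by have [[]] := kp_group_spec t alpha0. Qed.

Definition kp_control_l2 (t : R) : E := of_L2 (h_l2 t).

Lemma kp_control_eqv t : nrm H (kp_control_l2 t - U t alpha) = 0.
Proof. by have [_] := kp_group_spec t alpha0; apply. Qed.

Let G0 x : zero_mean (G x).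
Proof. by move=> l; exact: coef_control0. Qed.

Let F_l2 t s : L2 (kp_group (t - s) (control_op g (kp_control s))).
Proof. by have [[]] := kp_group_spec (t - s) (@G0 (kp_control_l2 s)). Qed.

Definition kp_integrand t s : E := of_L2 (F_l2 t s).

Lemma kp_integrand_eqv t s : nrm H (kp_integrand t s - U (t - s) (G (U s alpha))) = 0.
Proof.
have [_ hs] := kp_group_spec (t - s) (@G0 (kp_control_l2 s)).
apply: (nrm_eqv_trans (hs (F_l2 t s))).
apply/eqP; rewrite eq_le nrm_ge0 andbT (nrmUB HU); apply: le_trans (nrmGB e HG BG _ _) _.
by rewrite kp_control_eqv mulr0.
Qed.

Lemma ucont_kp_integrand t : ucont H (kp_integrand t).
Proof. exact: ucont_eqv (kp_integrand_eqv t) (ucont_orbit HU HG B0 BG alpha t). Qed.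

(** Combines [U t] and [U (- s)] into [U (t - s)]: the Duhamel integral of the equation is the flow
    applied to the pulled back integral. *)
Lemma coef_kp_duhamel t i : 0 <= t ->
  coef e (U t (I t)) i = tint 0 t (fun s => coef e (kp_integrand t s) i).
Proof.
move=> t0; rewrite HU (coef_duhamel HU HG B0 BG)// -cintegralZ//; last first.
  by apply: ucont_tintble; exact: ucont_pullback HU HG B0 BG alpha.
apply: eq_cintegral => s _.
rewrite /coef (ip_eqvl _ (kp_integrand_eqv t s)) -!/(coef _ _ _) (coef_pullback G HU) HU mulrA -cisD.
by congr (cis _ * _); ring.
Qed.

Lemma duhamel_zero_mean t : 0 <= t -> zero_mean (I t).
Proof.
move=> t0 l; rewrite (coef_duhamel HU HG B0 BG)//.
have mD : @measurable _ (measurableTypeR R) `]0, t[%classic by exact: measurable_itv.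
rewrite -[RHS](cintegral0 leb1 mD); apply: eq_cintegral => s _.
by rewrite (coef_pullback G HU) coef_control0 mulr0.
Qed.

Lemma kp_mild T (u0 : E) : zero_mean u0 ->
  mild_solution T u0 (fun t => control_op g (kp_control t)) (fun t => U t (u0 + I t)).
Proof.
move=> hu0; split=> [t|t|t]; rewrite in_itv /= => /andP[t0 tT].
- have h : zero_mean (u0 + I t) by move=> l; rewrite coefD hu0 add0r duhamel_zero_mean.
  exact: (proj1 (zero_meanP _) (zero_mean_flow t h)).
- apply/ecvg0P => [s|eps e0]; first exact: Lnorm_ge0.
  have [d [d0 hd]] := ucont_flow_duhamel HU HG B0 BG u0 alpha e0 t0.
  apply/nbhs_ballP; exists d => //= s sd sT.
  rewrite L2dist_nrm lee_fin; apply: hd; first by move: sT; rewrite /= in_itv /= => /andP[].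
  by apply: ltW; rewrite distrC.
- exists (U t (I t)); split.
    exact: (bochner_ucont t0 (ucont_kp_integrand t) (fun i => coef_kp_duhamel i t0)).
  have [[hk _] ek] := kp_group_spec t hu0.
  have h : L2eq (U t (u0 + I t)) (of_L2 hk + U t (I t)).
    apply: L2eq_coef => i; rewrite coefD HU coefD mulrDr -!HU; congr (_ + _).
    by apply: esym; exact: (ip_eqvl _ (ek hk)).
  by apply: filterS h => z hz Dz; rewrite (hz Dz) l2_addE.
Qed.

(** The solution is arbitrary: at time [T] its Bochner integral must be [U T] of the Gramian, so the
    state is [U T u0 + U T (U (- T) u1 - u0) = u1]. *)
Lemma kp_mild_endpoint T (u0 u1 : E) u : 0 <= T -> zero_mean u0 ->
  nrm H (I T - (U (- T) u1 - u0)) = 0 ->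
  mild_solution T u0 (fun t => control_op g (kp_control t)) u -> L2eq (u T) u1.
Proof.
move=> T0 hu0 hI [_ _ /(_ T)]; rewrite in_itv /= T0 lexx => /(_ isT) [w [bw uw]].
have [_ hw _] := bw; have cw := bochner_coef hw T0 (ucont_kp_integrand T) bw.
have [[hk _] ek] := kp_group_spec T hu0.
have h : L2eq (of_L2 hk + of_L2 hw) u1.
  apply: L2eq_coef => i; rewrite coefD cw -coef_kp_duhamel//.
  have -> : coef e (of_L2 hk) i = coef e (U T u0) i by exact: (ip_eqvl _ (ek hk)).
  have eI : coef e (I T) i = coef e (U (- T) u1 - u0) i by exact: (ip_eqvl _ hI).
  rewrite !HU eI coefB HU -mulrDr addrC subrK.
  by rewrite mulrA mulNr mulcisN mul1r.
by apply: filterS2 uw h => z h1 h2 Dz; rewrite h1// -h2.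
Qed.

Lemma kp_control_L2_time T : 0 < T -> L2_time T kp_control.
Proof.
move=> T0; have uh : ucont H kp_control_l2.
  exact: ucont_eqv kp_control_eqv (ucontU HU alpha).
have nh t : nrm H (kp_control_l2 t) = nrm H alpha by rewrite (nrm_eqv (kp_control_eqv t)) (nrmU HU).
have mD : @measurable _ (measurableTypeR R) `]0, T[%classic by exact: measurable_itv.
split.
  split=> [t _|]; first exact: h_l2.
  have [z hz] := vint_exists (ltW T0) (nrm_ge0 H alpha)
    (fun i => ucont_tintble e i 0 T uh) (fun t _ => eq_ind_r (fun r => r <= _) (lexx _) (nh t)).
  by have [_ _ [s [hs _ _]]] := bochner_ucont (ltW T0) uh hz; exists s.
rewrite (eq_integral (fun=> (nrm H alpha ^+ 2)%:E)); last first.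
  by move=> t _; rewrite -[kp_control t]/(l2val (kp_control_l2 t)) L2norm_nrm nh EFin_expe.
rewrite integral_cst// -[X in (_ * X)%E]fineK; last first.
  by rewrite ge0_fin_numE ?measure_ge0//; exact: itv_finite.
by rewrite -EFinM ltry.
Qed.

End Controllability.

Theorem theorem1p1 (R : realType) (a b : R) (hab : a < b)
  (hab2 : b <= a + 2 * pi) (g : R -> R) (hg : control_profile a b g)
  (T : R) (hT : 0 < T) (u0 u1 : field2 R) (hu0 : L20 u0) (hu1 : L20 u1) :
  exists h : R -> field2 R,
    L2_time T h /\
    (exists u : R -> field2 R,
       mild_solution T u0 (fun t => control_op g (h t)) u) /\
    (forall u : R -> field2 R,
       mild_solution T u0 (fun t => control_op g (h t)) u ->
       L2eq (u T) u1).
Proof.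
have [gC2 gper g0 _ gint] := hg.
have gc := weight_continuous gC2; have [B _ gB] := weight_bounded gC2.
have obs := weight_observability gC2 gper g0 gint hT.
pose x0 := of_L2 hu0.1; pose x1 := of_L2 hu1.1.
have hx0 : zero_mean x0 by apply/zero_meanP.
have hx1 : zero_mean x1 by apply/zero_meanP.
(* The target of the Gramian: the difference of the final and initial states once both are carried
   back to time 0. *)
have hd : zero_mean (kp_flow (- T) x1 - x0).
  by move=> l; rewrite coefB hx0 subr0; exact: zero_mean_flow.
have [alpha ha hI] := kp_gramian_surjective gc g0 gB gint hT obs hd.
exists (kp_control alpha); split; first exact: kp_control_L2_time.
split; first by eexists; exact: (kp_mild gc g0 gB gint ha T hx0).
by move=> u hu; exact: (kp_mild_endpoint ha (ltW hT) hx0 hI hu).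
Qed.
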